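(* Let $\chi\in C_c^\infty(\mathbb{R}^d)$ with $\mathbf 1_{B(0,1)}\le\chi\le\mathbf 1_{B(0,2)}$ and let $(q(x,\cdot))_{x\in\mathbb{R}^d}$ be a family of continuous negative definite functions of the form $$q(x,\xi)=q(x,0)-ib(x)\cdot\xi+\int_{y\ne0}\big(1-e^{iy\cdot\xi}+iy\cdot\xi\,\chi(y)\big)\,\nu(x,dy)$$ (no diffusion part). Suppose $q$ is locally bounded, i.e. for every compact $K\subseteq\mathbb{R}^d$ there is $c>0$ with $|q(x,\xi)|\le c(1+|\xi|^2)$ for $x\in K$, $\xi\in\mathbb{R}^d$. Then the following are equivalent: (i) $x\mapsto q(x,\xi)-q(x,0)$ is continuous for all $\xi\in\mathbb{R}^d$; (ii) $x\mapsto q(x,\xi)-q(x,0)$ is continuous for all $\xi$, and $\lim_{|\xi|\to0}\sup_{x\in K}|q(x,\xi)-q(x,0)|=0$ for every compact $K$; (iii) all of: (a) $x\mapsto b(x)$ is continuous; (b) $x\mapsto\nu(x,\cdot)$ is vaguely continuous on $\mathbb{R}^d\setminus\{0\}$, i.e. $\int f(y)\nu(z,dy)\to\int f(y)\nu(x,dy)$ as $z\to x$ for all $f\in C_c(\mathbb{R}^d\setminus\{0\})$ and $x\in\mathbb{R}^d$; (c) $\lim_{R\to\infty}\sup_{x\in K}\nu(x,B(0,R)^c)=0$ for every compact $K$; (d) $\lim_{r\to0}\sup_{x\in K}\int_{|y|\le r}|y|^2\nu(x,dy)=0$ for every compact $K$; (iv) the pseudo-differential operator $f\mapsto-\int e^{ix\cdot\xi}(q(x,\xi)-q(x,0))\hat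 f(\xi)d\xi$ maps $C_c^\infty(\mathbb{R}^d)$ into $C(\mathbb{R}^d)$.
   Context: $\hat f(\xi)=(2\pi)^{-d}\int e^{-ix\cdot\xi}f(x)dx$. For each $x$, $b(x)\in\mathbb{R}^d$ and $\nu(x,\cdot)$ is a measure on $\mathbb{R}^d\setminus\{0\}$ with $\int\min\{|y|^2,1\}\nu(x,dy)<\infty$; $q(x,0)\ge0$. *)

(* Defs.v *)
From mathcomp Require Import all_boot all_order all_algebra.
From mathcomp Require Import all_classical all_reals all_analysis.
From mathcomp Require Import complex.
Import Order.TTheory GRing.Theory Num.Theory.
Import numFieldNormedType.Exports.

Set Implicit Arguments.
Unset Strict Implicit.
Unset Printing Implicit Defensive.

Local Open Scope classical_set_scope.
Local Open Scope ring_scope.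

Section Defs.
Variable R : realType.

Definition dotp (d : nat) (x y : 'rV[R]_d) : R := \sum_(i < d) x 0 i * y 0 i.
Definition enorm (d : nat) (y : 'rV[R]_d) : R := Num.sqrt (dotp y y).

(* generated by the open sets of R^d (product = Euclidean topology) *)
Definition BRd (d : nat) := g_sigma_algebraType (@open 'rV[R]_d).

Definition punct (d : nat) : set (BRd d) := [set y : 'rV[R]_d | y != 0].

Definition expi (t : R) : R[i] := Complex (cos t) (sin t).
Definition cmod (z : R[i]) : R := Num.sqrt (complex.Re z ^+ 2 + complex.Im z ^+ 2).
Definition rC (t : R) : R[i] := Complex t 0.
Definition iC : R[i] := Complex 0 1.

Definition ccontinuous (d : nat) (g : 'rV[R]_d -> R[i]) :=
  continuous (fun x => complex.Re (g x)) /\ continuous (fun x => complex.Im (g x)).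

Definition cmintegral (d : nat) (mu : {measure set (BRd d) -> \bar R})
  (D : set (BRd d)) (g : 'rV[R]_d -> R[i]) : R[i] :=
  Complex (Rintegral mu D (fun y => complex.Re (g y)))
          (Rintegral mu D (fun y => complex.Im (g y))).

(* Lebesgue integral over R^d, written as the iterated Lebesgue integral
   over R (Fubini) *)
Fixpoint iint (n : nat) : ('rV[R]_n -> R) -> R :=
  match n return ('rV[R]_n -> R) -> R with
  | 0 => fun g => g 0
  | n'.+1 => fun g =>
      Rintegral (@lebesgue_measure R) setT
        (fun t : R => iint (fun v : 'rV[R]_n' => g (row_mx (const_mx t : 'rV[R]_1) v)))
  end.

Definition cint (d : nat) (g : 'rV[R]_d -> R[i]) : R[i] :=
  Complex (iint (fun x => complex.Re (g x))) (iint (fun x => complex.Im (g x))).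

Definition fourier (d : nat) (f : 'rV[R]_d -> R) (xi : 'rV[R]_d) : R[i] :=
  rC ((2 * pi) ^- d) * cint (fun x => expi (- dotp x xi) * rC (f x)).

Fixpoint iderive (d : nat) (vs : seq 'rV[R]_d) (f : 'rV[R]_d -> R) : 'rV[R]_d -> R :=
  if vs is v :: vs' then 'D_v (iderive vs' f) else f.

Definition smooth (d : nat) (f : 'rV[R]_d -> R) :=
  forall vs : seq 'rV[R]_d,
    continuous (iderive vs f) /\ (forall v x, derivable (iderive vs f) x v).

Definition supp (d : nat) (f : 'rV[R]_d -> R) := closure [set x | f x != 0].

Definition Cc_inf (d : nat) (f : 'rV[R]_d -> R) := smooth f /\ compact (supp f).

Definition qsym (d : nat) (q0 : 'rV[R]_d -> R) (b : 'rV[R]_d -> 'rV[R]_d)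
  (nu : 'rV[R]_d -> {measure set (BRd d) -> \bar R}) (chi : 'rV[R]_d -> R)
  (x xi : 'rV[R]_d) : R[i] :=
  rC (q0 x) - iC * rC (dotp (b x) xi)
  + cmintegral (nu x) (@punct d)
      (fun y => 1 - expi (dotp y xi) + iC * rC (dotp y xi * chi y)).

Definition cond_i (d : nat) (q : 'rV[R]_d -> 'rV[R]_d -> R[i]) :=
  forall xi, ccontinuous (fun x => q x xi - q x 0).

Definition cond_ii (d : nat) (q : 'rV[R]_d -> 'rV[R]_d -> R[i]) :=
  cond_i q /\
  forall K : set 'rV[R]_d, compact K ->
    forall e : R, 0 < e -> exists2 del : R, 0 < del &
      forall xi, enorm xi < del -> forall x, K x -> cmod (q x xi - q x 0) <= e.

Definition cond_iii (d : nat) (b : 'rV[R]_d -> 'rV[R]_d)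
  (nu : 'rV[R]_d -> {measure set (BRd d) -> \bar R}) :=
  [/\ (* (a) *) continuous b,
      (forall f : 'rV[R]_d -> R, continuous f -> compact (supp f) -> ~ supp f 0 ->
         continuous (fun z => Rintegral (nu z) (@punct d) f)),
      (forall K : set 'rV[R]_d, compact K ->
         forall e : R, 0 < e -> exists M : R, forall r : R, M < r ->
           forall x, K x -> (nu x (~` [set y : 'rV[R]_d | (enorm y < r)%R]) <= e%:E)%E) &
      (forall K : set 'rV[R]_d, compact K ->
         forall e : R, 0 < e -> exists2 del : R, 0 < del & forall r : R, 0 < r -> r < del ->
           forall x, K x ->
             (\int[nu x]_(y in @punct d `&` [set y : 'rV[R]_d | (enorm y <= r)%R])
                 (enorm y ^+ 2)%:E <= e%:E)%E)].

Definition cond_iv (d : nat) (q : 'rV[R]_d -> 'rV[R]_d -> R[i]) :=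
  forall f : 'rV[R]_d -> R, Cc_inf f ->
    ccontinuous (fun x => - cint (fun xi => expi (dotp x xi) * (q x xi - q x 0) * fourier f xi)).

End Defs.

(* Main.v *)
(** The implications form the cycle (i) => (iv) => (iii) => (ii) => (i).

    (i) => (iv): the transform of a test function decays faster than any
    polynomial, so the local bound on q allows dominated convergence.

    (iv) => (iii): Fourier inversion, up to a universal positive constant,
    identifies the real part of the pseudo-differential operator with a multiple
    of the Levy generator
      L f(x) = b(x).grad f(x) + int (f(x+y) - f(x) - chi(y) y.grad f(x)) nu(x, dy),
    so L f is continuous for every test function f. Near a point x0 one applies
    this to translates to x0 of suitable functions: chi(y/s) bounds the tails of
    nu(x, .) by those of nu(x0, .), which gives (c); y_j chi(y) isolates the drift
    and gives (a); |y|^2 chi(y/s) gives (d); mollifications of f give (b).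

    (iii) => (ii): (c) and (d) allow the Levy-Khintchine integrand to be cut off
    near 0 and near infinity uniformly in x, and (b) applies to what remains; the
    equicontinuity at xi = 0 follows from the same cut-off. *)

From HB Require Import structures.
Require Import Defs.
From mathcomp Require Import all_boot all_order all_algebra.
From mathcomp Require Import all_classical all_reals all_analysis.
From mathcomp Require Import complex.
From mathcomp Require Import measurable_realfun ring lra.
Import Order.TTheory GRing.Theory Num.Theory.
Import numFieldNormedType.Exports.
Set Implicit Arguments.
Unset Strict Implicit.
Unset Printing Implicit Defensive.
Local Open Scope classical_set_scope.
Local Open Scope ring_scope.

(** * Dominated integrals *)

Section integral_tools.
Context {dd : measure_display} {T : measurableType dd} {R : realType}.
Variable mu : {measure set T -> \bar R}.

(** The integral over R^d is a nest of one-dimensional real integrals, so linearity, substitution,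
    Fubini and dominated convergence are proved for it by induction on the dimension, for continuous
    integrands below a multiple of the product of the weights [(1 + v_i^2)^-1]. This weight fits the
    problem: transforms of test functions are bounded by its square, and the growth [1 + |xi|^2] of
    the symbol uses up only one of the two factors. Since inversion is needed only up to a positive
    factor, [chi] itself serves as summability kernel. From the generator to the characteristics,
    the difficulty is that knowledge at [x0] must control [nu x] for all [x] near [x0]. A test
    function centred at [x0] is seen from [x] with displacement [h = x - x0]; this perturbs the jump
    integrand by an amount that is small with [h] but does not decay in [y]. Hence a local bound on
    the mass away from the origin comes first. The drift precedes the small jumps, because it enters
    their estimate with a factor [h] and has to be locally bounded. *)

Lemma integrable_dominated (D : set T) (f g : T -> R) :
  measurable D -> measurable_fun D f -> (forall x, D x -> `|f x| <= g x) ->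
  mu.-integrable D (EFin \o g) -> mu.-integrable D (EFin \o f).
Proof.
move=> mD mf fg; apply: le_integrable => //; first exact/measurable_EFinP.
by move=> x Dx /=; rewrite lee_fin (le_trans (fg x Dx))// ler_norm.
Qed.

Lemma Rintegral_dct (D : set T) (f_ : nat -> T -> R) (f g : T -> R) :
  measurable D -> (forall n, measurable_fun D (f_ n)) ->
  (forall x, D x -> f_ n x @[n --> \oo] --> f x) ->
  mu.-integrable D (EFin \o g) ->
  (forall n x, D x -> `|f_ n x| <= g x) ->
  Rintegral mu D (f_ n) @[n --> \oo] --> Rintegral mu D f.
Proof.
move=> mD mf_ cf ig fg.
have mf : measurable_fun D f by exact: (measurable_fun_cvg mf_ cf).
have [|||||fi _ H] := @dominated_convergence _ _ _ mu D mD
  (fun n x => (f_ n x)%:E) (EFin \o f) (EFin \o g).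
- by move=> n; exact/measurable_EFinP.
- exact/measurable_EFinP.
- apply: aeW => x Dx; apply: cvg_EFin; first exact: nearW.
  exact: cf.
- exact: ig.
- by apply: aeW => x n Dx /=; rewrite lee_fin; exact: fg.
apply: fine_cvg; rewrite fineK; last exact: integrable_fin_num fi.
exact: H.
Qed.

Lemma Rintegral_bound (D : set T) (f g : T -> R) :
  measurable D -> measurable_fun D f -> (forall x, D x -> `|f x| <= g x) ->
  mu.-integrable D (EFin \o g) -> `|Rintegral mu D f| <= Rintegral mu D g.
Proof.
move=> mD mf fg ig; have fi := integrable_dominated mD mf fg ig.
apply: le_trans (le_normr_Rintegral mD fi) _; apply: le_Rintegral => //.
exact: integrable_norm.
Qed.

End integral_tools.

(** Dominated convergence speaks of sequences, continuity in a parameter of filters. The balls of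
    radius [1 / (k + 1)] form a countable base at [x], so a failure of convergence produces a bad
    sequence. *)
Lemma cvg_seq (R : realType) (V : pseudoMetricType R) (W : pseudoMetricType R)
    (f : V -> W) (x : V) (l : W) :
  (forall u : nat -> V, u n @[n --> \oo] --> x -> f (u n) @[n --> \oo] --> l) ->
  f y @[y --> x] --> l.
Proof.
move=> H; apply: contrapT => nfl.
have [e e0 He] : exists2 e : R, 0 < e & forall k : nat, exists y, ball x (k.+1%:R^-1) y /\ ~ ball l e (f y).
  apply: contrapT => nH; apply: nfl; apply/cvg_ballP => e e0.
  apply: contrapT => nn; apply: nH; exists e => // k.
  apply: contrapT => nk; apply: nn; apply/nbhs_ballP; exists (k.+1%:R^-1) => //=.
  move=> y xy; apply: contrapT => ny; apply: nk; by exists y.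
have [u Hu] := choice He.
have ux : u n @[n --> \oo] --> x.
  apply/cvg_ballP => eps eps0; near=> n.
  have [+ _] := Hu n; apply: le_ball.
  near: n; have := near_infty_natSinv_lt (PosNum eps0).
  by apply: filterS => k /ltW.
have /cvg_ballP/(_ e e0) := H u ux.
move=> [n _ /(_ n (leqnn n))/=] ; by have [_] := Hu n.
Unshelve. all: by end_near. Qed.

(** * One-dimensional integrals below an integrable weight *)

Section weight1.
Variable R : realType.
Notation mu := (@lebesgue_measure R).

(** The decay is algebraic on purpose: an affine substitution then changes the weight by a bounded
    factor only, and transforms of test functions, which need not decay exponentially, stay below
    it. *)
Definition iw (t : R) : R := (1 + t ^+ 2)^-1.

Lemma iw_gt0 t : 0 < iw t.
Proof. by rewrite invr_gt0 ltr_pwDl// sqr_ge0. Qed.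

Lemma iw_le1 t : iw t <= 1.
Proof. by rewrite invf_le1 ?ltr_pwDl ?sqr_ge0// lerDl sqr_ge0. Qed.

Lemma continuous_iw : continuous iw.
Proof. exact: continuous_oneDsqrV. Qed.

Lemma integrable_iw : mu.-integrable setT (EFin \o iw).
Proof.
have mw : measurable_fun setT iw := continuous_measurable_fun continuous_iw.
apply/integrableP; split; first exact/measurable_EFinP.
apply/abse_integralP => //=; first exact/measurable_EFinP.
rewrite ge0_symfun_integralT//=.
- rewrite (_ : [set x | _] = `[0, +oo[%classic); last first.
    by apply/seteqP; split => x/=; rewrite in_itv/= andbT.
  by rewrite integral0y_oneDsqr -EFinM ltry.
- by move=> x; exact/ltW/iw_gt0.
- exact: continuous_iw.
- by move=> x/=; rewrite /iw sqrrN.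
Qed.

Definition iwint : R := Rintegral mu setT iw.

Lemma iwint_ge0 : 0 <= iwint.
Proof. by apply: Rintegral_ge0 => x _; exact/ltW/iw_gt0. Qed.

Definition dom1 (C : R) (g : R -> R) :=
  continuous g /\ forall t, `|g t| <= C * iw t.

Lemma integrable_dom1 C g : dom1 C g -> mu.-integrable setT (EFin \o g).
Proof.
move=> [cg gC]; apply: (@integrable_dominated _ (measurableTypeR R) R mu setT g (fun t => C * iw t)) => //.
  exact: continuous_measurable_fun.
rewrite (_ : _ \o _ = (fun t => C%:E * (iw t)%:E)%E); last first.
  by apply/funext => t /=; rewrite EFinM.
exact: (integrableZl measurableT _ integrable_iw).
Qed.

Lemma bound_dom1 C g : dom1 C g -> `|Rintegral mu setT g| <= C * iwint.
Proof.
move=> [cg gC]; rewrite -RintegralZl//; last exact: integrable_iw.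
apply: Rintegral_bound => //; first exact: continuous_measurable_fun.
apply: integrable_dom1; split => [t|t]; last first.
  by rewrite ger0_norm// mulr_ge0 ?(ltW (iw_gt0 _))//; have := gC 0; move/(le_trans (normr_ge0 _)); rewrite pmulr_lge0// iw_gt0.
by apply: cvgM; [exact: cvg_cst|exact: continuous_iw].
Qed.

Lemma Rintegral_affine_ge0 (G : R -> R) (x c : R) : 0 < c -> continuous G ->
  (forall t, 0 <= G t) ->
  Rintegral mu setT G = Rintegral mu setT (fun t => G (x + c * t) * c).
Proof.
move=> c0 cG G0; pose F := (fun t : R => x + c * t).
have dF t : is_derive t (1:R) F c.
  by rewrite /F; apply: is_derive_eq; rewrite add0r mul1r /GRing.scale/= mulr1.
have F'E : (F^`())%classic = cst c.
  by apply/funext => t; rewrite derive1E; exact: derive_val.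
congr fine.
rewrite (@increasing_ge0_integration_by_substitutionT _ F G)//.
- by rewrite F'E.
- by move=> a b ab; rewrite /F ltrD2l ltr_pM2l.
- by rewrite F'E; exact: cst_continuous.
- by rewrite F'E; exact: is_cvg_cst.
- by rewrite F'E; exact: is_cvg_cst.
- apply/cvgrNyPle => A; near=> t; rewrite /F -lerBrDl -(ler_pdivlMl _ _ c0).
  by near: t; apply: nbhs_ninfty_le; rewrite num_real.
- apply/cvgryPge => A; near=> t; rewrite /F -lerBlDl -(ler_pdivrMl _ _ c0).
  by near: t; apply: nbhs_pinfty_ge; rewrite num_real.
Unshelve. all: by end_near. Qed.

(** With [u = x + c * t] the claim bounds [1 + t ^+ 2] by a multiple of [1 + u ^+ 2]; it follows
    from [t = (u - x) / c] and [(u - x) ^+ 2 <= 2 * u ^+ 2 + 2 * x ^+ 2]. *)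
Lemma iw_affine_le (x c t : R) : 0 < c ->
  iw (x + c * t) <= (2 * (1 + x ^+ 2) * (1 + c ^- 2)) * iw t.
Proof.
move=> c0; rewrite /iw ler_pdivlMr ?ltr_pwDl ?sqr_ge0//.
rewrite mulrC ler_pdivrMr ?ltr_pwDl ?sqr_ge0//.
have -> : t = c^-1 * ((x + c * t) - x) by field; lra.
set u := (x + _); set a := c^-1.
have -> : x + c * (a * (u - x)) = u by rewrite /a; field; lra.
rewrite -exprVn -/a.
have h1 := sqr_ge0 (u + x); have h2 : 0 <= a ^+ 2 := sqr_ge0 a.
have h3 : 0 <= x ^+ 2 := sqr_ge0 x. have h4 : 0 <= u ^+ 2 := sqr_ge0 u.
have e : (u - x) ^+ 2 <= 2 * u ^+ 2 + 2 * x ^+ 2 by nra.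
have e2 : (a * (u - x)) ^+ 2 <= a ^+ 2 * (2 * u ^+ 2 + 2 * x ^+ 2).
  by rewrite exprMn ler_wpM2l.
have h5 : 0 <= a ^+ 2 * x ^+ 2 by exact: mulr_ge0.
have h6 : 0 <= a ^+ 2 * u ^+ 2 by exact: mulr_ge0.
have h7 : 0 <= x ^+ 2 * u ^+ 2 by exact: mulr_ge0.
have h8 : 0 <= a ^+ 2 * x ^+ 2 * u ^+ 2 by exact: mulr_ge0.
by apply: le_trans (lerD (lexx 1) e2) _; nra.
Qed.

Lemma dom1_affine C (g : R -> R) (x c : R) : 0 < c -> dom1 C g ->
  dom1 (C * (2 * (1 + x ^+ 2) * (1 + c ^- 2))) (fun t => g (x + c * t)).
Proof.
move=> c0 [cg gC]; split=> t.
  apply: (@continuous_comp _ _ _ (fun t => x + c * t) g); last exact: cg.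
  apply: cvgD; first exact: cvg_cst.
  by apply: cvgM; [exact: cvg_cst|exact: cvg_id].
apply: le_trans (gC _) _; rewrite -mulrA ler_wpM2l//; last exact: iw_affine_le.
by have := gC 0; move/(le_trans (normr_ge0 _)); rewrite pmulr_lge0// iw_gt0.
Qed.

(** The substitution rule is available for nonnegative integrands. Adding [C * iw] makes [g]
    nonnegative, and the contribution of [C * iw], itself nonnegative, is subtracted afterwards. *)
Lemma Rintegral_affine C (g : R -> R) (x c : R) : 0 < c -> dom1 C g ->
  Rintegral mu setT (fun t => g (x + c * t)) = c^-1 * Rintegral mu setT g.
Proof.
move=> c0 dg; have [cg gC] := dg.
have C0 : 0 <= C.
  by have := gC 0; move/(le_trans (normr_ge0 _)); rewrite pmulr_lge0// iw_gt0.
have dw : dom1 C (fun t => C * iw t).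
  split => t; last by rewrite ger0_norm// mulr_ge0// (ltW (iw_gt0 _)).
  by apply: cvgM; [exact: cvg_cst|exact: continuous_iw].
have iG := integrable_dom1 dg. have iW := integrable_dom1 dw.
have iGa := integrable_dom1 (dom1_affine x c0 dg).
have iWa := integrable_dom1 (dom1_affine x c0 dw).
have E1 := @Rintegral_affine_ge0 (fun t => C * iw t) x c c0 dw.1.
have E2 := @Rintegral_affine_ge0 (fun t => g t + C * iw t) x c c0.
move: E1 E2; rewrite RintegralZr// => E1 E2.
have {}E1 := E1 (fun t => mulr_ge0 C0 (ltW (iw_gt0 t))).
rewrite RintegralD// in E2.
rewrite RintegralZr// ?RintegralD// in E2; last first.
  exact: (integrableD measurableT iGa iWa).
have {}E2 : Rintegral mu setT g + Rintegral mu setT (fun t => C * iw t) =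
  (Rintegral mu setT (fun t => g (x + c * t)) + Rintegral mu setT (fun t => C * iw (x + c * t))) * c.
  apply: E2 => [t|t]; first by apply: cvgD; [exact: cg|exact: dw.1].
  by have := gC t; rewrite ler_norml => /andP[]; rewrite -subr_ge0 opprK.
apply: (mulfI (lt0r_neq0 c0)); rewrite mulrA divff ?mul1r; last exact: lt0r_neq0.
by lra.
Qed.

End weight1.

(** * Iterated integrals *)

Section iterated_integral.
Variable R : realType.
Notation mu := (@lebesgue_measure R).

Lemma coord_le_norm n (v : 'rV[R]_n) i : `|v 0 i| <= `|v|.
Proof.
rewrite [leRHS]/Num.Def.normr /= mx_normrE.
by apply: (le_bigmax _ (fun ij : 'I_1 * 'I_n => `|v ij.1 ij.2|) (0, i)).
Qed.

Lemma norm_le_coord n (v : 'rV[R]_n) (e : R) : 0 <= e ->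
  (forall i, `|v 0 i| <= e) -> `|v| <= e.
Proof.
move=> e0 H; rewrite [leLHS]/Num.Def.normr /= mx_normrE; apply: bigmax_le => // -[i j] _.
by rewrite /= ord1.
Qed.

Lemma contD (T : topologicalType) (f g : T -> R) :
  continuous f -> continuous g -> continuous (fun x => f x + g x).
Proof. by move=> cf cg x; apply: cvgD; [exact: cf|exact: cg]. Qed.

Lemma contM (T : topologicalType) (f g : T -> R) :
  continuous f -> continuous g -> continuous (fun x => f x * g x).
Proof. by move=> cf cg x; apply: cvgM; [exact: cf|exact: cg]. Qed.

Lemma contN (T : topologicalType) (f : T -> R) :
  continuous f -> continuous (fun x => - f x).
Proof. by move=> cf x; apply: cvgN; exact: cf. Qed.

Lemma contB (T : topologicalType) (f g : T -> R) :
  continuous f -> continuous g -> continuous (fun x => f x - g x).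
Proof. by move=> cf cg x; apply: cvgB; [exact: cf|exact: cg]. Qed.

Lemma cont_cst (T U : topologicalType) (c : U) : continuous (fun _ : T => c).
Proof. exact: cst_continuous. Qed.

Lemma cont_comp (T U V : topologicalType) (f : T -> U) (g : U -> V) :
  continuous f -> continuous g -> continuous (fun x => g (f x)).
Proof. by move=> cf cg x; apply: continuous_comp; [exact: cf|exact: cg]. Qed.

Lemma cvg_cont (T U : topologicalType) (f : T -> U) (u : nat -> T) (t : T) :
  continuous f -> u n @[n --> \oo] --> t -> f (u n) @[n --> \oo] --> f t.
Proof. by move=> cf ut; apply: cvg_comp ut _; exact: cf. Qed.

Lemma cont_lip (V W : normedModType R) (f : V -> W) (k : R) :
  (forall x y, `|f x - f y| <= k * `|x - y|) -> continuous f.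
Proof.
move=> H x; apply/cvgrPdist_le => e e0; have [k0|k0] := leP k 0.
  apply: nearW => y; apply: le_trans (H _ _) _.
  by apply: le_trans (ltW e0); rewrite mulr_le0_ge0.
near=> y; apply: le_trans (H _ _) _; rewrite -ler_pdivlMl//; near: y; apply: cvgr_dist_le; first exact: cvg_id.
by rewrite mulr_gt0// invr_gt0.
Unshelve. all: by end_near. Qed.

Lemma rvB n (u v : 'rV[R]_n) i : (u - v) 0 i = u 0 i - v 0 i.
Proof. by rewrite !mxE. Qed.

Lemma rvD n (u v : 'rV[R]_n) i : (u + v) 0 i = u 0 i + v 0 i.
Proof. by rewrite !mxE. Qed.

Lemma rvZ n c (v : 'rV[R]_n) i : (c *: v) 0 i = c * v 0 i.
Proof. by rewrite !mxE. Qed.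

Definition cons_rv n (t : R) (v : 'rV[R]_n) : 'rV[R]_n.+1 :=
  row_mx (const_mx t : 'rV[R]_1) v.

Definition behead_rv n (v : 'rV[R]_n.+1) : 'rV[R]_n := \row_i v 0 (lift ord0 i).

Lemma cons_rv0 n t (v : 'rV[R]_n) : cons_rv t v 0 ord0 = t.
Proof.
rewrite /cons_rv (_ : ord0 = lshift n (ord0 : 'I_1)); last exact: val_inj.
transitivity ((const_mx t : 'rV[R]_1) 0 0); [exact: row_mxEl|by rewrite mxE].
Qed.

Lemma cons_rvS n t (v : 'rV[R]_n) i : cons_rv t v 0 (lift ord0 i) = v 0 i.
Proof.
rewrite /cons_rv (_ : lift ord0 i = rshift 1 i); last exact: val_inj.
exact: row_mxEr.
Qed.

Lemma rvS_ext n (u v : 'rV[R]_n.+1) : u 0 ord0 = v 0 ord0 ->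
  (forall i, u 0 (lift ord0 i) = v 0 (lift ord0 i)) -> u = v.
Proof.
move=> h0 hS; apply/rowP => i; case: (unliftP ord0 i) => [j ->|->//]; exact: hS.
Qed.

Lemma cons_behead n (v : 'rV[R]_n.+1) : cons_rv (v 0 ord0) (behead_rv v) = v.
Proof. by apply: rvS_ext => [|i]; rewrite ?cons_rv0// cons_rvS mxE. Qed.

Lemma cons_rvB n t s (u v : 'rV[R]_n) :
  cons_rv t u - cons_rv s v = cons_rv (t - s) (u - v).
Proof.
by apply: rvS_ext => [|i]; rewrite rvB ?cons_rv0// !cons_rvS rvB.
Qed.

Lemma cons_rv_affine n (x : 'rV[R]_n.+1) c t (v : 'rV[R]_n) :
  x + c *: cons_rv t v = cons_rv (x 0 ord0 + c * t) (behead_rv x + c *: v).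
Proof.
apply: rvS_ext => [|i]; first by rewrite rvD rvZ !cons_rv0.
by rewrite cons_rvS !rvD !rvZ cons_rvS mxE.
Qed.

Lemma norm_cons n t (v : 'rV[R]_n) : `|cons_rv t v| <= `|t| + `|v|.
Proof.
apply: norm_le_coord => [|i]; first exact: addr_ge0.
case: (unliftP ord0 i) => [j ->|->]; rewrite ?cons_rv0 ?cons_rvS ?lerDl//.
by apply: le_trans (coord_le_norm _ _) _; rewrite lerDr.
Qed.

Lemma continuous_cons1 n (v : 'rV[R]_n) : continuous (fun t => cons_rv t v).
Proof.
move=> t; apply/cvgrPdist_le => e e0; near=> s.
rewrite cons_rvB subrr; apply: le_trans (norm_cons _ _) _; rewrite normr0 addr0.
by near: s; exact: cvgr_dist_le.
Unshelve. all: by end_near. Qed.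

Lemma continuous_cons2 n (t : R) : continuous (@cons_rv n t).
Proof.
apply: (@cont_lip _ _ _ 1) => u v; rewrite cons_rvB subrr mul1r.
by apply: le_trans (norm_cons _ _) _; rewrite normr0 add0r.
Qed.

Definition wt n (v : 'rV[R]_n) : R := \prod_(i < n) iw (v 0 i).

Lemma wt_cons n t (v : 'rV[R]_n) : wt (cons_rv t v) = iw t * wt v.
Proof.
rewrite /wt big_ord_recl cons_rv0; congr (_ * _).
by apply: eq_bigr => i _; rewrite cons_rvS.
Qed.

Lemma wt_gt0 n (v : 'rV[R]_n) : 0 < wt v.
Proof. by apply: prodr_gt0 => i _; exact: iw_gt0. Qed.

Lemma wt_le1 n (v : 'rV[R]_n) : wt v <= 1.
Proof. rewrite /wt; apply: prodr_ile1 => i _; by rewrite (ltW (iw_gt0 _)) iw_le1.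
Qed.

Lemma continuous_coord n (i : 'I_n) : continuous (fun v : 'rV[R]_n => v 0 i).
Proof. exact: coord_continuous. Qed.

(* [wt] is a product of integrable one-dimensional weights, so [dom C g] makes every
   inner integral of the iterated integral [iint g] absolutely convergent. *)
Definition dom n C (g : 'rV[R]_n -> R) :=
  continuous g /\ forall v, `|g v| <= C * wt v.

Lemma dom_ge0 n C (g : 'rV[R]_n -> R) : dom C g -> 0 <= C.
Proof.
by move=> [_ /(_ 0)/(le_trans (normr_ge0 _))]; rewrite pmulr_lge0// wt_gt0.
Qed.

Lemma domW n C C' (g : 'rV[R]_n -> R) : C <= C' -> dom C g -> dom C' g.
Proof.
move=> CC' [cg gC]; split => // v; apply: le_trans (gC v) _.
by rewrite ler_wpM2r// ltW// wt_gt0.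
Qed.

Lemma dom_cons n C (g : 'rV[R]_n.+1 -> R) t : dom C g ->
  dom (C * iw t) (fun v => g (cons_rv t v)).
Proof.
move=> [cg gC]; split => [|v]; last by rewrite -mulrA -wt_cons.
by apply: cont_comp cg; exact: continuous_cons2.
Qed.

Lemma dom_consW n C (g : 'rV[R]_n.+1 -> R) t : dom C g ->
  dom C (fun v => g (cons_rv t v)).
Proof.
move=> dg; apply: domW (dom_cons t dg).
by rewrite ler_piMr ?iw_le1//; exact: dom_ge0 dg.
Qed.

(** Both claims share one induction: even the bound needs the inner integral to be continuous in the
    first variable, and that continuity is dominated convergence one dimension below. *)
Lemma iint_aux n :
  (forall C (g : 'rV[R]_n -> R), dom C g -> `|iint g| <= C * iwint R ^+ n) /\
  (forall C (g_ : nat -> 'rV[R]_n -> R) (g : 'rV[R]_n -> R),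
    (forall k, dom C (g_ k)) -> (forall v, g_ k v @[k --> \oo] --> g v) ->
    iint (g_ k) @[k --> \oo] --> iint g).
Proof.
elim: n => [|n [IH1 IH2]].
  split => [C g [_ /(_ 0)]|C g_ g _ H]; last exact: H.
  by rewrite /wt big_ord0 expr0.
have D C (g : 'rV[R]_n.+1 -> R) : dom C g ->
    dom1 (C * iwint R ^+ n) (fun t => iint (fun v => g (cons_rv t v))).
  move=> dg; split => [t|t]; last by rewrite mulrAC; apply: IH1; exact: dom_cons.
  apply: cvg_seq => u ut; apply: (IH2 C) => [k|v]; first exact: dom_consW.
  by apply: (cvg_cont dg.1); apply: (cvg_cont (@continuous_cons1 n v)).
split => [C g dg|C g_ g dg gg].
  by rewrite exprSr mulrA; apply: bound_dom1; exact: D.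
have C0 : 0 <= C := dom_ge0 (dg 0%N).
apply: (@Rintegral_dct _ (measurableTypeR R) R mu setT _ _
  (fun t => C * iwint R ^+ n * iw t)) => //.
- by move=> k; apply: continuous_measurable_fun; exact: (D _ _ (dg k)).1.
- move=> t _; apply: IH2 => [k|v]; first exact: dom_consW (dg k).
  exact: gg.
- apply: (@integrable_dom1 _ (C * iwint R ^+ n)); split => [t|t].
    by apply: cvgM; [exact: cvg_cst|exact: continuous_iw].
  by rewrite ger0_norm// mulr_ge0// ?(ltW (iw_gt0 _))// mulr_ge0// exprn_ge0// iwint_ge0.
- by move=> k t _; exact: (D _ _ (dg k)).2.
Qed.

Lemma iint_bound n C (g : 'rV[R]_n -> R) : dom C g -> `|iint g| <= C * iwint R ^+ n.
Proof. exact: (iint_aux n).1. Qed.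

Lemma iint_dct n C (g_ : nat -> 'rV[R]_n -> R) (g : 'rV[R]_n -> R) :
  (forall k, dom C (g_ k)) -> (forall v, g_ k v @[k --> \oo] --> g v) ->
  iint (g_ k) @[k --> \oo] --> iint g.
Proof. exact: (iint_aux n).2. Qed.

Lemma dom1_iint n C (g : 'rV[R]_n.+1 -> R) : dom C g ->
  dom1 (C * iwint R ^+ n) (fun t => iint (fun v => g (cons_rv t v))).
Proof.
move=> dg; split => [t|t]; last by rewrite mulrAC; apply: iint_bound; exact: dom_cons.
apply: cvg_seq => u ut; apply: (@iint_dct _ C) => [k|v]; first exact: dom_consW.
by apply: (cvg_cont dg.1); apply: (cvg_cont (@continuous_cons1 n v)).
Qed.

Lemma iint_continuous (V : pseudoMetricType R) n C (g : V -> 'rV[R]_n -> R) x :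
  (\forall y \near x, dom C (g y)) ->
  (forall v, g y v @[y --> x] --> g x v) ->
  iint (g y) @[y --> x] --> iint (g x).
Proof.
move=> dg cg; apply: cvg_seq => u ux.
have [N _ HN] : \forall k \near \oo, dom C (g (u k)) by exact: ux dg.
rewrite -(cvg_shiftn N); apply: (@iint_dct _ C) => [k|v].
  by apply: HN => /=; exact: leq_addl.
apply: (@cvg_comp _ _ _ (fun k => u (k + N)%N) (g^~ v)); last exact: cg.
by apply: (@cvg_comp _ _ _ (fun k => (k + N)%N) u); [exact: cvg_addnr|exact: ux].
Qed.

Lemma iint_continuousT (V : pseudoMetricType R) n C (g : V -> 'rV[R]_n -> R) :
  (forall y, dom C (g y)) -> (forall v, continuous (g^~ v)) ->
  continuous (fun y => iint (g y)).
Proof.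
move=> dg cg x; apply: (@iint_continuous _ _ C g x) => [|v]; last exact: cg.
exact: nearW.
Qed.

Lemma domD n C C' (f g : 'rV[R]_n -> R) : dom C f -> dom C' g ->
  dom (C + C') (fun v => f v + g v).
Proof.
move=> [cf fC] [cg gC]; split => [|v]; first exact: contD.
by rewrite mulrDl; apply: le_trans (ler_normD _ _) _; exact: lerD.
Qed.

Lemma domZ n C k (g : 'rV[R]_n -> R) : dom C g -> dom (`|k| * C) (fun v => k * g v).
Proof.
move=> [cg gC]; split => [|v]; first by apply: contM => //; exact: cont_cst.
by rewrite normrM -mulrA ler_wpM2l.
Qed.

Lemma iintD n C C' (f g : 'rV[R]_n -> R) : dom C f -> dom C' g ->
  iint (fun v => f v + g v) = iint f + iint g.
Proof.
elim: n C C' f g => [//|n IH] C C' f g df dg /=.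
rewrite -RintegralD//; [|exact: integrable_dom1 (dom1_iint df)|exact: integrable_dom1 (dom1_iint dg)].
by apply: eq_Rintegral => t _; apply: (IH _ _ _ _ (dom_consW t df) (dom_consW t dg)).
Qed.

Lemma iintZ n C k (g : 'rV[R]_n -> R) : dom C g ->
  iint (fun v => k * g v) = k * iint g.
Proof.
elim: n C g => [//|n IH] C g dg /=.
rewrite -RintegralZl//; last exact: integrable_dom1 (dom1_iint dg).
by apply: eq_Rintegral => t _; apply: (IH _ _ (dom_consW t dg)).
Qed.

Lemma iintB n C C' (f g : 'rV[R]_n -> R) : dom C f -> dom C' g ->
  iint (fun v => f v - g v) = iint f - iint g.
Proof.
move=> df dg; rewrite -mulN1r -(iintZ _ dg) -(iintD df (domZ (-1) dg)).
by congr iint; apply/funext => v; rewrite mulN1r.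
Qed.

Lemma iint_ge0 n (g : 'rV[R]_n -> R) : (forall v, 0 <= g v) -> 0 <= iint g.
Proof.
elim: n g => [g g0|n IH g g0] /=; first exact: g0.
apply: fine_ge0; apply: integral_ge0 => t _.
by rewrite lee_fin; exact: IH.
Qed.

Lemma dom_affine n C (g : 'rV[R]_n -> R) (x : 'rV[R]_n) c : 0 < c -> dom C g ->
  dom (C * \prod_(i < n) (2 * (1 + x 0 i ^+ 2) * (1 + c ^- 2))) (fun v => g (x + c *: v)).
Proof.
move=> c0 dg; split=> [|v].
  apply: cont_comp dg.1; apply: (@cont_lip _ _ _ `|c|) => u v.
  by rewrite opprD addrACA subrr add0r -scalerBr normrZ.
apply: le_trans (dg.2 _) _; rewrite -mulrA ler_wpM2l//; first exact: dom_ge0 dg.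
rewrite /wt -big_split/=; apply: ler_prod => i _; rewrite (ltW (iw_gt0 _)) !mxE.
exact: iw_affine_le.
Qed.

Lemma iint_affine n C (g : 'rV[R]_n -> R) (x : 'rV[R]_n) c : 0 < c -> dom C g ->
  iint (fun v => g (x + c *: v)) = c ^- n * iint g.
Proof.
move=> c0; elim: n C g x => [|n IH] C g x dg.
  by rewrite /= expr0 invr1 mul1r; congr g; apply/rowP => -[].
rewrite /= exprSr invfM -mulrA -(Rintegral_affine (x 0 ord0) c0 (dom1_iint dg)).
rewrite -RintegralZl//; last first.
  exact: integrable_dom1 (dom1_affine _ c0 (dom1_iint dg)).
apply: eq_Rintegral => t _; rewrite -(IH C _ (behead_rv x)); last exact: dom_consW.
by congr iint; apply/funext => v; rewrite -/(cons_rv _ _) cons_rv_affine.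
Qed.

Lemma Rintegral_gt0 C (g : R -> R) t0 : dom1 C g -> (forall t, 0 <= g t) ->
  0 < g t0 -> 0 < Rintegral mu setT g.
Proof.
move=> dg g0 gt0; have [cg _] := dg.
have [e /= e0 He] : exists2 e : R, 0 < e & forall t, `|t0 - t| < e -> g t0 / 2 < g t.
  have : \forall t \near t0, g t0 / 2 < g t.
    by apply: (cvgr_gt _ (cg t0)); rewrite ltr_pdivrMr// ltr_pMr// ltr1n.
  by move=> /nbhs_ballP[e e0 H]; exists e => // t te; exact: H.
pose a := t0 - e / 2; pose b := t0 + e / 2.
have ab : a < b by rewrite /a /b; lra.
suff H : (((g t0 / 2) * (b - a))%:E <= \int[mu]_t (g t)%:E)%E.
  rewrite -lte_fin; apply: (@lt_le_trans _ _ ((g t0 / 2) * (b - a))%:E).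
    by rewrite lte_fin mulr_gt0// ?divr_gt0// subr_gt0.
  by rewrite fineK//; exact: integrable_fin_num (integrable_dom1 dg).
apply: (@le_trans _ _ (\int[mu]_(t in `[a, b]) (g t)%:E)%E); last first.
  apply: ge0_subset_integral => //; last by move=> t _; rewrite lee_fin.
  by apply/measurable_EFinP; exact: continuous_measurable_fun.
apply: (@le_trans _ _ (\int[mu]_(t in `[a, b]) (g t0 / 2)%:E)%E).
  rewrite integral_cst// EFinM lee_wpmul2l ?lee_fin ?divr_ge0 ?(ltW gt0)//.
  have -> : (b - a)%:E = mu `[a, b]%classic; last exact: lexx.
  by rewrite lebesgue_measure_itv/= lte_fin ab -EFinD.
apply: ge0_le_integral => //.
- by move=> t _; rewrite lee_fin divr_ge0// ltW.
- apply/measurable_EFinP; apply: measurable_funTS.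
  exact: continuous_measurable_fun.
- move=> t /=; rewrite in_itv/= => /andP[ta tb]; rewrite lee_fin ltW// He//.
  by rewrite ltr_norml /a /b in ta tb *; lra.
Qed.

Lemma iint_gt0 n C (g : 'rV[R]_n -> R) v0 : dom C g -> (forall v, 0 <= g v) ->
  0 < g v0 -> 0 < iint g.
Proof.
elim: n C g v0 => [|n IH] C g v0 dg g0 gv0.
  by rewrite /= (_ : 0 = v0)//; apply/rowP => -[].
apply: (@Rintegral_gt0 _ _ (v0 0 ord0) (dom1_iint dg)) => [t|]; first exact: iint_ge0.
by apply: (IH _ _ (behead_rv v0) (dom_consW _ dg)) => //; rewrite cons_behead.
Qed.

End iterated_integral.

(** * Fubini for iterated integrals *)

Section fubini_iterated.
Variable R : realType.
Notation mu := (@lebesgue_measure R).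

Section one_variable.
Context {dd : measure_display} {T : measurableType dd}.

(** Rounding the real variable down to the grid of mesh [1 / (k + 1)] gives a function that is
    measurable on each of countably many strips; continuity in that variable then lets the mesh tend
    to 0. *)
Lemma measurable_caratheodory (h : T -> R -> R) :
  (forall t, measurable_fun setT (h^~ t)) -> (forall y, continuous (h y)) ->
  measurable_fun setT (fun p : T * measurableTypeR R => h p.1 p.2).
Proof.
move=> mh ch.
pose r (k : nat) (t : R) : R := (Num.floor (t * k.+1%:R))%:~R / k.+1%:R.
have rt t : r k t @[k --> \oo] --> t.
  apply/cvgrPdist_le => e e0; near=> k.
  have k0 : 0 < k.+1%:R :> R by rewrite ltr0n.
  have /andP[f1 f2] := Num.Theory.floor_itv (t * k.+1%:R).
  have E : t - r k t = (t * k.+1%:R - (Num.floor (t * k.+1%:R))%:~R) / k.+1%:R.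
    by rewrite /r; field; rewrite lt0r_neq0.
  rewrite E ger0_norm; last by rewrite divr_ge0// ?subr_ge0// ltW.
  apply: (@le_trans _ _ (k.+1%:R^-1)).
    rewrite ler_pdivrMr// mulVf ?lt0r_neq0// lerBlDr addrC ltW//.
    by move: f2; rewrite intrD.
  near: k; have := near_infty_natSinv_lt (PosNum e0).
  by apply: filterS => k /ltW.
apply: (@measurable_fun_cvg _ _ _ _ (fun k p => h p.1 (r k p.2))); last first.
  by move=> [y t] _ /=; apply: (cvg_cont (ch y)); exact: rt.
(* The strips are indexed by integers, the countable union by naturals. A natural that codes no
   integer repeats the strip of 0, which is harmless. *)
move=> k; pose z (n : nat) : int := if unpickle n is Some i then i else 0.
pose E n := (setT : set T) `*` ([set t : measurableTypeR R | Num.floor (t * k.+1%:R) = z n]).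
have mE n : measurable (E n).
  apply: measurableX => //.
  rewrite (_ : mkset _ = `[(z n)%:~R / k.+1%:R, ((z n + 1)%:~R) / k.+1%:R [%classic) //.
  apply/seteqP; split => t /=; rewrite in_itv/= ler_pdivrMr ?ltr0n// ltr_pdivlMr ?ltr0n//.
    by move=> <-; exact: Num.Theory.floor_itv.
  by move=> H; apply/eqP; rewrite Num.Theory.floor_eq.
have -> : [set: T * measurableTypeR R] = \bigcup_n E n.
  apply/seteqP; split => // -[y t] _; exists (pickle (Num.floor (t * k.+1%:R))) => //.
  by split => //=; rewrite /z pickleK.
apply/measurable_fun_bigcup => // n.
apply: (@eq_measurable_fun _ _ _ _ _ (fun p : T * R => h p.1 ((z n)%:~R / k.+1%:R))).
  by move=> [y t]; rewrite inE => -[_ /= E0]; rewrite /r E0.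
apply: measurable_funTS; apply: (measurableT_comp (mh _)).
exact: measurable_fst.
Unshelve. all: by end_near. Qed.

Variable m : {sigma_finite_measure set T -> \bar R}.
Variables (h : T -> R -> R) (M : T -> R).
Hypothesis mh : forall t, measurable_fun setT (h^~ t).
Hypothesis ch : forall y, continuous (h y).
Hypothesis iM : m.-integrable setT (EFin \o M).
Hypothesis hM : forall y t, `|h y t| <= M y * iw t.

Let dh y : dom1 (M y) (h y). Proof. by split. Qed.

Let f (p : T * measurableTypeR R) := (h p.1 p.2)%:E.

Let mf : measurable_fun setT f.
Proof. by apply/measurable_EFinP; exact: measurable_caratheodory. Qed.

Let inner y : (\int[mu]_t `|f (y, t)| <= (M y * iwint R)%:E)%E.
Proof.
have i1 : mu.-integrable setT (EFin \o (fun t => M y * iw t)).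
  rewrite (_ : _ \o _ = (fun t => (M y)%:E * (iw t)%:E)%E); last first.
    by apply/funext => t /=; rewrite EFinM.
  exact: (integrableZl measurableT _ (integrable_iw R)).
have -> : (M y * iwint R)%:E = (\int[mu]_t (M y * iw t)%:E)%E.
  rewrite -RintegralZl//; last exact: integrable_iw.
  by rewrite fineK//; exact: integrable_fin_num i1.
apply: ge0_le_integral => //=.
- apply/measurable_EFinP; apply: measurableT_comp => //.
  by apply: continuous_measurable_fun; exact: ch.
- exact: (measurable_int _ i1).
- by move=> t _; rewrite lee_fin.
Qed.

Let intf : (m \x mu)%E.-integrable setT f.
Proof.
apply/integrable12ltyP; first exact: mf.
apply: (@le_lt_trans _ _ (\int[m]_y ((M y * iwint R)%:E))%E).
  apply: ge0_le_integral => //=.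
  - by move=> y _; exact: integral_ge0.
  - apply: (@measurable_fun_fubini_tonelli_F _ _ _ _ _ mu (abse \o f)) => //.
      exact: measurableT_comp.
    by move=> p; exact: abse_ge0.
  - apply/measurable_EFinP; apply: measurable_funM => //; apply/measurable_EFinP.
    exact: measurable_int iM.
  - by move=> y _; exact: inner.
have := integrable_lty measurableT (integrableZr measurableT (iwint R) iM).
by [].
Qed.

Lemma measurable_Rintegral_param : measurable_fun setT (fun y => Rintegral mu setT (h y)).
Proof.
apply/measurable_EFinP; have := measurable_fubini_F intf.
apply: eq_measurable_fun => y _ /=; rewrite /fubini_F /= fineK//.
exact: integrable_fin_num (integrable_dom1 (dh y)).
Qed.

Lemma Fubini_Rintegral :
  Rintegral m setT (fun y => Rintegral mu setT (h y)) =
  Rintegral mu setT (fun t => Rintegral m setT (h^~ t)).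
Proof.
have i2 t : m.-integrable setT (EFin \o h^~ t).
  apply: (@integrable_dominated _ _ _ _ _ _ M) => // y _.
  apply: le_trans (hM y t) _; rewrite ler_piMr ?iw_le1//.
  by have := hM y 0; move/(le_trans (normr_ge0 _)); rewrite pmulr_lge0// iw_gt0.
rewrite /Rintegral; transitivity (fine (\int[m]_y \int[mu]_t f (y, t))%E).
  congr fine; apply: eq_integral => y _; rewrite fineK//.
  exact: integrable_fin_num (integrable_dom1 (dh y)).
rewrite (Fubini intf); congr fine; apply: eq_integral => t _; rewrite fineK//.
exact: integrable_fin_num (i2 t).
Qed.

End one_variable.

(** Measurability of the inner integral is carried through the induction, because the one-variable
    Fubini theorem demands it of every slice [H^~ t]. *)
Lemma Fubini_iint {dd : measure_display} {T : measurableType dd}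
    (m : {sigma_finite_measure set T -> \bar R}) n (h : T -> 'rV[R]_n -> R) (M : T -> R) :
  (forall v, measurable_fun setT (h^~ v)) -> (forall y, continuous (h y)) ->
  m.-integrable setT (EFin \o M) -> (forall y v, `|h y v| <= M y * wt v) ->
  measurable_fun setT (fun y => iint (h y)) /\
  Rintegral m setT (fun y => iint (h y)) = iint (fun v => Rintegral m setT (h^~ v)).
Proof.
elim: n h M => [|n IH] h M mh ch iM hM; first by split; [exact: mh|].
have M0 y : 0 <= M y.
  by have := hM y 0; move/(le_trans (normr_ge0 _)); rewrite pmulr_lge0// wt_gt0.
have dh y : dom (M y) (h y) by split.
pose H y t := iint (fun v => h y (cons_rv t v)).
have IHt t : measurable_fun setT (H^~ t) /\ Rintegral m setT (H^~ t) = iint (fun v => Rintegral m setT (fun y => h y (cons_rv t v))).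
  apply: (IH (fun y v => h y (cons_rv t v)) M) => //.
  - by move=> y; exact: (dom_consW t (dh y)).1.
  - by move=> y v; exact: (dom_consW t (dh y)).2.
have cH y : continuous (H y) by exact: (dom1_iint (dh y)).1.
have iM' : m.-integrable setT (EFin \o (fun y => M y * iwint R ^+ n)).
  exact: (integrableZr measurableT (iwint R ^+ n) iM).
have HM y t : `|H y t| <= (M y * iwint R ^+ n) * iw t by exact: (dom1_iint (dh y)).2.
split; first exact: (measurable_Rintegral_param (fun t => (IHt t).1) cH iM' HM).
rewrite /= (Fubini_Rintegral (fun t => (IHt t).1) cH iM' HM).
by apply: eq_Rintegral => t _; exact: (IHt t).2.
Qed.

(** For each value of the first coordinate the other [p] are exchanged by induction; [Fubini_iint]
    for Lebesgue measure then moves the first coordinate inside as well. *)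
Lemma iint_swap p n (h : 'rV[R]_p -> 'rV[R]_n -> R) C :
  (forall v, continuous (h^~ v)) -> (forall x, continuous (h x)) ->
  (forall x v, `|h x v| <= C * wt x * wt v) ->
  iint (fun x => iint (h x)) = iint (fun v => iint (h^~ v)).
Proof.
elim: p h C => [|p IH] h C c1 c2 hC; first by [].
have C0 : 0 <= C.
  by have := hC 0 0; move/(le_trans (normr_ge0 _)); rewrite pmulr_lge0 ?wt_gt0// pmulr_lge0// wt_gt0.
have d1 v : dom (C * wt v) (h^~ v) by split => // x; rewrite mulrAC.
rewrite /=; transitivity (Rintegral mu setT (fun t => iint (fun v => iint (fun x => h (cons_rv t x) v)))).
  apply: eq_Rintegral => t _; apply: (IH (fun x => h (cons_rv t x)) C).
  - by move=> v; exact: (dom_consW t (d1 v)).1.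
  - by move=> x; exact: c2.
  - move=> x v; apply: le_trans (hC _ _) _; rewrite wt_cons.
    rewrite (ler_wpM2r (ltW (wt_gt0 v)))// (ler_wpM2l C0)//.
    by rewrite ler_piMl ?iw_le1// ltW// wt_gt0.
have dn v := dom1_iint (d1 v).
have [||||_ ->//] := @Fubini_iint _ (measurableTypeR R) (@lebesgue_measure R) n
  (fun t v => iint (fun x => h (cons_rv t x) v)) (fun t => C * iwint R ^+ p * iw t).
- by move=> v; apply: continuous_measurable_fun; exact: (dn v).1.
- move=> t; apply: (@iint_continuousT R _ p C) => [w|x]; last exact: c2.
  apply: domW (dom_consW t (d1 w)).
  by rewrite ler_piMr// wt_le1.
- apply: (@integrable_dom1 _ (C * iwint R ^+ p)); split => [|t].
    by apply: contM; [exact: cont_cst|exact: continuous_iw].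
  by rewrite ger0_norm// mulr_ge0// ?(ltW (iw_gt0 _))// mulr_ge0// exprn_ge0// iwint_ge0.
- move=> t v; apply: le_trans ((dn v).2 t) _.
  by rewrite le_eqVlt; apply/orP; left; apply/eqP; ring.
Qed.

End fubini_iterated.

(** * Test functions *)

Section smooth_functions.
Variable R : realType.

Section normed.
Variable V : normedModType R.
Implicit Types f g : V -> R.

Definition C1w f := continuous f /\ forall v x, derivable f x v.

(** [smooth] quantifies over lists of directions, which does not suit the Leibniz rule. Bounding the
    order gives an induction over all functions at once: the derivative of a product at order [k.+1]
    is a sum of products of order [k]. *)
Fixpoint Ck (k : nat) f : Prop :=
  C1w f /\ if k is k'.+1 then forall v, Ck k' ('D_v f) else True.

Lemma CkW k f : Ck k.+1 f -> Ck k f.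
Proof.
elim: k f => [|k IH] f [cf Df]; first by split.
by split; [exact: cf|move=> v; exact: IH (Df v)].
Qed.

Lemma C1wD f g : C1w f -> C1w g -> C1w (fun x => f x + g x).
Proof.
by move=> [cf df] [cg dg]; split; [exact: contD|move=> v x; exact: derivableD].
Qed.

Lemma C1wM f g : C1w f -> C1w g -> C1w (fun x => f x * g x).
Proof.
by move=> [cf df] [cg dg]; split; [exact: contM|move=> v x; exact: derivableM].
Qed.

Lemma C1w_cst c : C1w (fun _ => c).
Proof. by split; [exact: cont_cst|move=> v x; exact: (derivable_cst c x v)]. Qed.

Lemma CkD k f g : Ck k f -> Ck k g -> Ck k (fun x => f x + g x).
Proof.
elim: k f g => [|k IH] f g [cf Df] [cg Dg]; first by split; [exact: C1wD|].
split; [exact: C1wD|move=> v].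
rewrite (_ : 'D_v _ = (fun x => 'D_v f x + 'D_v g x)); first exact: IH (Df v) (Dg v).
by apply/funext => x; rewrite (deriveD (cf.2 v x) (cg.2 v x)).
Qed.

Lemma CkM k f g : Ck k f -> Ck k g -> Ck k (fun x => f x * g x).
Proof.
elim: k f g => [|k IH] f g Hf Hg; have [cf Df] := Hf; have [cg Dg] := Hg.
  by split; [exact: C1wM|].
split; [exact: C1wM|move=> v].
rewrite (_ : 'D_v _ = (fun x => f x * 'D_v g x + g x * 'D_v f x)).
  by apply: CkD; apply: IH (CkW _) _; [exact: Hf|exact: Dg|exact: Hg|exact: Df].
by apply/funext => x; rewrite (deriveM (cf.2 v x) (cg.2 v x)).
Qed.

Lemma Ck_cst k (c : R) : Ck k (fun _ => c).
Proof.
elim: k c => [|k IH] c; first by split; [exact: C1w_cst|].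
split; [exact: C1w_cst|move=> v].
rewrite (_ : 'D_v _ = (fun _ => 0)); first exact: IH.
by apply/funext => x; rewrite (derive_cst c).
Qed.

Lemma affine_quot f c (a x v : V) :
  (fun h : R => h^-1 *: (((fun y => f (c *: y + a)) \o shift x) (h *: v) - f (c *: x + a))) =
  (fun h : R => h^-1 *: ((f \o shift (c *: x + a)) (h *: (c *: v)) - f (c *: x + a))).
Proof.
apply/funext => h /=; congr (_ *: (f _ - _)).
by rewrite scalerDr addrA !scalerA (mulrC c).
Qed.

Lemma derivable_affine f c (a x v : V) :
  derivable f (c *: x + a) (c *: v) -> derivable (fun y => f (c *: y + a)) x v.
Proof. by rewrite /derivable affine_quot. Qed.

Lemma derive_affine f c (a x v : V) :
  'D_v (fun y => f (c *: y + a)) x = 'D_(c *: v) f (c *: x + a).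
Proof. by rewrite /derive affine_quot. Qed.

Lemma continuous_affine (c : R) (a : V) : continuous (fun y : V => c *: y + a).
Proof.
apply: (@cont_lip _ _ _ _ `|c|) => u v.
by rewrite opprD addrACA subrr addr0 -scalerBr normrZ.
Qed.

Lemma Ck_affine k f c (a : V) : Ck k f -> Ck k (fun y => f (c *: y + a)).
Proof.
have C f' : C1w f' -> C1w (fun y => f' (c *: y + a)).
  move=> [cf df]; split; first exact: (cont_comp (@continuous_affine c a) cf).
  by move=> v x; apply: derivable_affine; exact: df.
elim: k f => [|k IH] f [cf Df]; first by split; [exact: C|].
split; [exact: C|move=> v].
rewrite (_ : 'D_v _ = (fun y => 'D_(c *: v) f (c *: y + a))); first exact: (IH _ (Df (c *: v))).
by apply/funext => x; rewrite derive_affine.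
Qed.

(** A directional derivative is an ordinary derivative along a line, so that the one-variable rules
    and the mean value theorem apply. *)
Lemma line_quot f (a v : V) (s : R) :
  (fun h : R => h^-1 *: (((fun s : R => f (s *: v + a)) \o shift s) (h *: (1 : R)) - f (s *: v + a))) =
  (fun h : R => h^-1 *: ((f \o shift (s *: v + a)) (h *: v) - f (s *: v + a))).
Proof.
apply/funext => h /=; congr (_ *: (f _ - _)).
by rewrite (_ : h *: 1 = h) ?scalerDl ?addrA// /GRing.scale/= mulr1.
Qed.

Lemma derivable_line f (a v : V) (s : R) :
  derivable (fun s : R => f (s *: v + a)) s 1 <-> derivable f (s *: v + a) v.
Proof. by rewrite /derivable line_quot. Qed.

Lemma derive_line f (a v : V) (s : R) :
  'D_1 (fun s : R => f (s *: v + a)) s = 'D_v f (s *: v + a).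
Proof. by rewrite /derive line_quot. Qed.

Lemma is_derive_line f (a v : V) (l : R) :
  is_derive (0 : R) (1 : R) (fun s : R => f (s *: v + a)) l -> is_derive a v f l.
Proof.
move=> [H1 H2]; split.
  by move/derivable_line : H1; rewrite scale0r add0r.
by move: H2; rewrite derive_line scale0r add0r.
Qed.

Lemma derive_zero_out f (M : R) v x :
  (forall a, M <= `|a| -> f a = 0) -> M < `|x| -> 'D_v f x = 0.
Proof.
move=> H Mx; rewrite -(derive_cst (0 : R) x v); apply: near_eq_derive.
near=> y; apply: H; apply: ltW; near: y.
have : `|y| @[y --> x] --> `|x| by apply: cvg_norm; exact: cvg_id.
by move/cvgr_gt; exact.
Unshelve. all: by end_near. Qed.

Lemma mean_value_line f (B : R) (v a : V) (s : R) :
  (forall x, derivable f x v) -> (forall x, `|'D_v f x| <= B) -> 0 < s ->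
  `|f (s *: v + a) - f a| <= B * s.
Proof.
move=> dg DB s0; pose phi (s : R) := f (s *: v + a).
have H (t : R) : is_derive t (1 : R) phi ('D_v f (t *: v + a)).
  by split; [exact/derivable_line|exact: derive_line].
have cphi : {within `[0, s], continuous phi}.
  apply: continuous_subspaceT => t.
  by apply: differentiable_continuous; apply/derivable1_diffP; exact: (@ex_derive _ _ _ _ _ _ _ (H t)).
have [t _ E] := MVT_segment (ltW s0) (fun t _ => H t) cphi.
rewrite (_ : f a = phi 0); last by rewrite /phi scale0r add0r.
rewrite -/(phi s) E subr0 normrM (gtr0_norm s0).
by apply: ler_wpM2r; [exact: ltW|exact: DB].
Qed.

Lemma derive_seq f (v a : V) : derivable f a v ->
  k.+1%:R * (f (k.+1%:R^-1 *: v + a) - f a) @[k --> \oo] --> 'D_v f a.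
Proof.
move=> df; have H : (k.+1%:R^-1 : R) @[k --> \oo] --> 0^'.
  move=> A /= [e /= e0 He]; apply: filterS (near_infty_natSinv_lt (PosNum e0)).
  move=> k /= ke; apply: He => /=; last by rewrite invr_neq0.
  by rewrite sub0r normrN gtr0_norm ?invr_gt0.
have -> : (fun k : nat => k.+1%:R * (f (k.+1%:R^-1 *: v + a) - f a)) =
  (fun h => h^-1 *: ((f \o shift a) (h *: v) - f a)) \o (fun k : nat => (k.+1%:R^-1 : R)).
  by apply/funext => k /=; rewrite invrK.
exact: cvg_comp H df.
Qed.

End normed.

Lemma iderive_rcons n (vs : seq 'rV[R]_n) v (f : 'rV[R]_n -> R) :
  iderive (rcons vs v) f = iderive vs ('D_v f).
Proof. by elim: vs => //= w vs ->. Qed.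

Lemma smooth_derive n (f : 'rV[R]_n -> R) v : smooth f -> smooth ('D_v f).
Proof. by move=> sf vs; have := sf (rcons vs v); rewrite iderive_rcons. Qed.

Lemma smooth_cont n (f : 'rV[R]_n -> R) : smooth f -> continuous f.
Proof. by move=> /(_ [::])[]. Qed.

Lemma smooth_derivable n (f : 'rV[R]_n -> R) v x : smooth f -> derivable f x v.
Proof. by move=> /(_ [::])[_]; exact. Qed.

Lemma smoothP n (f : 'rV[R]_n -> R) : smooth f <-> forall k, Ck k f.
Proof.
split=> [sf k|H vs].
  elim: k f sf => [|k IH] f sf; (split; first by exact: (sf [::])) => //.
  by move=> v; apply: IH; exact: smooth_derive.
have {H} := H (size vs); elim/last_ind: vs f => [|vs v IH] f; first by move=> [].
by rewrite size_rcons iderive_rcons => -[_] /(_ v); exact: IH.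
Qed.

Lemma smoothD n (f g : 'rV[R]_n -> R) : smooth f -> smooth g -> smooth (fun x => f x + g x).
Proof. by move=> /smoothP sf /smoothP sg; apply/smoothP => k; exact: CkD. Qed.

Lemma smoothM n (f g : 'rV[R]_n -> R) : smooth f -> smooth g -> smooth (fun x => f x * g x).
Proof. by move=> /smoothP sf /smoothP sg; apply/smoothP => k; exact: CkM. Qed.

Lemma smooth_cst n (c : R) : smooth (fun _ : 'rV[R]_n => c).
Proof. by apply/smoothP => k; exact: Ck_cst. Qed.

Lemma smooth_affine n (f : 'rV[R]_n -> R) c (a : 'rV[R]_n) :
  smooth f -> smooth (fun y => f (c *: y + a)).
Proof. by move=> /smoothP sf; apply/smoothP => k; exact: Ck_affine. Qed.

Lemma is_derive_coord n (j : 'I_n) (x v : 'rV[R]_n) :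
  is_derive x v (fun y : 'rV[R]_n => y 0 j) (v 0 j).
Proof.
apply: is_derive_line; rewrite (_ : (fun _ => _) = (fun s : R => s * v 0 j + x 0 j)).
  by apply: is_derive_eq; rewrite addr0 /GRing.scale/= mulr1 ?mulr0 ?addr0 ?add0r.
by apply/funext => s; rewrite rvD rvZ.
Qed.

Lemma derive_coord n (j : 'I_n) (v : 'rV[R]_n) :
  'D_v (fun y : 'rV[R]_n => y 0 j) = (fun _ => v 0 j).
Proof. by apply/funext => x; have [_ ->] := is_derive_coord j x v. Qed.

Lemma smooth_coord n (j : 'I_n) : smooth (fun y : 'rV[R]_n => y 0 j).
Proof.
have H : C1w (fun y : 'rV[R]_n => y 0 j).
  split; first exact: continuous_coord.
  by move=> v x; have [] := is_derive_coord j x v.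
apply/smoothP => -[|k]; split => // v; rewrite derive_coord; exact: Ck_cst.
Qed.

(** Compact support in a form free of closures, which passes directly to products, affine
    substitutions and derivatives. *)
Definition bsupp n (f : 'rV[R]_n -> R) := exists M : R, forall a, M <= `|a| -> f a = 0.

Lemma compact_cball n (x : 'rV[R]_n) (M : R) : compact [set v : 'rV[R]_n | `|x - v| <= M].
Proof.
apply: bounded_closed_compact.
  exists (`|x| + M); split; first exact: num_real.
  move=> K xK v /= vM; apply: le_trans (ltW xK).
  rewrite (_ : v = x - (x - v)); last by rewrite opprB addrC subrK.
  by apply: le_trans (ler_normB _ _) _; rewrite lerD2l.
have c : continuous (fun v : 'rV[R]_n => `|x - v|).
  apply: (@cont_lip _ _ _ _ 1) => u v; rewrite mul1r.
  apply: le_trans (ler_dist_dist _ _) _.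
  by rewrite opprB addrC addrA subrK distrC.
have -> : [set v : 'rV[R]_n | `|x - v| <= M] = (fun v : 'rV[R]_n => `|x - v|) @^-1` [set r | r <= M] by [].
by apply: preimage_closed => //; exact: closed_le.
Qed.

Lemma bsuppP n (f : 'rV[R]_n -> R) : compact (supp f) <-> bsupp f.
Proof.
split => [/compact_bounded [M [_ H]]|[M H]].
  (* The first unit makes the bound exceed [M] strictly, as boundedness requires; the second makes
     [f] vanish on the sphere of the chosen radius too. *)
  exists (M + 1 + 1) => a Ma; apply/eqP; apply: contraTT Ma => fa.
  rewrite -ltNge; apply: (@le_lt_trans _ _ (M + 1)); last by rewrite ltrDl.
  apply: H; first by rewrite ltrDl.
  by apply: subset_closure.
have K := @compact_cball n 0 M.
apply: (subclosed_compact _ K); first exact: closed_closure.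
have cK : closed [set v : 'rV[R]_n | `|0 - v| <= M].
  by apply: compact_closed => //; exact: norm_hausdorff.
rewrite [X in _ `<=` X]((closure_id _).1 cK); apply: closureS => a /= fa.
by rewrite sub0r normrN leNgt; apply: contra fa => /ltW/H ->.
Qed.

Lemma Cc_infP n (f : 'rV[R]_n -> R) : Cc_inf f <-> smooth f /\ bsupp f.
Proof. by split=> -[sf /bsuppP]. Qed.

Lemma bsuppM n (f g : 'rV[R]_n -> R) : bsupp g -> bsupp (fun x => f x * g x).
Proof. by move=> [M H]; exists M => a /H ->; rewrite mulr0. Qed.

Lemma bsuppD n (f g : 'rV[R]_n -> R) : bsupp f -> bsupp g -> bsupp (fun x => f x + g x).
Proof.
move=> [M H] [M' H']; exists (Num.max M M') => a; rewrite ge_max => /andP[/H -> /H' ->].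
by rewrite addr0.
Qed.

Lemma bsupp_affine n (f : 'rV[R]_n -> R) c (a : 'rV[R]_n) : c != 0 ->
  bsupp f -> bsupp (fun y => f (c *: y + a)).
Proof.
move=> c0 [M H]; exists ((M + `|a|) / `|c|) => y.
rewrite ler_pdivrMr ?normr_gt0// => Hy; apply: H.
rewrite -(lerD2r `|a|); apply: le_trans Hy _.
rewrite mulrC -normrZ -[X in `|X| <= _](addrK a); exact: ler_normB.
Qed.

Lemma bsupp_derive n (f : 'rV[R]_n -> R) v : bsupp f -> bsupp ('D_v f).
Proof.
move=> [M H]; exists (M + 1) => x Mx; apply: (derive_zero_out _ H).
by apply: lt_le_trans Mx; rewrite ltrDl.
Qed.

Lemma Cc_inf_derive n (f : 'rV[R]_n -> R) v : Cc_inf f -> Cc_inf ('D_v f).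
Proof.
move=> /Cc_infP[sf bf]; apply/Cc_infP; split; first exact: smooth_derive.
exact: bsupp_derive.
Qed.

Lemma Cc_infD n (f g : 'rV[R]_n -> R) : Cc_inf f -> Cc_inf g -> Cc_inf (fun x => f x + g x).
Proof.
move=> /Cc_infP[sf bf] /Cc_infP[sg bg]; apply/Cc_infP; split; last exact: bsuppD.
exact: smoothD.
Qed.

Lemma Cc_infM n (f g : 'rV[R]_n -> R) : smooth f -> Cc_inf g -> Cc_inf (fun x => f x * g x).
Proof.
move=> sf /Cc_infP[sg bg]; apply/Cc_infP; split; last exact: bsuppM.
exact: smoothM.
Qed.

Lemma Cc_inf_affine n (f : 'rV[R]_n -> R) c (a : 'rV[R]_n) : c != 0 ->
  Cc_inf f -> Cc_inf (fun y => f (c *: y + a)).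
Proof.
move=> c0 /Cc_infP[sf bf]; apply/Cc_infP; split; first exact: smooth_affine.
exact: bsupp_affine.
Qed.

Definition wtK n (M : R) : R := (1 + M ^+ 2) ^+ n.

Lemma wtK_le n (M : R) (a : 'rV[R]_n) : `|a| <= M -> 1 <= wtK n M * wt a.
Proof.
move=> aM; rewrite /wtK /wt -[X in _ ^+ X](card_ord n) -prodr_const -big_split/=.
elim/big_ind : _ => [//|x y x1 y1|i _]; first by rewrite -[1]mulr1 ler_pM.
rewrite /iw ler_pdivlMr ?mul1r ?lerD2l ?ltr_pwDl ?sqr_ge0//.
by rewrite -real_normK ?num_real// lerXn2r ?nnegrE// ?(le_trans (coord_le_norm _ _) aM)// (le_trans (normr_ge0 a)).
Qed.

Lemma dom_of_bounded n (g : 'rV[R]_n -> R) (B M : R) : continuous g ->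
  (forall a, `|g a| <= B) -> (forall a, M <= `|a| -> g a = 0) ->
  dom (B * wtK n M) g.
Proof.
move=> cg gB gM; split => // a.
have B0 : 0 <= B := le_trans (normr_ge0 _) (gB a).
have [aM|aM] := leP `|a| M.
  by apply: le_trans (gB a) _; rewrite -mulrA ler_peMr// wtK_le.
rewrite gM ?(ltW aM)// normr0 !mulr_ge0// ?(ltW (wt_gt0 _))//.
by rewrite exprn_ge0// addr_ge0// sqr_ge0.
Qed.

Lemma cont_bsupp_bounded n (g : 'rV[R]_n -> R) : continuous g -> bsupp g ->
  exists2 B : R, 0 <= B & forall a, `|g a| <= B.
Proof.
move=> cg [M gM].
have ne : [set v : 'rV[R]_n | `|0 - v| <= Num.max M 0] !=set0.
  by exists 0; rewrite /= subrr normr0 le_max lexx orbT.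
have cn : {within [set v : 'rV[R]_n | `|0 - v| <= Num.max M 0], continuous (fun a => `|g a|)}.
  by apply: continuous_subspaceT; exact: (cont_comp cg (@norm_continuous _ R)).
have [a _ aM] := EVT_max_rV ne (@compact_cball _ _ _) cn.
exists `|g a| => // b; have [bM|bM] := leP `|b| M.
  by apply: aM; rewrite inE /= sub0r normrN le_max bM.
by rewrite gM ?normr0// ltW.
Qed.

Lemma dom_bsupp n (g : 'rV[R]_n -> R) : continuous g -> bsupp g -> exists C, dom C g.
Proof.
move=> cg bg; have [B _ gB] := cont_bsupp_bounded cg bg; have [M gM] := bg.
by exists (B * wtK n M); exact: dom_of_bounded.
Qed.

Lemma iint_shift n C (g : 'rV[R]_n -> R) x : dom C g ->
  iint (fun a => g (x + a)) = iint g.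
Proof.
move=> dg; have := iint_affine x ltr01 dg; rewrite expr1n invr1 mul1r => <-.
by congr iint; apply/funext => a; rewrite scale1r.
Qed.

Lemma dom_shift n C (g : 'rV[R]_n -> R) x : dom C g ->
  exists C', dom C' (fun a => g (x + a)).
Proof.
move=> dg; have := dom_affine x ltr01 dg; set C' := (X in dom X _).
by move=> H; exists C'; under eq_fun do rewrite -[X in g (x + X)]scale1r.
Qed.

(** This is integration by parts without boundary terms. The difference quotients have integral 0 by
    translation invariance; they are bounded by the mean value theorem and live in a common ball, so
    their limit has integral 0. *)
Lemma iint_derive0 n (g : 'rV[R]_n -> R) v : continuous g -> bsupp g ->
  (forall x, derivable g x v) -> continuous ('D_v g) -> iint ('D_v g) = 0.
Proof.
move=> cg bg dg cDg; have [M gM] := bg.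
have [B B0 DB] := cont_bsupp_bounded cDg (bsupp_derive v bg).
pose q (k : nat) (a : 'rV[R]_n) := k.+1%:R * (g (k.+1%:R^-1 *: v + a) - g a).
have [C dC] := dom_bsupp cg bg.
have qD : iint (q k) @[k --> \oo] --> iint ('D_v g).
  (* All shifts are by at most [|v|], so the radius [M + |v|] contains the supports of all the
     quotients. *)
  apply: (@iint_dct _ _ (B * wtK n (M + `|v|))) => [k|a].
    apply: dom_of_bounded.
    - apply: contM; first exact: cont_cst.
      apply: contB => //; apply: cont_comp cg.
      apply: (@cont_lip _ _ _ _ 1) => x y.
      by rewrite opprD addrACA subrr add0r mul1r.
    - move=> a; rewrite normrM ger0_norm// mulrC -ler_pdivlMr ?ltr0n//.
      by apply: mean_value_line => //; rewrite invr_gt0 ltr0n.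
    - move=> a Ma; rewrite /q gM.
        rewrite gM ?subrr ?mulr0//; apply: le_trans Ma; by rewrite lerDl.
      rewrite -(lerD2r `|v|); apply: le_trans Ma _.
      rewrite -{1}[a](addKr (k.+1%:R^-1 *: v)) addrC.
      apply: le_trans (ler_normD _ _) _; rewrite lerD2l normrN normrZ ler_piMl//.
      by rewrite ger0_norm// invf_le1// ler1n.
  exact: derive_seq.
have q0 k : iint (q k) = 0.
  have [C' dC'] := dom_shift (k.+1%:R^-1 *: v) dC.
  have dN := domZ (-1) dC; have dD := domD dC' dN.
  rewrite (iintZ (C := C' + `|-1| * C)); last first.
    by under eq_fun do rewrite -mulN1r.
  by rewrite (iintB dC' dC) (iint_shift _ dC) subrr mulr0.
have q0' : iint (q k) @[k --> \oo] --> (0 : R).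
  by rewrite (_ : (fun k => _) = (fun _ => 0)); [exact: cvg_cst|exact/funext].
exact: (cvg_unique _ qD q0').
Qed.

End smooth_functions.

(** * Fourier inversion *)

Section dot_product.
Variables (R : realType) (n : nat).
Implicit Types x y z : 'rV[R]_n.

Lemma dotpC x y : dotp x y = dotp y x.
Proof. by apply: eq_bigr => i _; rewrite mulrC. Qed.

Lemma dotpDl x y z : dotp (x + y) z = dotp x z + dotp y z.
Proof. by rewrite -big_split; apply: eq_bigr => i _; rewrite rvD mulrDl. Qed.

Lemma dotpZl c x z : dotp (c *: x) z = c * dotp x z.
Proof. by rewrite /dotp mulr_sumr; apply: eq_bigr => i _; rewrite rvZ mulrA. Qed.

Lemma dotpDr x y z : dotp z (x + y) = dotp z x + dotp z y.
Proof. by rewrite dotpC dotpDl !(dotpC z). Qed.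

Lemma dotpZr c x z : dotp z (c *: x) = c * dotp z x.
Proof. by rewrite dotpC dotpZl (dotpC z). Qed.

Lemma dotpNl x z : dotp (- x) z = - dotp x z.
Proof. by rewrite -scaleN1r dotpZl mulN1r. Qed.

Lemma dotpNr x z : dotp z (- x) = - dotp z x.
Proof. by rewrite dotpC dotpNl dotpC. Qed.

Lemma dotpBl x y z : dotp (x - y) z = dotp x z - dotp y z.
Proof. by rewrite dotpDl dotpNl. Qed.

Lemma dotp0l z : dotp 0 z = 0.
Proof. by rewrite -(scale0r (0 : 'rV[R]_n)) dotpZl mul0r. Qed.

Lemma dotp0r z : dotp z 0 = 0.
Proof. by rewrite dotpC dotp0l. Qed.

Lemma dotp_delta j z : dotp (delta_mx 0 j) z = z 0 j.
Proof.
rewrite /dotp (bigD1 j)//= mxE !eqxx mul1r big1 ?addr0// => i ij.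
by rewrite mxE eqxx (negbTE ij) mul0r.
Qed.

Lemma dotp_ge0 x : 0 <= dotp x x.
Proof. by apply: sumr_ge0 => i _; rewrite -expr2 sqr_ge0. Qed.

Lemma cont_sum (T : topologicalType) m (f : 'I_m -> T -> R) :
  (forall i, continuous (f i)) -> continuous (fun t : T => \sum_(i < m) f i t).
Proof.
elim: m f => [|m IH] f cf.
  by under eq_fun do rewrite big_ord0; exact: cont_cst.
under eq_fun do rewrite big_ord_recl.
by apply: contD => //; apply: IH => i; exact: cf.
Qed.

Lemma continuous_dotpl z : continuous (fun x => dotp x z).
Proof.
apply: cont_sum => i; apply: contM; first exact: continuous_coord.
exact: cont_cst.
Qed.

Lemma continuous_dotpr z : continuous (dotp z).
Proof.
apply: cont_sum => i; apply: contM; last exact: continuous_coord.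
exact: cont_cst.
Qed.

Lemma enorm_ge0 x : 0 <= enorm x.
Proof. exact: sqrtr_ge0. Qed.

Lemma enorm_sqr x : enorm x ^+ 2 = dotp x x.
Proof. by rewrite sqr_sqrtr// dotp_ge0. Qed.

Lemma enorm0 : enorm (0 : 'rV[R]_n) = 0.
Proof. by rewrite /enorm dotp0l sqrtr0. Qed.

Lemma enormN x : enorm (- x) = enorm x.
Proof. by rewrite /enorm dotpNl dotpNr opprK. Qed.

Lemma enormZ c x : enorm (c *: x) = `|c| * enorm x.
Proof. by rewrite /enorm dotpZl dotpZr mulrA -expr2 sqrtrM ?sqr_ge0// sqrtr_sqr. Qed.

Lemma cauchy_schwarz x y : `|dotp x y| <= enorm x * enorm y.
Proof.
have H t : 0 <= dotp x x + 2 * t * dotp x y + t ^+ 2 * dotp y y.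
  have := dotp_ge0 (x + t *: y); rewrite dotpDl !dotpDr !dotpZl !dotpZr (dotpC y x).
  by move=> h; apply: le_trans h _; rewrite le_eqVlt; apply/orP; left; apply/eqP; ring.
rewrite -(ler_pXn2r (n := 2))// ?nnegrE ?mulr_ge0 ?enorm_ge0// exprMn !enorm_sqr.
rewrite real_normK ?num_real//.
have [Y0|Y0] := eqVneq (dotp y y) 0.
  have [->|Z0] := eqVneq (dotp x y) 0; first by rewrite expr0n/= mulr_ge0 ?dotp_ge0.
  (* Without its quadratic term the polynomial is affine in [t], and this [t] would give it the
     value -1. Below, when [dotp y y] is positive, the minimiser is inserted instead. *)
  have := H (- (dotp x x + 1) / (2 * dotp x y)); rewrite Y0 mulr0 addr0.
  rewrite (_ : 2 * _ * _ = - (dotp x x + 1)); last by field.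
  by lra.
have Yp : 0 < dotp y y by rewrite lt_neqAle eq_sym Y0 dotp_ge0.
have := H (- dotp x y / dotp y y).
rewrite (_ : _ + _ = dotp x x - dotp x y ^+ 2 / dotp y y); last by field.
by rewrite subr_ge0 ler_pdivrMr.
Qed.

Lemma enormD x y : enorm (x + y) <= enorm x + enorm y.
Proof.
rewrite -(ler_pXn2r (n := 2))// ?nnegrE ?addr_ge0 ?enorm_ge0//.
rewrite sqrrD !enorm_sqr dotpDl !dotpDr (dotpC y x).
have := cauchy_schwarz x y; have := ler_norm (dotp x y); rewrite -mulr_natr; lra.
Qed.

Lemma enormB x y : enorm (x - y) <= enorm x + enorm y.
Proof. by rewrite -(enormN y); exact: enormD. Qed.

Lemma coord_le_enorm x i : `|x 0 i| <= enorm x.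
Proof.
rewrite -(ler_pXn2r (n := 2))// ?nnegrE ?enorm_ge0// enorm_sqr real_normK ?num_real//.
rewrite /dotp (bigD1 i)//= -expr2 lerDl; apply: sumr_ge0 => j _.
by rewrite -expr2 sqr_ge0.
Qed.

Lemma norm_le_enorm x : `|x| <= enorm x.
Proof. by apply: norm_le_coord; [exact: enorm_ge0|exact: coord_le_enorm]. Qed.

Lemma enorm_le_norm x : enorm x <= n%:R * `|x|.
Proof.
rewrite -(ler_pXn2r (n := 2))// ?nnegrE ?mulr_ge0 ?enorm_ge0//.
rewrite enorm_sqr exprMn; apply: (@le_trans _ _ (\sum_(i < n) `|x| ^+ 2)).
  apply: ler_sum => i _; rewrite -expr2 -real_normK ?num_real//.
  by rewrite lerXn2r ?nnegrE// coord_le_norm.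
rewrite sumr_const card_ord -[leLHS]mulr_natl ler_wpM2r ?sqr_ge0//.
by rewrite -natrX ler_nat; case: (n) => // m; rewrite expnS leq_pmulr// expn1.
Qed.

Lemma enorm_eq0 x : enorm x = 0 -> x = 0.
Proof.
by move=> x0; apply/eqP; rewrite -normr_eq0 eq_le normr_ge0 andbT -x0 norm_le_enorm.
Qed.

Lemma continuous_enorm : continuous (@enorm R n).
Proof.
apply: (cont_comp (f := fun x => dotp x x)); last exact: sqrt_continuous.
by apply: cont_sum => i; apply: contM; exact: continuous_coord.
Qed.

End dot_product.

(** * Cosine and sine transforms of test functions *)

Section trigonometric_transforms.
Variables (R : realType) (n : nat).
Implicit Types (f : 'rV[R]_n -> R) (x a v xi : 'rV[R]_n).

(** Up to the factor [(2 * pi) ^- n], [cosT] and [sinT] are the real and imaginary parts of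
    [expi (dotp x xi) * fourier f xi]. Keeping [x] inside the phase lets all computations stay
    real. *)
Definition cosT f x xi : R := iint (fun a => cos (dotp (x - a) xi) * f a).
Definition sinT f x xi : R := iint (fun a => sin (dotp (x - a) xi) * f a).

Lemma continuous_phase_a (h : R -> R) x xi : continuous h ->
  continuous (fun a => h (dotp (x - a) xi)).
Proof.
move=> ch; apply: (cont_comp (f := fun a => dotp (x - a) xi)) ch.
under eq_fun do rewrite dotpBl.
by apply: contB; [exact: cont_cst|exact: continuous_dotpl].
Qed.

Lemma continuous_phase_x (h : R -> R) a xi : continuous h ->
  continuous (fun x => h (dotp (x - a) xi)).
Proof.
move=> ch; apply: (cont_comp (f := fun x => dotp (x - a) xi)) ch.
under eq_fun do rewrite dotpBl.
by apply: contB; [exact: continuous_dotpl|exact: cont_cst].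
Qed.

Lemma continuous_phase_xi (h : R -> R) x a : continuous h ->
  continuous (fun xi => h (dotp (x - a) xi)).
Proof. by move=> ch; exact: (cont_comp (@continuous_dotpr _ _ _) ch). Qed.

Lemma dom_bounded_mul C f (c : 'rV[R]_n -> R) : continuous c ->
  (forall a, `|c a| <= 1) -> dom C f -> dom C (fun a => c a * f a).
Proof.
move=> cc c1 [cf fC]; split => [|a]; first exact: contM.
by rewrite normrM; apply: le_trans (fC a); rewrite ler_piMl.
Qed.

Lemma dom_cosT C f x xi : dom C f -> dom C (fun a => cos (dotp (x - a) xi) * f a).
Proof.
apply: dom_bounded_mul => [|a]; last exact: cos_max.
by apply: continuous_phase_a; exact: continuous_cos.
Qed.

Lemma dom_sinT C f x xi : dom C f -> dom C (fun a => sin (dotp (x - a) xi) * f a).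
Proof.
apply: dom_bounded_mul => [|a]; last exact: sin_max.
by apply: continuous_phase_a; exact: continuous_sin.
Qed.

Lemma continuous_cosT C f x : dom C f -> continuous (cosT f x).
Proof.
move=> df; apply: (iint_continuousT (C := C)) => [xi|a]; first exact: dom_cosT.
by apply: contM; [apply: continuous_phase_xi; exact: continuous_cos|exact: cont_cst].
Qed.

Lemma continuous_sinT C f x : dom C f -> continuous (sinT f x).
Proof.
move=> df; apply: (iint_continuousT (C := C)) => [xi|a]; first exact: dom_sinT.
by apply: contM; [apply: continuous_phase_xi; exact: continuous_sin|exact: cont_cst].
Qed.

Lemma continuous_cosT_x C f xi : dom C f -> continuous (fun x => cosT f x xi).
Proof.
move=> df; apply: (iint_continuousT (C := C)) => [x|a]; first exact: dom_cosT.
by apply: contM; [apply: continuous_phase_x; exact: continuous_cos|exact: cont_cst].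
Qed.

Lemma continuous_sinT_x C f xi : dom C f -> continuous (fun x => sinT f x xi).
Proof.
move=> df; apply: (iint_continuousT (C := C)) => [x|a]; first exact: dom_sinT.
by apply: contM; [apply: continuous_phase_x; exact: continuous_sin|exact: cont_cst].
Qed.

Lemma Cc_dom f : Cc_inf f -> exists C, dom C f.
Proof. by move=> /Cc_infP[sf bf]; apply: dom_bsupp => //; exact: smooth_cont. Qed.

Lemma phase_line x a v xi (s : R) :
  dotp (x - (s *: v + a)) xi = dotp (x - a) xi - s * dotp v xi.
Proof. by rewrite !dotpBl dotpDl dotpZl; ring. Qed.

Lemma is_derive_cos_phase x a v xi :
  is_derive a v (fun a => cos (dotp (x - a) xi)) (dotp v xi * sin (dotp (x - a) xi)).
Proof.
apply: is_derive_line; rewrite (_ : (fun _ => _) = cos \o (fun s : R => dotp (x - a) xi + - dotp v xi * s)); last first.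
  by apply/funext => s /=; rewrite phase_line mulNr mulrC.
have H : is_derive (0 : R) (1 : R) (fun s : R => dotp (x - a) xi + - dotp v xi * s) (- dotp v xi).
  by apply: is_derive_eq; rewrite add0r mul1r /GRing.scale/= mulr1.
have := is_derive1_comp (is_derive_cos _) H; rewrite mulr0 addr0 mulrNN mulrC.
exact.
Qed.

Lemma is_derive_sin_phase x a v xi :
  is_derive a v (fun a => sin (dotp (x - a) xi)) (- (dotp v xi * cos (dotp (x - a) xi))).
Proof.
apply: is_derive_line; rewrite (_ : (fun _ => _) = sin \o (fun s : R => dotp (x - a) xi + - dotp v xi * s)); last first.
  by apply/funext => s /=; rewrite phase_line mulNr mulrC.
have H : is_derive (0 : R) (1 : R) (fun s : R => dotp (x - a) xi + - dotp v xi * s) (- dotp v xi).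
  by apply: is_derive_eq; rewrite add0r mul1r /GRing.scale/= mulr1.
have := is_derive1_comp (is_derive_sin _) H; rewrite mulr0 addr0 mulrN mulrC.
exact.
Qed.

(** The derivative along [v] of a trigonometric factor times [f] integrates to 0, which trades the
    factor [dotp v xi] for a derivative of [f]. *)
Lemma sinT_parts f x v xi : Cc_inf f ->
  dotp v xi * sinT f x xi = - cosT ('D_v f) x xi.
Proof.
move=> Cf; have [C df] := Cc_dom Cf; have [C' dDf] := Cc_dom (Cc_inf_derive v Cf).
have /Cc_infP[sf bf] := Cf.
have E : 'D_v (fun a => cos (dotp (x - a) xi) * f a) =
    (fun a => cos (dotp (x - a) xi) * 'D_v f a + dotp v xi * (sin (dotp (x - a) xi) * f a)).
  apply/funext => a; have [d1 d2] := is_derive_cos_phase x a v xi.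
  by rewrite (deriveM d1 (smooth_derivable sf)) d2 /GRing.scale/=; ring.
have := @iint_derive0 _ _ (fun a => cos (dotp (x - a) xi) * f a) v.
rewrite E (iintD (dom_cosT _ _ dDf) (domZ _ (dom_sinT _ _ df))) (iintZ _ (dom_sinT _ _ df)).
rewrite -/(cosT _ _ _) -/(sinT _ _ _) => H; apply/eqP; rewrite -subr_eq0 opprK addrC; apply/eqP.
apply: H.
- exact: (dom_cosT _ _ df).1.
- exact: bsuppM.
- by move=> a; apply: derivableM; [have [] := is_derive_cos_phase x a v xi|exact: smooth_derivable].
- exact: (domD (dom_cosT _ _ dDf) (domZ _ (dom_sinT _ _ df))).1.
Qed.

Lemma cosT_parts f x v xi : Cc_inf f ->
  dotp v xi * cosT f x xi = sinT ('D_v f) x xi.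
Proof.
move=> Cf; have [C df] := Cc_dom Cf; have [C' dDf] := Cc_dom (Cc_inf_derive v Cf).
have /Cc_infP[sf bf] := Cf.
have E : 'D_v (fun a => sin (dotp (x - a) xi) * f a) =
    (fun a => sin (dotp (x - a) xi) * 'D_v f a + (- dotp v xi) * (cos (dotp (x - a) xi) * f a)).
  apply/funext => a; have [d1 d2] := is_derive_sin_phase x a v xi.
  by rewrite (deriveM d1 (smooth_derivable sf)) d2 /GRing.scale/=; ring.
have := @iint_derive0 _ _ (fun a => sin (dotp (x - a) xi) * f a) v.
rewrite E (iintD (dom_sinT _ _ dDf) (domZ _ (dom_cosT _ _ df))) (iintZ _ (dom_cosT _ _ df)).
rewrite -/(cosT _ _ _) -/(sinT _ _ _) => H; apply/esym/eqP; rewrite -subr_eq0 -mulNr; apply/eqP.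
apply: H.
- exact: (dom_sinT _ _ df).1.
- exact: bsuppM.
- by move=> a; apply: derivableM; [have [] := is_derive_sin_phase x a v xi|exact: smooth_derivable].
- exact: (domD (dom_sinT _ _ dDf) (domZ _ (dom_cosT _ _ df))).1.
Qed.

(** The operator identity minus the second derivative along the [j]-th axis. The transform turns it
    into multiplication by [1 + xi_j ^+ 2], the inverse of one factor of [wt]. *)
Definition helmholtz (j : 'I_n) f : 'rV[R]_n -> R :=
  fun a => f a + -1 * 'D_(delta_mx 0 j) ('D_(delta_mx 0 j) f) a.

Lemma Cc_inf_helmholtz j f : Cc_inf f -> Cc_inf (helmholtz j f).
Proof.
move=> Cf; apply: Cc_infD => //; apply: Cc_infM; first exact: smooth_cst.
by do 2 apply: Cc_inf_derive.
Qed.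

Lemma trig_helmholtz j f x xi : Cc_inf f ->
  cosT (helmholtz j f) x xi = (1 + xi 0 j ^+ 2) * cosT f x xi /\
  sinT (helmholtz j f) x xi = (1 + xi 0 j ^+ 2) * sinT f x xi.
Proof.
move=> Cf; have [C df] := Cc_dom Cf; pose e : 'rV[R]_n := delta_mx 0 j.
have Cf1 := Cc_inf_derive e Cf; have Cf2 := Cc_inf_derive e Cf1.
have [C2 df2] := Cc_dom Cf2.
have A : cosT (helmholtz j f) x xi = cosT f x xi - cosT ('D_e ('D_e f)) x xi.
  rewrite -(iintB (dom_cosT x xi df) (dom_cosT x xi df2)).
  by congr iint; apply/funext => a; rewrite /helmholtz -/e; ring.
have B : sinT (helmholtz j f) x xi = sinT f x xi - sinT ('D_e ('D_e f)) x xi.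
  rewrite -(iintB (dom_sinT x xi df) (dom_sinT x xi df2)).
  by congr iint; apply/funext => a; rewrite /helmholtz -/e; ring.
have E : dotp e xi = xi 0 j by exact: dotp_delta.
have c1 := sinT_parts x e xi Cf1; have c2 := cosT_parts x e xi Cf.
have s1 := cosT_parts x e xi Cf1; have s2 := sinT_parts x e xi Cf.
rewrite E in c1 c2 s1 s2; rewrite A B; split.
  by rewrite mulrDl mul1r expr2 -mulrA c2 c1.
by rewrite mulrDl mul1r expr2 -mulrA s2 mulrN s1.
Qed.

Lemma trig_helmholtz_seq (s : seq 'I_n) f x xi : Cc_inf f ->
  Cc_inf (foldr helmholtz f s) /\
  cosT (foldr helmholtz f s) x xi = (\prod_(j <- s) (1 + xi 0 j ^+ 2)) * cosT f x xi /\
  sinT (foldr helmholtz f s) x xi = (\prod_(j <- s) (1 + xi 0 j ^+ 2)) * sinT f x xi.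
Proof.
move=> Cf; elim: s => [|j s [Cs [Ec Es]]] /=; first by rewrite !big_nil !mul1r.
split; first exact: Cc_inf_helmholtz.
have [-> ->] := trig_helmholtz j x xi Cs.
by rewrite !big_cons Ec Es !mulrA.
Qed.

Lemma trig_decay f : Cc_inf f -> exists2 C, 0 <= C &
  forall x xi, `|cosT f x xi| <= C * wt xi ^+ 2 /\ `|sinT f x xi| <= C * wt xi ^+ 2.
Proof.
(* Each coordinate is listed twice to obtain [wt ^+ 2]: one power will absorb the quadratic growth
   of the symbol, the other keeps the product integrable. *)
move=> Cf; pose s := index_enum 'I_n ++ index_enum 'I_n.
have [Cg _] := trig_helmholtz_seq s 0 0 Cf; have [C dg] := Cc_dom Cg.
have K0 : 0 <= C * iwint R ^+ n by rewrite mulr_ge0 ?(dom_ge0 dg)// exprn_ge0// iwint_ge0.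
exists (C * iwint R ^+ n) => // x xi.
have [_ [Ec Es]] := trig_helmholtz_seq s x xi Cf.
pose P := \prod_(j <- s) (1 + xi 0 j ^+ 2).
have PE : P = (wt xi ^+ 2)^-1.
  by rewrite /P /s big_cat/= expr2 invfM /wt -prodfV; congr (_ * _);
    apply: eq_bigr => i _; rewrite invrK.
have W0 : 0 < wt xi ^+ 2 by rewrite exprn_gt0// wt_gt0.
have P0 : 0 < P by rewrite PE invr_gt0.
have B1 := iint_bound (dom_cosT x xi dg); have B2 := iint_bound (dom_sinT x xi dg).
rewrite -/(cosT _ _ _) Ec -/P normrM gtr0_norm// PE mulrC ler_pdivrMr// in B1.
by rewrite -/(sinT _ _ _) Es -/P normrM gtr0_norm// PE mulrC ler_pdivrMr// in B2.
Qed.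

Lemma trig_dom f : Cc_inf f -> exists C, forall x, dom C (cosT f x) /\ dom C (sinT f x).
Proof.
move=> Cf; have [C C0 H] := trig_decay Cf; have [C' df] := Cc_dom Cf.
have W xi : C * wt xi ^+ 2 <= C * wt xi.
  by rewrite ler_wpM2l// expr2 ler_piMl ?wt_le1// ltW// wt_gt0.
exists C => x; split; split; [exact: continuous_cosT df| |exact: continuous_sinT df|];
  by move=> xi; have [h1 h2] := H x xi; (apply: le_trans (W xi)).
Qed.

Lemma cosT_even f xi : cosT f 0 (- xi) = cosT f 0 xi.
Proof. by congr iint; apply/funext => a; rewrite dotpNr cosN. Qed.

Variable chi : 'rV[R]_n -> R.
Hypothesis Cchi : Cc_inf chi.
Hypothesis chi0 : chi 0 = 1.
Hypothesis chi_ge0 : forall a, 0 <= chi a.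

(* Its value is (2 pi)^n, but only its positivity matters. *)
Definition inv_cst : R := iint (cosT chi 0).

(* Regularising by chi(xi/k) turns the double integral into the convolution of f
   with an approximate identity built from the transform of chi. *)
Lemma inversion_approx f x (k : nat) : Cc_inf f ->
  iint (fun xi => chi (k.+1%:R^-1 *: xi) * cosT f x xi) =
  iint (fun b => f (x + k.+1%:R^-1 *: b) * cosT chi 0 b).
Proof.
move=> Cf; have [Cf' df] := Cc_dom Cf; have [Cc dc] := Cc_dom Cchi.
set e : R := k.+1%:R^-1; have e0 : 0 < e by rewrite invr_gt0 ltr0n.
have eV : e^-1 = k.+1%:R by rewrite invrK.
have [C2 dce] : exists C2, dom C2 (fun xi => chi (e *: xi)).
  have := dom_affine 0 e0 dc; set C2 := (X in dom X _) => H; exists C2.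
  by move: H; under eq_fun do rewrite add0r.
have [CQ dQ] : exists CQ, dom CQ (cosT chi 0).
  by have [CQ H] := trig_dom Cchi; exists CQ; have [] := H 0.
transitivity (iint (fun xi => iint (fun a => chi (e *: xi) * (cos (dotp (x - a) xi) * f a)))).
  by congr iint; apply/funext => xi; rewrite (iintZ _ (dom_cosT x xi df)).
rewrite (iint_swap (C := C2 * Cf')); first last.
- move=> xi a; rewrite !normrM.
  rewrite [X in _ <= X](_ : _ = (C2 * wt xi) * (Cf' * wt a)); last by ring.
  apply: ler_pM => //; first exact: dce.2.
  by apply: le_trans (df.2 a); rewrite ler_piMl// cos_max.
- by move=> xi; apply: contM; [exact: cont_cst|exact: (dom_cosT x xi df).1].
- move=> a; apply: contM; first exact: dce.1.
  apply: contM; last exact: cont_cst.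
  by apply: continuous_phase_xi; exact: continuous_cos.
(* For fixed [a], rescaling [xi] by [e] exhibits the transform of [chi] at the frequency
   [(x - a) / e]. *)
have I a : iint (fun xi => chi (e *: xi) * (cos (dotp (x - a) xi) * f a)) =
    e ^- n * (f a * cosT chi 0 (e^-1 *: (x - a))).
  transitivity (iint (fun xi => f a * (fun eta => cos (dotp (0 - eta) (e^-1 *: (x - a))) * chi eta) (0 + e *: xi))).
    congr iint; apply/funext => xi; rewrite !add0r dotpNl cosN dotpZl dotpZr.
    by rewrite [e * _]mulrA divff ?lt0r_neq0// mul1r (dotpC xi); ring.
  have dG := dom_cosT 0 (e^-1 *: (x - a)) dc.
  rewrite (iintZ _ (dom_affine 0 e0 dG)) (iint_affine 0 e0 dG) -/(cosT _ _ _).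
  by ring.
have dH : dom (Cf' * CQ) (fun a => f a * cosT chi 0 (e^-1 *: (x - a))).
  split.
    apply: contM; first exact: df.1.
    apply: (cont_comp (f := fun a => e^-1 *: (x - a))); last exact: dQ.1.
    apply: (@cont_lip _ _ _ _ `|e^-1|) => u v.
    by rewrite -scalerBr opprB addrC addrA subrK normrZ distrC.
  move=> a; rewrite normrM mulrAC; apply: ler_pM => //; first exact: df.2.
  by apply: le_trans (dQ.2 _) _; rewrite ler_piMr ?wt_le1//; exact: dom_ge0 dQ.
under eq_fun do rewrite I.
(* The substitution [a = x + e *: b] absorbs the factor [e ^- n]; it yields the frequency [- b],
   whose sign disappears because [cosT chi 0] is even. *)
rewrite (iintZ _ dH) -(iint_affine x e0 dH); congr iint; apply/funext => b /=.
rewrite opprD addrA subrr add0r -scaleNr scalerA mulrN mulVf ?lt0r_neq0//.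
by rewrite scaleN1r cosT_even.
Qed.

(** Both sides of [inversion_approx] converge by dominated convergence: on the left the cut-off
    tends to [chi 0 = 1], on the right the argument of [f] tends to [x]. *)
Lemma inversion f x : Cc_inf f -> iint (cosT f x) = inv_cst * f x.
Proof.
move=> Cf; have [Cf' H] := trig_dom Cf; have [dU _] := H x.
have [CQ dQ] : exists CQ, dom CQ (cosT chi 0).
  by have [CQ H'] := trig_dom Cchi; exists CQ; have [] := H' 0.
have /Cc_infP[sf bf] := Cf; have /Cc_infP[sc bc] := Cchi.
have [B B0 fB] := cont_bsupp_bounded (smooth_cont sf) bf.
have [B' B'0 cB] := cont_bsupp_bounded (smooth_cont sc) bc.
have e0 : (k.+1%:R^-1 : R) @[k --> \oo] --> 0.
  apply/cvgrPdist_lt => e e0; apply: filterS (near_infty_natSinv_lt (PosNum e0)).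
  by move=> k ke; rewrite sub0r normrN gtr0_norm ?invr_gt0.
have es v : (k.+1%:R^-1 *: v : 'rV[R]_n) @[k --> \oo] --> (0 : 'rV[R]_n).
  by rewrite -[X in _ --> X](scale0r v); apply: (cvg_cont (f := fun s : R => s *: v)) e0; exact: scalel_continuous.
have mulB (K K' : R) (g h : 'rV[R]_n -> R) : continuous g -> (forall v, `|g v| <= K) ->
    0 <= K -> dom K' h -> dom (K * K') (fun v => g v * h v).
  move=> cg gK K0 [ch hK]; split; first exact: contM.
  by move=> v; rewrite normrM -mulrA; apply: ler_pM.
have L1 : iint (fun xi => chi (k.+1%:R^-1 *: xi) * cosT f x xi) @[k --> \oo] --> iint (cosT f x).
  apply: (iint_dct (C := B' * Cf')) => [k|xi].
    apply: mulB => //; apply: (cont_comp (f := fun v : 'rV[R]_n => k.+1%:R^-1 *: v)); last exact: smooth_cont.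
    exact: scaler_continuous.
  have -> : nbhs (cosT f x xi) = nbhs (chi 0 * cosT f x xi) by rewrite chi0 mul1r.
  apply: cvgM; last exact: cvg_cst.
  by apply: (cvg_cont (smooth_cont sc)); exact: es.
have L2 : iint (fun b => f (x + k.+1%:R^-1 *: b) * cosT chi 0 b) @[k --> \oo] --> iint (fun b => f x * cosT chi 0 b).
  apply: (iint_dct (C := B * CQ)) => [k|b].
    apply: mulB => //; apply: (cont_comp (f := fun v : 'rV[R]_n => x + k.+1%:R^-1 *: v)); last exact: smooth_cont.
    by under eq_fun do rewrite addrC; exact: continuous_affine.
  apply: cvgM; last exact: cvg_cst.
  apply: (cvg_cont (smooth_cont sf)); rewrite -[X in _ --> X]addr0.
  by apply: cvgD; [exact: cvg_cst|exact: es].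
rewrite mulrC -(iintZ _ dQ); apply: (cvg_unique _ L1) => //.
by rewrite (_ : (fun k => _) = (fun k => iint (fun b => f (x + k.+1%:R^-1 *: b) * cosT chi 0 b)))//;
  apply/funext => k; exact: inversion_approx.
Qed.

(** A Plancherel identity for [chi]: the integral of the squared modulus of its transform equals
    [inv_cst] times the integral of [chi ^+ 2]. The former is positive, since at frequency 0 the
    transform is the integral of [chi]; the latter is nonnegative, so [inv_cst] cannot be [<= 0]. *)
Lemma inv_cst_gt0 : 0 < inv_cst.
Proof.
have [C dc] := Cc_dom Cchi; have [C' H] := trig_dom Cchi.
have C0 := dom_ge0 dc; have C'0 := dom_ge0 (H 0).1.
pose P xi := cosT chi 0 xi ^+ 2 + sinT chi 0 xi ^+ 2.
have sq (K : R) (g : 'rV[R]_n -> R) : 0 <= K -> dom K g -> dom (K * K) (fun v => g v ^+ 2).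
  move=> K0 [cg gC]; split; first exact: contM.
  move=> v; rewrite expr2 normrM -mulrA; apply: ler_pM => //.
  by apply: le_trans (gC v) _; rewrite ler_piMr// wt_le1.
have dP : dom (C' * C' + C' * C') P.
  by apply: domD; apply: sq => //; have [] := H 0.
have PE xi : P xi = iint (fun a => chi a * cosT chi a xi).
  rewrite /P !expr2 {1}/cosT {2}/sinT.
  rewrite -(iintZ _ (dom_sinT 0 xi dc)) mulrC -(iintZ _ (dom_cosT 0 xi dc)).
  rewrite -(iintD (domZ _ (dom_cosT 0 xi dc)) (domZ _ (dom_sinT 0 xi dc))).
  congr iint; apply/funext => a.
  have -> : cosT chi a xi = cos (dotp a xi) * cosT chi 0 xi + - sin (dotp a xi) * sinT chi 0 xi.
    rewrite -(iintZ _ (dom_cosT 0 xi dc)) -(iintZ _ (dom_sinT 0 xi dc)).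
    rewrite -(iintD (domZ _ (dom_cosT 0 xi dc)) (domZ _ (dom_sinT 0 xi dc))).
    by congr iint; apply/funext => b; rewrite !dotpBl dotp0l cosB sub0r cosN sinN; ring.
  by rewrite !dotpBl dotp0l sub0r cosN sinN; ring.
have S : iint P = inv_cst * iint (fun a => chi a ^+ 2).
  rewrite (_ : P = (fun xi => iint (fun a => chi a * cosT chi a xi))); last exact/funext.
  rewrite (iint_swap (C := C' * C)); first last.
  - move=> xi a; rewrite normrM mulrC (_ : C' * C * _ * _ = (C' * wt xi) * (C * wt a)); last by ring.
    by apply: ler_pM => //; [have [[]] := H a|exact: dc.2].
  - by move=> xi; apply: contM; [exact: dc.1|exact: continuous_cosT_x dc].
  - by move=> a; apply: contM; [exact: cont_cst|exact: continuous_cosT dc].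
  rewrite -(iintZ (C := C * C)); last exact: sq.
  congr iint; apply/funext => a; have [da _] := H a.
  by rewrite (iintZ _ da) inversion//; ring.
have P0 : 0 < iint P.
  apply: (iint_gt0 (v0 := 0) dP) => [v|]; first by rewrite addr_ge0// sqr_ge0.
  apply: ltr_pwDl; last exact: sqr_ge0.
  rewrite exprn_even_gt0//= lt0r_neq0//.
  rewrite /cosT (_ : (fun a => _) = chi); last first.
    by apply/funext => a; rewrite dotp0r cos0 mul1r.
  by apply: (iint_gt0 (v0 := 0) dc) => //; rewrite chi0.
have I0 : 0 <= iint (fun a => chi a ^+ 2) by apply: iint_ge0 => a; exact: sqr_ge0.
rewrite ltNge; apply/negP => c0; move: P0; rewrite S ltNge; apply/negP; rewrite negbK.
exact: mulr_le0_ge0.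
Qed.


End trigonometric_transforms.

(** * Borel sets and elementary bounds *)

Section real_trig_bounds.
Variable R : realType.
Implicit Types t : R.

Lemma sin_le_abs t : `|sin t| <= `|t|.
Proof.
wlog t0 : t / 0 <= t.
  move=> H; have [/H//|/ltW t0] := leP 0 t.
  by have := H (- t); rewrite sinN !normrN; apply; rewrite oppr_ge0.
have cs : {within `[0, t], continuous (@sin R)}.
  by apply: continuous_subspaceT => s; exact: continuous_sin.
have [s _] := MVT_segment t0 (fun s _ => is_derive_sin s) cs.
rewrite sin0 !subr0 => ->; rewrite normrM ler_piMl// cos_max//.
Qed.

Lemma sin_sqr_le t : sin t ^+ 2 <= t ^+ 2.
Proof.
rewrite -(real_normK (num_real (sin t))) -[leRHS](real_normK (num_real t)).
by rewrite lerXn2r ?nnegrE// sin_le_abs.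
Qed.

Lemma one_cosE t : 1 - cos t = 2 * sin (t / 2) ^+ 2.
Proof.
have E : cos t = cos (t / 2) ^+ 2 - sin (t / 2) ^+ 2 by rewrite {1}(splitr t) cosD -!expr2.
by have := cos2Dsin2 (t / 2); rewrite E; lra.
Qed.

Lemma one_cos_le t : `|1 - cos t| <= t ^+ 2.
Proof.
rewrite one_cosE normrM ger0_norm// ger0_norm ?sqr_ge0//.
by have := sin_sqr_le (t / 2); have := sqr_ge0 t; nra.
Qed.

Lemma one_cos_le2 t : `|1 - cos t| <= 2.
Proof. by have := cos_le1 t; have := cos_geN1 t; rewrite ler_norml; lra. Qed.

(** A quadratic bound is what Levy measures can integrate. The mean value theorem reduces it to
    [1 - cos s <= s] for [s >= 0], where [s ^+ 2 / 2] suffices up to 2 and the trivial bound 2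
    beyond. *)
Lemma sin_sub_le t : `|t - sin t| <= t ^+ 2.
Proof.
wlog t0 : t / 0 <= t.
  move=> H; have [/H//|/ltW t0] := leP 0 t.
  have := H (- t); rewrite sinN sqrrN -opprD normrN; apply; rewrite oppr_ge0//.
have D (s : R) : is_derive s (1 : R) (fun s : R => s - sin s) (1 - cos s).
  by apply: is_derive_eq.
have cs : {within `[0, t], continuous (fun s : R => s - sin s)}.
  apply: continuous_subspaceT => s; apply: cvgB; first exact: cvg_id.
  exact: continuous_sin.
have [s] := MVT_segment t0 (fun s _ => D s) cs.
rewrite in_itv/= sin0 !subr0 => /andP[s0 st] ->; rewrite normrM (ger0_norm t0) expr2.
apply: ler_wpM2r => //; apply: le_trans st.
have [s2|s2] := leP s 2; last by apply: le_trans (one_cos_le2 s) (ltW s2).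
rewrite one_cosE normrM ger0_norm// ger0_norm ?sqr_ge0//.
by have := sin_sqr_le (s / 2); have := sqr_ge0 s; nra.
Qed.

End real_trig_bounds.

Section borel_Rd.
Variables (R : realType) (d : nat).

Lemma open_measurable_BRd (A : set 'rV[R]_d) : open A -> measurable (A : set (BRd R d)).
Proof. by move=> oA; apply: sub_sigma_algebra. Qed.

Lemma cont_measurable (g : 'rV[R]_d -> R) : continuous g ->
  measurable_fun setT (g : BRd R d -> R).
Proof.
move=> cg; apply: (measurability _ (RGenOInfty.measurableE R)).
move=> _ [_ [a ->] <-]; rewrite setTI; apply: open_measurable_BRd.
by apply: open_comp; [move=> x _; exact: cg|exact: interval_open].
Qed.

Lemma measurable_preim (g : 'rV[R]_d -> R) (A : set R) : continuous g ->
  measurable A -> measurable (g @^-1` A : set (BRd R d)).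
Proof.
by move=> cg mA; rewrite -[X in measurable X]setTI; exact: cont_measurable.
Qed.

Lemma measurable_punct : measurable (@punct R d).
Proof.
have -> : @punct R d = (@enorm R d) @^-1` `]0, +oo[%classic.
  apply/seteqP; split => y /=; rewrite in_itv/= andbT.
    by move=> y0; rewrite lt_neqAle enorm_ge0 andbT eq_sym; apply: contra y0 => /eqP/enorm_eq0 ->.
  by move=> y0; apply: contraTN y0 => /eqP ->; rewrite enorm0 ltxx.
by apply: measurable_preim => //; exact: continuous_enorm.
Qed.

Lemma measurable_enorm_ge (r : R) : measurable ([set y : 'rV[R]_d | (r <= enorm y)%R] : set (BRd R d)).
Proof.
have -> : [set y : 'rV[R]_d | (r <= enorm y)%R] = (@enorm R d) @^-1` `[r, +oo[%classic.
  by apply/seteqP; split => y /=; rewrite in_itv/= andbT.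
by apply: measurable_preim => //; exact: continuous_enorm.
Qed.

Lemma measurable_enorm_le (r : R) : measurable ([set y : 'rV[R]_d | (enorm y <= r)%R] : set (BRd R d)).
Proof.
have -> : [set y : 'rV[R]_d | (enorm y <= r)%R] = (@enorm R d) @^-1` `]-oo, r]%classic.
  by apply/seteqP; split => y /=; rewrite in_itv.
by apply: measurable_preim => //; exact: continuous_enorm.
Qed.

(** The integrand of the Levy condition. It vanishes at 0, and so does every function below a
    multiple of it; their integrals over [punct] can therefore be taken over the whole space. *)
Definition m2 (y : 'rV[R]_d) : R := Num.min (enorm y ^+ 2) 1.

Lemma m2_ge0 y : 0 <= m2 y.
Proof. by rewrite le_min sqr_ge0 ler01. Qed.

Lemma m20 : m2 0 = 0.
Proof. by rewrite /m2 enorm0 expr0n/= min_l. Qed.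

Lemma continuous_min (T : topologicalType) (f g : T -> R) : continuous f -> continuous g ->
  continuous (fun t => Num.min (f t) (g t)).
Proof.
move=> cf cg; under eq_fun do rewrite minr_absE.
apply: contM; last exact: cont_cst.
apply: contB; first exact: contD.
by apply: (cont_comp (contB cf cg)); exact: norm_continuous.
Qed.

Lemma continuous_m2 : continuous m2.
Proof.
apply: continuous_min; last exact: cont_cst.
by under eq_fun do rewrite expr2; apply: contM; exact: continuous_enorm.
Qed.

Lemma m2_small y : enorm y <= 1 -> m2 y = enorm y ^+ 2.
Proof. by move=> y1; rewrite /m2 min_l// -(expr1n _ 2) lerXn2r// ?nnegrE// enorm_ge0. Qed.

Lemma m2_big y : 1 <= enorm y -> m2 y = 1.
Proof. by move=> y1; rewrite /m2 min_r// -{1}(expr1n R 2) lerXn2r// ?nnegrE ?ler01// enorm_ge0. Qed.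

(** Expanding the product of the factors [1 + xi_i ^+ 2] gives 1, the sum of the squares, and
    further nonnegative terms. *)
Lemma wt_enorm (xi : 'rV[R]_d) : (1 + enorm xi ^+ 2) * wt xi <= 1.
Proof.
suff H : 1 + enorm xi ^+ 2 <= (wt xi)^-1.
  by rewrite -ler_pdivlMr ?wt_gt0// mul1r.
rewrite enorm_sqr /dotp /wt -prodfV.
elim: (index_enum 'I_d) => [|i s IH]; first by rewrite !big_nil addr0.
rewrite !big_cons /iw invrK -!expr2.
have S0 : 0 <= \sum_(j <- s) xi 0 j * xi 0 j.
  by apply: sumr_ge0 => j _; rewrite -expr2 sqr_ge0.
have x0 := sqr_ge0 (xi 0 i).
apply: le_trans (ler_wpM2l _ IH); last by rewrite addr_ge0.
by have := mulr_ge0 x0 S0; lra.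
Qed.

End borel_Rd.

Section sigma_finite_wrapper.
Context {R : realType} {dd : measure_display} {T : measurableType dd}.
Variable m : {measure set T -> \bar R}.

(* The phantom argument lets instance inference find the proof of sigma-finiteness. *)
Definition sf_wrap (_ : sigma_finite setT m) : set T -> \bar R := m.

Variable sf : sigma_finite setT m.
HB.instance Definition _ := Measure.copy (sf_wrap sf) m.
HB.instance Definition _ := Measure_isSigmaFinite.Build _ _ _ (sf_wrap sf) sf.

Definition sf_measure : {sigma_finite_measure set T -> \bar R} := sf_wrap sf.

End sigma_finite_wrapper.

Lemma Fubini_iint_sigma_finite (R : realType) {dd : measure_display} {T : measurableType dd}
    (m : {measure set T -> \bar R}) n (h : T -> 'rV[R]_n -> R) (M : T -> R) :
  sigma_finite setT m ->
  (forall v, measurable_fun setT (h^~ v)) -> (forall y, continuous (h y)) ->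
  m.-integrable setT (EFin \o M) -> (forall y v, `|h y v| <= M y * wt v) ->
  measurable_fun setT (fun y => iint (h y)) /\
  Rintegral m setT (fun y => iint (h y)) = iint (fun v => Rintegral m setT (h^~ v)).
Proof.
by move=> sf; exact: (@Fubini_iint R _ _ (sf_measure sf)).
Qed.

Lemma Rintegral_continuous (R : realType) {dd : measure_display} {T : measurableType dd}
    (m : {measure set T -> \bar R}) (D : set T) (V : pseudoMetricType R)
    (h : V -> T -> R) (M : T -> R) (x : V) :
  measurable D -> (forall v, measurable_fun D (h v)) -> m.-integrable D (EFin \o M) ->
  (\forall v \near x, forall y, D y -> `|h v y| <= M y) ->
  (forall y, D y -> h v y @[v --> x] --> h x y) ->
  Rintegral m D (h v) @[v --> x] --> Rintegral m D (h x).
Proof.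
move=> mD mh iM hM ch; apply: cvg_seq => u ux.
have [N _ HN] : \forall k \near \oo, forall y, D y -> `|h (u k) y| <= M y by exact: ux hM.
rewrite -(cvg_shiftn N); apply: (Rintegral_dct (g := M)) => //.
- move=> y Dy; apply: (@cvg_comp _ _ _ (fun k => u (k + N)%N) (h^~ y)); last exact: ch.
  by apply: (@cvg_comp _ _ _ (fun k => (k + N)%N) u); [exact: cvg_addnr|exact: ux].
- by move=> k y Dy; apply: HN => //=; exact: leq_addl.
Qed.

(** * The generator of a fixed Levy triplet *)

Section levy_measure.
Variables (R : realType) (d : nat).
Variable m : {measure set (BRd R d) -> \bar R}.
Hypothesis m0 : m [set (0 : 'rV[R]_d)] = 0%E.
Hypothesis m_levy : (\int[m]_(y in @punct R d) (Num.min (enorm y ^+ 2) 1)%:E < +oo)%E.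

Lemma integral_punct (g : 'rV[R]_d -> \bar R) : g 0 = 0%E ->
  (\int[m]_(y in @punct R d) g y = \int[m]_y g y)%E.
Proof.
move=> g0; rewrite integral_mkcond; apply: eq_integral => y _; rewrite patchE.
case: ifPn => //; rewrite notin_setE => /negP; rewrite negbK => /eqP ->.
by rewrite g0.
Qed.

Lemma Rintegral_punct (g : 'rV[R]_d -> R) : g 0 = 0 ->
  Rintegral m (@punct R d) g = Rintegral m setT g.
Proof. by move=> g0; congr fine; apply: integral_punct; rewrite g0. Qed.

Lemma integrable_m2 : m.-integrable setT (EFin \o (@m2 R d)).
Proof.
have mm : measurable_fun setT (@m2 R d : BRd R d -> R) := cont_measurable (@continuous_m2 R d).
apply/integrableP; split; first exact/measurable_EFinP.
under eq_integral do rewrite /= ger0_norm ?m2_ge0//.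
by rewrite -integral_punct// m20.
Qed.

Lemma integrable_le_m2 (g : 'rV[R]_d -> R) (K : R) : continuous g ->
  (forall y, `|g y| <= K * m2 y) -> m.-integrable setT (EFin \o g).
Proof.
move=> cg gK; apply: (@integrable_dominated _ (BRd R d) R m setT g (fun y => K * m2 y)) => //.
  exact: cont_measurable.
exact: (integrableZl measurableT K integrable_m2).
Qed.

Lemma markov_set (A : set (BRd R d)) (g : 'rV[R]_d -> R) (c : R) :
  measurable A -> measurable_fun setT (g : BRd R d -> R) -> (forall y, 0 <= g y) ->
  0 <= c -> (forall y, A y -> c <= g y) ->
  (c%:E * m A <= \int[m]_y (g y)%:E)%E.
Proof.
move=> mA mg g0 c0 cg; rewrite -integral_cst//.
apply: (@le_trans _ _ (\int[m]_(y in A) (g y)%:E)%E).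
  apply: ge0_le_integral => //.
  - by apply/measurable_EFinP; exact: measurable_funTS.
apply: ge0_subset_integral => //; first exact/measurable_EFinP.
by move=> y _; rewrite lee_fin.
Qed.

Lemma tail_finite (r : R) : 0 < r -> (m [set y : 'rV[R]_d | (r <= enorm y)%R] < +oo)%E.
Proof.
move=> r0; have c0 : 0 < Num.min (r ^+ 2) 1 by rewrite lt_min ltr01 exprn_gt0.
have H : ((Num.min (r ^+ 2) 1)%:E * m [set y : 'rV[R]_d | (r <= enorm y)%R] < +oo)%E.
  apply: le_lt_trans (integrable_lty measurableT integrable_m2).
  apply: markov_set => //.
  - exact: measurable_enorm_ge.
  - by apply: cont_measurable; exact: continuous_m2.
  - by move=> y; exact: m2_ge0.
  - exact: ltW.
  - move=> y /= ry; rewrite /m2 le_min !ge_min lexx orbT andbT.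
    by rewrite lerXn2r ?nnegrE ?enorm_ge0 ?(ltW r0).
rewrite ltey; apply/eqP => E; move: H; rewrite E gt0_muley ?lte_fin//.
Qed.

(** Needed for Fubini. The mass may be infinite near the origin, but it is finite outside every ball
    around 0, and 0 itself is a null set by [m0]. *)
Lemma levy_sigma_finite : sigma_finite setT m.
Proof.
exists (fun k : nat => [set (0 : 'rV[R]_d)] `|` [set y : 'rV[R]_d | (k.+1%:R^-1 <= enorm y)%R]).
  apply/seteqP; split => // y _; have [y0|y0] := eqVneq y 0.
    by exists 0%N => //; left.
  have e0 : 0 < enorm y.
    by rewrite lt_neqAle enorm_ge0 andbT eq_sym; apply: contra y0 => /eqP/enorm_eq0 ->.
  have [k _ /(_ k (leqnn k)) /= ke] := near_infty_natSinv_lt (PosNum e0).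
  by exists k => //; right => /=; exact: ltW.
have m1 : measurable ([set 0] : set (BRd R d)).
  have -> : [set (0 : 'rV[R]_d)] = ~` (@punct R d).
    apply/seteqP; split => y /=; first by move=> ->; rewrite /punct /= eqxx.
    by rewrite /punct /= => /negP; rewrite negbK => /eqP.
  by apply: measurableC; exact: measurable_punct.
move=> k; split.
  by apply: measurableU => //; exact: measurable_enorm_ge.
apply: (@le_lt_trans _ _ (m [set (0%R : 'rV[R]_d)] + m [set y : 'rV[R]_d | (k.+1%:R^-1 <= enorm y)%R])%E).
  by apply: measureU2 => //; exact: measurable_enorm_ge.
by rewrite m0 add0e; apply: tail_finite; rewrite invr_gt0.
Qed.

Variable chi : 'rV[R]_d -> R.
Hypothesis Cchi : Cc_inf chi.
Hypothesis chi_bounds : forall y : 'rV[R]_d,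
  (if enorm y < 1 then 1 else 0) <= chi y <= (if enorm y < 2 then 1 else 0).

Lemma chi_ge0 y : 0 <= chi y.
Proof. by have /andP[+ _] := chi_bounds y; apply: le_trans; case: ifP. Qed.

Lemma chi_le1 y : chi y <= 1.
Proof. by have /andP[_ +] := chi_bounds y; move/le_trans; apply; case: ifP. Qed.

Lemma chi_in y : enorm y < 1 -> chi y = 1.
Proof.
move=> y1; apply/eqP; rewrite eq_le chi_le1/=.
by have /andP[+ _] := chi_bounds y; rewrite y1.
Qed.

Lemma chi_out y : 2 <= enorm y -> chi y = 0.
Proof.
move=> y2; apply/eqP; rewrite eq_le chi_ge0 andbT.
by have /andP[_] := chi_bounds y; rewrite ltNge y2.
Qed.

Lemma chi_at0 : chi 0 = 1.
Proof. by apply: chi_in; rewrite enorm0. Qed.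

Lemma continuous_chi : continuous chi.
Proof. by have [/smooth_cont] := Cchi. Qed.

(** [cosint] and [sinint] are the real and imaginary parts of the Levy-Khintchine integrand. *)
Definition cosint (xi y : 'rV[R]_d) : R := 1 - cos (dotp y xi).
Definition sinint (xi y : 'rV[R]_d) : R := dotp y xi * chi y - sin (dotp y xi).

Lemma cosint0 xi : cosint xi 0 = 0.
Proof. by rewrite /cosint dotp0l cos0 subrr. Qed.

Lemma sinint0 xi : sinint xi 0 = 0.
Proof. by rewrite /sinint dotp0l sin0 mul0r subrr. Qed.

Lemma dotp_sqr_le (xi y : 'rV[R]_d) : dotp y xi ^+ 2 <= enorm y ^+ 2 * enorm xi ^+ 2.
Proof.
rewrite -exprMn -real_normK ?num_real// lerXn2r ?nnegrE ?mulr_ge0 ?enorm_ge0//.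
exact: cauchy_schwarz.
Qed.

Lemma cosint_bound xi y : `|cosint xi y| <= 2 * (1 + enorm xi ^+ 2) * m2 y.
Proof.
have e0 := sqr_ge0 (enorm xi); have [y1|/ltW y1] := leP (enorm y) 1.
  rewrite m2_small//; apply: le_trans (one_cos_le _) _.
  apply: le_trans (dotp_sqr_le _ _) _; have := sqr_ge0 (enorm y); nra.
by rewrite m2_big// mulr1; apply: le_trans (one_cos_le2 _) _; lra.
Qed.

(** Where [chi] is 1 the compensator removes the first-order term of the sine and a quadratic
    remainder is left. Elsewhere [m2] is 1, and the compensator is at most [2 * enorm xi] because
    [chi] vanishes from radius 2 on. *)
Lemma sinint_bound xi y : `|sinint xi y| <= 2 * (1 + enorm xi ^+ 2) * m2 y.
Proof.
have e0 := sqr_ge0 (enorm xi); have [y1|y1] := ltP (enorm y) 1.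
  rewrite m2_small ?(ltW y1)// /sinint chi_in// mulr1; apply: le_trans (sin_sub_le _) _.
  apply: le_trans (dotp_sqr_le _ _) _; have := sqr_ge0 (enorm y); nra.
rewrite m2_big// mulr1; apply: le_trans (ler_normB _ _) _.
have S : `|sin (dotp y xi)| <= 1 by exact: sin_max.
have T : `|dotp y xi * chi y| <= 2 * enorm xi.
  have [y2|y2] := leP 2 (enorm y).
    by rewrite chi_out// mulr0 normr0 mulr_ge0 ?enorm_ge0.
  rewrite normrM (ger0_norm (chi_ge0 y)); apply: (@le_trans _ _ `|dotp y xi|).
    by rewrite ler_piMr// chi_le1.
  apply: le_trans (cauchy_schwarz _ _) _; apply: ler_wpM2r; [exact: enorm_ge0|exact: ltW].
by have := sqr_ge0 (enorm xi - 1); rewrite sqrrB1; lra.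
Qed.

Lemma continuous_cosint xi : continuous (cosint xi).
Proof.
apply: contB; first exact: cont_cst.
by apply: cont_comp; [exact: continuous_dotpl|exact: continuous_cos].
Qed.

Lemma continuous_sinint xi : continuous (sinint xi).
Proof.
apply: contB; first by apply: contM; [exact: continuous_dotpl|exact: continuous_chi].
by apply: cont_comp; [exact: continuous_dotpl|exact: continuous_sin].
Qed.

Lemma continuous_cosint_xi y : continuous (cosint^~ y).
Proof.
apply: contB; first exact: cont_cst.
by apply: cont_comp; [exact: continuous_dotpr|exact: continuous_cos].
Qed.

Lemma continuous_sinint_xi y : continuous (sinint^~ y).
Proof.
apply: contB; first by apply: contM; [exact: continuous_dotpr|exact: cont_cst].
by apply: cont_comp; [exact: continuous_dotpr|exact: continuous_sin].
Qed.

Lemma integrable_cosint xi : m.-integrable setT (EFin \o cosint xi).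
Proof.
apply: integrable_le_m2 (cosint_bound xi); exact: continuous_cosint.
Qed.

Lemma integrable_sinint xi : m.-integrable setT (EFin \o sinint xi).
Proof.
apply: integrable_le_m2 (sinint_bound xi); exact: continuous_sinint.
Qed.

Lemma continuous_Rintegral_xi (h : 'rV[R]_d -> 'rV[R]_d -> R) :
  (forall xi, continuous (h xi)) -> (forall y, continuous (h^~ y)) ->
  (forall xi y, `|h xi y| <= 2 * (1 + enorm xi ^+ 2) * m2 y) ->
  continuous (fun xi => Rintegral m setT (h xi)).
Proof.
move=> c1 c2 hb xi.
apply: (@Rintegral_continuous R _ (BRd R d) m setT 'rV[R]_d h (fun y => 2 * (1 + (enorm xi + 1) ^+ 2) * m2 y) xi) => //.
- by move=> v; exact: cont_measurable.
- exact: (integrableZl measurableT _ integrable_m2).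
- have N : \forall v \near xi, enorm v < enorm xi + 1.
    by apply: (cvgr_lt _ (@continuous_enorm R d xi)); rewrite ltrDl.
  apply: filterS N => v ve y _; apply: le_trans (hb v y) _.
  apply: ler_wpM2r; first exact: m2_ge0.
  rewrite ler_wpM2l// lerD2l lerXn2r ?nnegrE ?enorm_ge0 ?addr_ge0 ?enorm_ge0//.
  exact: ltW.
- by move=> y _; exact: c2.
Qed.

Lemma cosT_shift (f : 'rV[R]_d -> R) x y xi C : dom C f ->
  cosT f (x + y) xi = cos (dotp y xi) * cosT f x xi - sin (dotp y xi) * sinT f x xi.
Proof.
move=> df; rewrite -(iintZ _ (dom_cosT x xi df)) -(iintZ _ (dom_sinT x xi df)).
rewrite -(iintB (domZ _ (dom_cosT x xi df)) (domZ _ (dom_sinT x xi df))).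
congr iint; apply/funext => a.
by rewrite (_ : x + y - a = y + (x - a)) ?dotpDl ?cosD; [ring|rewrite addrAC addrC].
Qed.

Lemma sinT_shift (f : 'rV[R]_d -> R) x y xi C : dom C f ->
  sinT f (x + y) xi = sin (dotp y xi) * cosT f x xi + cos (dotp y xi) * sinT f x xi.
Proof.
move=> df; rewrite -(iintZ _ (dom_cosT x xi df)) -(iintZ _ (dom_sinT x xi df)).
rewrite -(iintD (domZ _ (dom_cosT x xi df)) (domZ _ (dom_sinT x xi df))).
congr iint; apply/funext => a.
by rewrite (_ : x + y - a = y + (x - a)) ?dotpDl ?sinD; [ring|rewrite addrAC addrC].
Qed.

Variable bv : 'rV[R]_d.

Definition psiR xi : R := Rintegral m (@punct R d) (cosint xi).
Definition psiI xi : R := - dotp bv xi + Rintegral m (@punct R d) (sinint xi).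

Lemma continuous_psiR : continuous psiR.
Proof.
rewrite /psiR; under eq_fun do rewrite Rintegral_punct ?cosint0//.
apply: continuous_Rintegral_xi; [exact: continuous_cosint|exact: continuous_cosint_xi|exact: cosint_bound].
Qed.

Lemma continuous_psiI : continuous psiI.
Proof.
rewrite /psiI; apply: contD; first by apply: contN; exact: continuous_dotpr.
under eq_fun do rewrite Rintegral_punct ?sinint0//.
apply: continuous_Rintegral_xi; [exact: continuous_sinint|exact: continuous_sinint_xi|exact: sinint_bound].
Qed.

(** The directional derivative ['D_y f x] stands for the product of [y] with the gradient of [f]. *)
Definition jump f (x y : 'rV[R]_d) : R := f (x + y) - f x - chi y * 'D_y f x.

Definition levy_op f x : R := 'D_bv f x + Rintegral m (@punct R d) (jump f x).

Section formula.
Variables (f : 'rV[R]_d -> R) (x : 'rV[R]_d).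
Hypothesis Cf : Cc_inf f.

(** The real part of the Levy-Khintchine integrand times the phase-shifted transform of [f].
    Integrating first in [y] produces the symbol, first in [xi] the jump part of the generator. *)
Let h (y xi : 'rV[R]_d) : R := cosint xi y * cosT f x xi - sinint xi y * sinT f x xi.

(** The factors [cos (dotp y xi)] and [sin (dotp y xi)] move the base point from [x] to [x + y], and
    [dotp y xi] becomes a derivative along [y]; inversion then applies to each of the three
    terms. *)
Let h_jump y : iint (h y) = - inv_cst chi * jump f x y.
Proof.
have [C df] := Cc_dom Cf; have [C1 H1] := trig_dom Cf.
have [C2 H2] := trig_dom (Cc_inf_derive y Cf).
have E : h y = (fun xi => (cosT f x xi - cosT f (x + y) xi) + chi y * cosT ('D_y f) x xi).
  apply/funext => xi; rewrite /h /cosint /sinint (cosT_shift _ _ _ df).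
  have := sinT_parts x y xi Cf => P.
  have -> : cosT ('D_y f) x xi = - (dotp y xi * sinT f x xi) by rewrite P opprK.
  by ring.
have dB : dom (C1 + `|-1| * C1) (fun xi => cosT f x xi - cosT f (x + y) xi).
  have := domD (H1 x).1 (domZ (-1) (H1 (x + y)).1).
  by under eq_fun do rewrite mulN1r.
rewrite E (iintD dB (domZ (chi y) (H2 x).1)) (iintB (H1 x).1 (H1 (x + y)).1).
rewrite (iintZ _ (H2 x).1) !(inversion Cchi chi_at0)//; last exact: Cc_inf_derive.
by rewrite /jump; ring.
Qed.

Let h_bound : exists2 K, 0 <= K & forall y xi, `|h y xi| <= K * m2 y * wt xi.
Proof.
have [C C0 H] := trig_decay Cf; exists (4 * C); first by rewrite mulr_ge0.
move=> y xi; have [HU HV] := H x xi.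
have := cosint_bound xi y; have := sinint_bound xi y => B1 B2.
apply: le_trans (ler_normB _ _) _; rewrite !normrM.
have W := wt_enorm xi; have W0 := wt_gt0 xi; have M0 := m2_ge0 y.
have E0 : 0 <= 1 + enorm xi ^+ 2 by rewrite addr_ge0// sqr_ge0.
apply: (@le_trans _ _ (2 * (2 * (1 + enorm xi ^+ 2) * m2 y * (C * wt xi ^+ 2)))).
  rewrite mulrDl mul1r [X in _ <= X](_ : _ = 2 * (1 + enorm xi ^+ 2) * m2 y * (C * wt xi ^+ 2) + 2 * (1 + enorm xi ^+ 2) * m2 y * (C * wt xi ^+ 2)); last by ring.
  by apply: lerD; apply: ler_pM.
rewrite [leLHS](_ : _ = (4 * C * m2 y * wt xi) * ((1 + enorm xi ^+ 2) * wt xi)); last by ring.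
by rewrite ler_piMr// !mulr_ge0// ltW.
Qed.

Lemma levy_formula :
  [/\ m.-integrable setT (EFin \o jump f x),
  exists C, dom C (fun xi => psiR xi * cosT f x xi - psiI xi * sinT f x xi) &
  iint (fun xi => psiR xi * cosT f x xi - psiI xi * sinT f x xi) = - inv_cst chi * levy_op f x].
Proof.
have [K K0 hK] := h_bound; have [C df] := Cc_dom Cf.
have c0 := inv_cst_gt0 Cchi chi_at0 chi_ge0.
have cU := continuous_cosT (x := x) df; have cV := continuous_sinT (x := x) df.
have chy y : continuous (h y).
  by apply: contB; apply: contM => //; [exact: continuous_cosint_xi|exact: continuous_sinint_xi].
have chx xi : continuous (h^~ xi).
  by apply: contB; apply: contM; (try exact: cont_cst); [exact: continuous_cosint|exact: continuous_sinint].
have iM : m.-integrable setT (EFin \o (fun y => K * m2 y)) := integrableZl measurableT K integrable_m2.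
have [mI FI] := Fubini_iint_sigma_finite levy_sigma_finite (fun xi => cont_measurable (chx xi)) chy iM hK.
have dh y : dom (K * m2 y) (h y) by split.
(* As [inv_cst chi] is not 0, [jump] is a multiple of [iint (h y)] and inherits its measurability
   and its [m2] bound; no Taylor expansion of [f] is involved. *)
have ij : m.-integrable setT (EFin \o jump f x).
  have -> : jump f x = (fun y => - (inv_cst chi)^-1 * iint (h y)).
    by apply/funext => y; rewrite h_jump; field; rewrite lt0r_neq0.
  have i1 : m.-integrable setT (EFin \o (fun y => iint (h y))).
    apply: (@integrable_dominated _ (BRd R d) R m setT _ (fun y => K * iwint R ^+ d * m2 y)) => //.
      by move=> y _; rewrite mulrAC; exact: iint_bound.
    exact: (integrableZl measurableT _ integrable_m2).
  exact: (integrableZl measurableT _ i1).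
have [C3 H3] := trig_dom (Cc_inf_derive bv Cf).
have E xi : psiR xi * cosT f x xi - psiI xi * sinT f x xi =
    Rintegral m setT (h^~ xi) - cosT ('D_bv f) x xi.
  rewrite RintegralB//; last 2 first.
  - exact: (integrableZr measurableT _ (integrable_cosint xi)).
  - exact: (integrableZr measurableT _ (integrable_sinint xi)).
  rewrite !RintegralZr//; [|exact: integrable_sinint|exact: integrable_cosint].
  rewrite /psiR /psiI !Rintegral_punct ?cosint0 ?sinint0//.
  have -> : cosT ('D_bv f) x xi = - (dotp bv xi * sinT f x xi) by rewrite (sinT_parts _ _ _ Cf) opprK.
  by ring.
(* Continuity in [xi] is read off from [E], whose remaining terms are continuous; the weight bound
   comes from integrating [hK] in [y]. *)
have dH : dom (Rintegral m setT (fun y => K * m2 y)) (fun xi => Rintegral m setT (h^~ xi)).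
  split.
    have -> : (fun xi => Rintegral m setT (h^~ xi)) = (fun xi => psiR xi * cosT f x xi - psiI xi * sinT f x xi + cosT ('D_bv f) x xi).
      by apply/funext => xi; rewrite E subrK.
    apply: contD; last exact: (H3 x).1.1.
    by apply: contB; apply: contM => //; [exact: continuous_psiR|exact: continuous_psiI].
  move=> xi; rewrite -RintegralZr//.
  apply: Rintegral_bound => //; first exact: cont_measurable.
  exact: (integrableZr measurableT _ iM).
split => //.
  have := domD dH (domZ (-1) (H3 x).1); set C4 := (X in dom X _) => D4; exists C4.
  by move: D4; under eq_fun do rewrite mulN1r -E.
under eq_fun do rewrite E.
rewrite (iintB dH (H3 x).1) -FI (inversion Cchi chi_at0 _ (Cc_inf_derive bv Cf)).
rewrite (_ : (fun y => iint (h y)) = (fun y => - inv_cst chi * jump f x y)); last exact/funext.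
rewrite RintegralZl// /levy_op Rintegral_punct; first by ring.
by rewrite /jump addr0 derive0 mulr0 !subrr.
Qed.

End formula.

End levy_measure.

Lemma integrand_complex (R : realType) (t p r u v c : R) :
  expi t * Complex p r * (rC c * Complex u v) =
  Complex (c * (p * (cos t * u - sin t * v) - r * (sin t * u + cos t * v)))
          (c * (p * (sin t * u + cos t * v) + r * (cos t * u - sin t * v))).
Proof. by rewrite /expi /rC; simpc; congr Complex; ring. Qed.

Lemma Re_le_cmod (R : realType) (z : R[i]) : `|complex.Re z| <= cmod z.
Proof.
rewrite -sqrtr_sqr ler_wsqrtr// lerDl sqr_ge0//.
Qed.

Lemma Im_le_cmod (R : realType) (z : R[i]) : `|complex.Im z| <= cmod z.
Proof.
rewrite -sqrtr_sqr ler_wsqrtr// lerDr sqr_ge0//.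
Qed.

Lemma cmod_le (R : realType) (a c : R) : cmod (Complex a c) <= `|a| + `|c|.
Proof.
rewrite -(ler_pXn2r (n := 2))// ?nnegrE ?sqrtr_ge0 ?addr_ge0//.
rewrite sqr_sqrtr ?addr_ge0 ?sqr_ge0//= sqrrD !real_normK ?num_real//.
by rewrite -addrA lerD2l lerDr mulrn_wge0// mulr_ge0.
Qed.

(** * Approximation and mollification *)

Section tools_iii.
Variables (R : realType) (d : nat).

Lemma Rintegral_split_bound (m : {measure set (BRd R d) -> \bar R})
    (A g : 'rV[R]_d -> R) (D : set (BRd R d)) (c e1 e2 : R) :
  m.-integrable setT (EFin \o A) -> measurable_fun setT (g : BRd R d -> R) ->
  (forall y, 0 <= g y) -> measurable D -> 0 <= c ->
  (forall y, `|A y| <= g y + c * \1_D y) ->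
  (\int[m]_y (g y)%:E <= e1%:E)%E -> (m D <= e2%:E)%E ->
  `|Rintegral m setT A| <= e1 + c * e2.
Proof.
move=> iA mg g0 mD c0 Ag H1 H2.
have mi : measurable_fun setT (fun y : BRd R d => c * \1_D y).
  by apply: measurable_funM => //; exact: measurable_indic.
have i0 y : 0 <= c * \1_D y by rewrite mulr_ge0// indicE.
have H : (\int[m]_y `|A y|%:E <= (e1 + c * e2)%:E)%E.
  apply: (@le_trans _ _ (\int[m]_y ((g y)%:E + (c * \1_D y)%:E))%E).
    apply: ge0_le_integral => //.
    - by apply/measurable_EFinP; apply: measurableT_comp => //; apply/measurable_EFinP; exact: measurable_int iA.
    - by apply/measurable_EFinP; exact: measurable_funD.
    - by move=> y _; rewrite -EFinD lee_fin.
  rewrite ge0_integralD//; last 4 first.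
  - by move=> y _; rewrite lee_fin.
  - exact/measurable_EFinP.
  - by move=> y _; rewrite lee_fin.
  - exact/measurable_EFinP.
  rewrite EFinD leeD//.
  under eq_integral do rewrite EFinM.
  rewrite ge0_integralZl//; last by apply/measurable_EFinP; exact: measurable_indic.
  by rewrite integral_indic// setIT EFinM lee_wpmul2l.
apply: le_trans (le_normr_Rintegral measurableT iA) _.
rewrite -lee_fin; apply: le_trans H; rewrite fineK//.
by apply: integrable_fin_num => //; exact: (integrable_norm iA).
Qed.

Lemma compact_cont_bounded (F : 'rV[R]_d -> R) (K : set 'rV[R]_d) :
  continuous F -> compact K -> exists2 B : R, 0 <= B & forall x, K x -> `|F x| <= B.
Proof.
move=> cF cK; have [K0|K0] := pselect (K !=set0); last first.
  by exists 0 => // x Kx; exfalso; apply: K0; exists x.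
have cn : {within K, continuous (fun a => `|F a|)}.
  by apply: continuous_subspaceT; exact: (cont_comp cF (@norm_continuous _ R)).
have [a _ aM] := EVT_max_rV K0 cK cn.
by exists `|F a| => // x Kx; apply: aM; rewrite inE.
Qed.

(** The approximating function may depend on the point and on [e], and has to be close only near
    that point. This is how continuity passes from truncated integrands, or from the generator of
    suitable test functions, to the characteristics. *)
Lemma cont_unif_approx (T : topologicalType) (F : T -> R) :
  (forall (x : T) (e : R), 0 < e -> exists2 G : T -> R, continuous G &
    \forall z \near x, `|F z - G z| <= e) -> continuous F.
Proof.
move=> H x; apply/cvgrPdist_le => e e0.
have e3 : 0 < e / 3 by rewrite divr_gt0.
have [G cG N] := H x (e / 3) e3.
have Nx := nbhs_singleton N.
have /cvgrPdist_le/(_ _ e3) N2 := cG x.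
apply: filterS2 N N2 => z z1 z2.
rewrite (_ : F x - F z = (F x - G x) + (G x - G z) + (G z - F z)); last by ring.
apply: le_trans (ler_normD _ _) _; rewrite [leRHS](_ : e = e / 3 + e / 3 + e / 3); last by lra.
apply: lerD; last by rewrite distrC.
by apply: le_trans (ler_normD _ _) _; apply: lerD.
Qed.

Lemma cont_rV (T : topologicalType) (F : T -> 'rV[R]_d) :
  (forall j, continuous (fun x => F x 0 j)) -> continuous F.
Proof.
move=> cF x; apply/cvgrPdist_le => e e0.
pose S z := \sum_(j < d) `|F x 0 j - F z 0 j|.
have cS : continuous S.
  apply: cont_sum => j; apply: (cont_comp _ (@norm_continuous _ R)).
  by apply: contB; [exact: cont_cst|exact: cF].
have /cvgrPdist_le/(_ e e0) := cS x; apply: filterS => z.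
rewrite {1}/S big1 => [|j _]; last by rewrite subrr normr0.
rewrite sub0r normrN => /(le_trans (ler_norm _)) H; apply: norm_le_coord; first exact: ltW.
move=> j; apply: le_trans H; rewrite rvB /S (bigD1 j)//= lerDl.
by apply: sumr_ge0.
Qed.

(** The budget for two errors of equal size integrated over a set of mass at most [C]; [C + 1] keeps
    the denominator positive when [C] is 0. *)
Lemma half_share (e C : R) : 0 < e -> 0 <= C -> 2 * (e / (2 * (C + 1))) * C <= e.
Proof.
move=> e0 C0; have C1 : 0 < C + 1 by rewrite ltr_wpDl.
rewrite (_ : 2 * _ * C = e * (C / (C + 1))); last by field; lra.
by rewrite ger_pMr// ler_pdivrMr// mul1r lerDl.
Qed.

Lemma nbhs_cball1 (x : 'rV[R]_d) (P : 'rV[R]_d -> Prop) :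
  (forall z, `|x - z| <= 1 -> P z) -> \forall z \near x, P z.
Proof.
move=> H; apply/nbhs_ballP; exists 1 => //= z; rewrite -ball_normE /= => /ltW.
exact: H.
Qed.

Lemma open_enorm_lt (r : R) : open [set y : 'rV[R]_d | (enorm y < r)%R].
Proof.
have -> : [set y : 'rV[R]_d | (enorm y < r)%R] = (@enorm R d) @^-1` [set t | t < r] by [].
by apply: open_comp; [move=> x _; exact: continuous_enorm|exact: open_lt].
Qed.

Lemma not_supp0P (g : 'rV[R]_d -> R) : ~ supp g 0 <->
  exists2 s : R, 0 < s & forall y, enorm y < s -> g y = 0.
Proof.
split => [H|[s s0 H] /(_ [set y | enorm y < s])].
  have : (~` supp g) 0 by [].
  have oS : open (~` supp g) by apply: closed_openC; exact: closed_closure.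
  rewrite openE in oS; move/oS => /nbhs_ballP[e /= e0 He].
  exists e => // y ye; apply/eqP/negP => gy.
  have : ball (0 : 'rV[R]_d) e y.
    by rewrite -ball_normE /= sub0r normrN (le_lt_trans (norm_le_enorm y)).
  by move/He; apply; apply: subset_closure => /=; exact/negP.
case; first by apply: open_nbhs_nbhs; split; [exact: open_enorm_lt|rewrite /= enorm0].
by move=> y [/= /negP gy /H /eqP].
Qed.

(** A one-sided comparison: [A] may be negative, but only on [D] and by at most [c], so an upper
    bound on its integral still controls the nonnegative [g]. *)
Lemma ge0_integral_split_le (m : {measure set (BRd R d) -> \bar R})
    (A g : 'rV[R]_d -> R) (D : set (BRd R d)) (c e1 e2 : R) :
  m.-integrable setT (EFin \o A) -> measurable_fun setT (g : BRd R d -> R) ->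
  (forall y, 0 <= g y) -> measurable D -> 0 <= c ->
  (forall y, g y <= A y + c * \1_D y) ->
  Rintegral m setT A <= e1 -> (m D <= e2%:E)%E ->
  (\int[m]_y (g y)%:E <= (e1 + c * e2)%:E)%E.
Proof.
move=> iA mg g0 mD c0 gA H1 H2.
have mI : measurable_fun setT (fun y : BRd R d => (\1_D y)%:E : \bar R).
  by apply/measurable_EFinP; exact: measurable_indic.
have iI : m.-integrable setT (fun y => (\1_D y)%:E).
  apply/integrableP; split => //.
  under eq_integral do rewrite /= ger0_norm ?indicE//.
  under eq_integral do rewrite -indicE.
  by rewrite integral_indic// setIT (le_lt_trans H2)// ltry.
have icI := integrableZl measurableT c iI.
apply: (@le_trans _ _ (\int[m]_y ((A y)%:E + c%:E * (\1_D y)%:E))%E).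
  apply: ge0_le_integral => //.
  - by move=> y _; rewrite lee_fin.
  - exact/measurable_EFinP.
  - exact: measurable_int (integrableD measurableT iA icI).
  - by move=> y _; rewrite -EFinM -EFinD lee_fin.
rewrite integralD// EFinD leeD//.
  by rewrite -[X in (X <= _)%E]fineK ?lee_fin//; exact: integrable_fin_num iA.
by rewrite integralZl// integral_indic// setIT EFinM lee_wpmul2l.
Qed.

Lemma smooth_sum m (f : 'I_m -> 'rV[R]_d -> R) :
  (forall i, smooth (f i)) -> smooth (fun y => \sum_(i < m) f i y).
Proof.
elim: m f => [|m IH] f sf.
  by under eq_fun do rewrite big_ord0; exact: smooth_cst.
under eq_fun do rewrite big_ord_recr/=.
by apply: smoothD => //; apply: IH.
Qed.

Lemma smooth_dotp : smooth (fun y : 'rV[R]_d => dotp y y).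
Proof. by apply: smooth_sum => i; apply: smoothM; exact: smooth_coord. Qed.

Lemma is_derive_dotp (x v : 'rV[R]_d) : is_derive x v (fun y : 'rV[R]_d => dotp y y) (2 * dotp x v).
Proof.
apply: is_derive_line.
rewrite (_ : (fun _ => _) = (fun s : R => s * (s * dotp v v) + s * (2 * dotp x v) + dotp x x)).
  by apply: is_derive_eq; rewrite /GRing.scale/=; ring.
apply/funext => s; rewrite dotpDl !dotpDr !dotpZl !dotpZr (dotpC v x); ring.
Qed.

End tools_iii.

(** * Uniform continuity and mollification *)

Section mollification.
Variables (R : realType) (d : nat).
Implicit Types f g phi : 'rV[R]_d -> R.

Lemma cont_near (T : topologicalType) (F : T -> R) (x : T) (e : R) : continuous F -> 0 < e ->
  \forall z \near x, `|F x - F z| <= e.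
Proof. by move=> cF e0; have /cvgrPdist_le/(_ _ e0) := cF x. Qed.

Lemma near_enorm (x : 'rV[R]_d) (del : R) : 0 < del -> \forall z \near x, enorm (z - x) < del.
Proof.
(* The Euclidean norm is at most [d] times the sup norm; [d.+1] also covers dimension 0. *)
move=> d0; apply/nbhs_ballP; exists (del / d.+1%:R) => /=; first by rewrite divr_gt0.
move=> z; rewrite -ball_normE /= distrC ltr_pdivlMr// => H.
apply: le_lt_trans (enorm_le_norm _) _; apply: le_lt_trans H.
by rewrite mulrC ler_wpM2l// ler_nat.
Qed.

Lemma bsupp_unif_cont f : continuous f -> bsupp f -> forall e : R, 0 < e ->
  exists2 del : R, 0 < del & forall x y, enorm (x - y) < del -> `|f x - f y| <= e.
Proof.
move=> cf [M fM] e e0.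
have e2 : 0 < e / 2 by rewrite divr_gt0.
have NC := (compact_near_coveringP _).1 (@compact_cball R d 0 M).
pose P (t : R) x := forall y, enorm (x - y) < t -> `|f x - f y| <= e.
have HP x : [set v : 'rV[R]_d | `|0 - v| <= M] x -> \forall x' \near x & t \near 0^'+, P t x'.
  move=> _; have /nbhs_ballP[r /= r0 Hr] := cont_near x cf e2.
  have B y : enorm (y - x) < r -> `|f x - f y| <= e / 2.
    move=> yx; apply: Hr; rewrite -ball_normE /= distrC.
    exact: le_lt_trans (norm_le_enorm _) yx.
  have r2 : 0 < r / 2 by rewrite divr_gt0.
  (* Half of [r] for each: then both [z] and any [y] within [t] of [z] lie within [r] of [x]. *)
  exists ([set z | enorm (z - x) < r / 2], [set t | t < r / 2]) => /=.
    by split; [exact: near_enorm|exact: nbhs_right_lt].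
  move=> [z t] [/= zx tr] y zy.
  rewrite (_ : f z - f y = (f x - f y) - (f x - f z)); last by ring.
  apply: le_trans (ler_normB _ _) _; rewrite [leRHS](splitr e); apply: lerD; apply: B; last by lra.
  rewrite (_ : y - x = (z - x) - (z - y)); last by rewrite opprB [RHS]addrC addrA subrK.
  by apply: le_lt_trans (enormB _ _) _; lra.
have [del /= d0 Hd] := NC R _ P _ HP.
have {}Hd x y : `|x| <= M -> enorm (x - y) < del / 2 -> `|f x - f y| <= e.
  move=> xM xy; apply: (Hd (del / 2)) => //=; last by rewrite sub0r normrN.
    by rewrite sub0r normrN gtr0_norm ?divr_gt0// ltr_pdivrMr// ltr_pMr// ltr1n.
  by rewrite divr_gt0.
exists (del / 2); first by rewrite divr_gt0.
move=> x y xy; have [xM|/ltW xM] := leP `|x| M; first exact: Hd.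
have [yM|/ltW yM] := leP `|y| M.
  by rewrite distrC; apply: Hd => //; rewrite -enormN opprB.
by rewrite !fM// subrr normr0 ltW.
Qed.

(** The variable [y] occurs in [phi] only, so derivatives fall on [phi] and [f] need not be
    differentiable. Writing [a - y] as [-1 *: y + a] fits the lemmas on affine substitutions. *)
Definition conv f phi (y : 'rV[R]_d) : R := iint (fun a => f a * phi (-1 *: y + a)).

Lemma dom_mul_bounded C (B : R) f (c : 'rV[R]_d -> R) : continuous c ->
  (forall a, `|c a| <= B) -> dom C f -> dom (C * B) (fun a => f a * c a).
Proof.
move=> cc cB [cf fC]; split => [|a]; first exact: contM.
by rewrite normrM mulrAC; apply: ler_pM.
Qed.

Lemma continuous_translate (x : 'rV[R]_d) : continuous (fun a : 'rV[R]_d => x + a).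
Proof.
by apply: (@cont_lip _ _ _ _ 1) => u v; rewrite mul1r opprD addrACA subrr add0r.
Qed.

Lemma dom_conv C f phi B y : continuous phi -> (forall a, `|phi a| <= B) -> dom C f ->
  dom (C * B) (fun a => f a * phi (-1 *: y + a)).
Proof.
move=> cp pB df; apply: dom_mul_bounded => //.
exact: (cont_comp (@continuous_translate _) cp).
Qed.

(** Filling in the limit at 0 turns a difference quotient into a function to which continuity of
    parametric integrals applies. *)
Lemma cvg_dnbhs0 (g : R -> R) (l : R) : g h @[h --> 0^'] --> l ->
  (if h == 0 then l else g h) @[h --> 0] --> l.
Proof.
move=> /cvgrPdist_lt H; apply/cvgrPdist_lt => e e0; have := H e e0.
rewrite near_withinE; apply: filterS => h Hh.
by case: eqVneq => [_|/Hh//]; rewrite subrr normr0.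
Qed.

Lemma is_derive_conv C f phi y v : dom C f -> Cc_inf phi ->
  is_derive y v (conv f phi) (conv f ('D_(-1 *: v) phi) y).
Proof.
move=> df Cp; have /Cc_infP[sp bp] := Cp.
have /Cc_infP[sD bD] := Cc_inf_derive (-1 *: v) Cp.
have [B B0 DB] := cont_bsupp_bounded (smooth_cont sD) bD.
have [B1 B10 pB] := cont_bsupp_bounded (smooth_cont sp) bp.
pose G a y := phi (-1 *: y + a).
have dG a x : derivable (G a) x v by apply: derivable_affine; exact: smooth_derivable.
have DG a x : 'D_v (G a) x = 'D_(-1 *: v) phi (-1 *: x + a) by exact: derive_affine.
have cGa x : continuous (fun a => G a x) by exact: (cont_comp (@continuous_translate _) (smooth_cont sp)).
pose Q (h : R) a := f a * (if h == 0 then 'D_(-1 *: v) phi (-1 *: y + a) else h^-1 * (G a (h *: v + y) - G a y)).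
have MV a h : h != 0 -> `|h^-1 * (G a (h *: v + y) - G a y)| <= B.
  have DBa x : `|'D_v (G a) x| <= B by rewrite DG.
  move=> h0; rewrite normrM normfV mulrC ler_pdivrMr ?normr_gt0//.
  have [hp|hn|/eqP] := ltgtP 0 h; last by rewrite eq_sym (negbTE h0).
    by rewrite (gtr0_norm hp); exact: (@mean_value_line R _ (G a) B v y h (dG a) DBa hp).
  rewrite (ltr0_norm hn) distrC.
  have := @mean_value_line R _ (G a) B v (h *: v + y) (- h) (dG a) DBa.
  by rewrite scaleNr addKr oppr_gt0; exact.
have dQ h : dom (C * B) (Q h).
  have [->|h0] := eqVneq h 0.
    rewrite /Q eqxx; apply: dom_mul_bounded => //.
    exact: (cont_comp (@continuous_translate _) (smooth_cont sD)).
  rewrite /Q (negbTE h0); apply: dom_mul_bounded => //; last by move=> a; exact: MV.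
  by apply: contM; [exact: cont_cst|apply: contB].
have cQ : iint (Q h) @[h --> (0 : R)] --> iint (Q 0).
  have nQ : \forall h \near (0 : R), dom (C * B) (Q h).
    by apply/nbhs_ballP; exists 1 => //= h _; exact: dQ.
  apply: (@iint_continuous R R d (C * B) Q 0 nQ) => a.
  rewrite /Q eqxx; apply: cvgM; first exact: cvg_cst.
  apply: cvg_dnbhs0; rewrite -DG; exact: dG.
have E0 : iint (Q 0) = conv f ('D_(-1 *: v) phi) y by rewrite /Q eqxx.
have EQ h : h != 0 -> iint (Q h) = h^-1 *: (((conv f phi) \o shift y) (h *: v) - conv f phi y).
  move=> h0; have d1 := dom_conv (h *: v + y) (smooth_cont sp) pB df.
  have d2 := dom_conv y (smooth_cont sp) pB df.
  have d3 : dom (C * B1 + `|-1| * (C * B1)) (fun a => f a * phi (-1 *: (h *: v + y) + a) - f a * phi (-1 *: y + a)).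
    by have := domD d1 (domZ (-1) d2); under eq_fun do rewrite mulN1r.
  rewrite /= /conv -(iintB d1 d2) /GRing.scale/= -(iintZ _ d3).
  by congr iint; apply/funext => a; rewrite /Q (negbTE h0) /G; ring.
have L : (h^-1 *: (((conv f phi) \o shift y) (h *: v) - conv f phi y)) @[h --> 0^'] --> conv f ('D_(-1 *: v) phi) y.
  rewrite -E0; apply/cvgrPdist_lt => e e0; have /cvgrPdist_lt/(_ e e0) := cQ.
  by rewrite near_withinE; apply: filterS => h + h0; rewrite (EQ _ h0).
split; first by apply/cvg_ex; eexists; exact: L.
exact: (cvg_lim _ L).
Qed.

Lemma Ck_conv C f : dom C f -> forall k phi, Cc_inf phi -> Ck k (conv f phi).
Proof.
move=> df; have c1 phi : Cc_inf phi -> C1w (conv f phi).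
  move=> Cp; split; last by move=> v x; have [] := is_derive_conv x v df Cp.
  have /Cc_infP[sp bp] := Cp; have [B B0 pB] := cont_bsupp_bounded (smooth_cont sp) bp.
  apply: (iint_continuousT (C := C * B)) => [y|a]; first exact: dom_conv (smooth_cont sp) pB df.
  apply: contM; first exact: cont_cst.
  exact: (cont_comp (@continuous_affine _ _ (-1) a) (smooth_cont sp)).
elim=> [|k IH] phi Cp; (split; first exact: c1) => //.
move=> v; rewrite (_ : 'D_v _ = conv f ('D_(-1 *: v) phi)).
  by apply: IH; exact: Cc_inf_derive.
by apply/funext => x; have [_ ->] := is_derive_conv x v df Cp.
Qed.

Lemma iint_norm_le C C' (G H : 'rV[R]_d -> R) : dom C G -> dom C' H ->
  (forall a, `|G a| <= H a) -> `|iint G| <= iint H.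
Proof.
move=> dG dH GH; rewrite ler_norml; apply/andP; split.
  rewrite -subr_ge0 opprK -(iintD dG dH); apply: iint_ge0 => a.
  by have := GH a; rewrite ler_norml -subr_ge0 opprK => /andP[].
rewrite -subr_ge0 -(iintB dH dG); apply: iint_ge0 => a.
by have := GH a; rewrite ler_norml subr_ge0 => /andP[].
Qed.

(** Dividing by the mass of [phi] makes [g y] a weighted average of the values of [f] within [del]
    of [y]. The last clause keeps [g] zero near the origin whenever [f] is zero on a slightly larger
    ball. *)
Lemma mollify f phi (e del : R) : continuous f -> bsupp f -> 0 < e -> 0 < del ->
  (forall x y, enorm (x - y) < del -> `|f x - f y| <= e) ->
  Cc_inf phi -> (forall a, 0 <= phi a) -> 0 < phi 0 ->
  (forall a, del <= enorm a -> phi a = 0) ->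
  exists g, [/\ Cc_inf g, (forall y, `|f y - g y| <= e) &
    forall y, (forall a, enorm (a - y) < del -> f a = 0) -> g y = 0].
Proof.
move=> cf bf e0 d0 uf Cp p0 p00 pout.
have [C df] := dom_bsupp cf bf; have [Cphi dp] := Cc_dom Cp.
have /Cc_infP[sp bp] := Cp; have [B B0 pB] := cont_bsupp_bounded (smooth_cont sp) bp.
have N0 : 0 < iint phi by apply: (iint_gt0 (v0 := 0) dp).
pose g y := (iint phi)^-1 * conv f phi y.
have Z y : (forall a, enorm (a - y) < del -> f a = 0) -> g y = 0.
  move=> H; rewrite /g /conv (_ : (fun a => _) = (fun a => 0 * phi a)).
    by rewrite (iintZ _ dp) mul0r mulr0.
  apply/funext => a; rewrite mul0r scaleN1r addrC.
  by have [/H ->|/pout ->] := ltP (enorm (a - y)) del; rewrite ?mul0r ?mulr0.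
exists g; split => //.
  apply/Cc_infP; split.
    apply: smoothM; first exact: smooth_cst.
    by apply/smoothP => k; exact: Ck_conv df k phi Cp.
  have [M fM] := bf; exists (M + del) => y yM; apply: Z => a ay; apply: fM.
  rewrite -(lerD2r del); apply: le_trans yM _.
  rewrite (_ : y = a - (a - y)); last by rewrite opprB addrC subrK.
  apply: le_trans (ler_normB _ _) _; rewrite lerD2l ltW//.
  exact: le_lt_trans (norm_le_enorm _) ay.
move=> y; have [C2 dpy] := dom_shift (-1 *: y) dp.
have EN : iint (fun a => phi (-1 *: y + a)) = iint phi := iint_shift _ dp.
have d2 := dom_conv y (smooth_cont sp) pB df.
have E : f y - g y = (iint phi)^-1 * iint (fun a => f y * phi (-1 *: y + a) - f a * phi (-1 *: y + a)).
  rewrite (iintB (domZ (f y) dpy) d2) (iintZ _ dpy) EN mulrBr [_^-1 * (f y * _)]mulrCA.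
  by rewrite mulVf ?mulr1// lt0r_neq0.
rewrite E normrM gtr0_norm ?invr_gt0// mulrC ler_pdivrMr// -EN -(iintZ _ dpy).
have d3 : dom (`|f y| * C2 + `|-1| * (C * B)) (fun a => f y * phi (-1 *: y + a) - f a * phi (-1 *: y + a)).
  by have := domD (domZ (f y) dpy) (domZ (-1) d2); under eq_fun do rewrite mulN1r.
apply: (iint_norm_le d3 (domZ e dpy)) => a.
rewrite -mulrBl normrM (ger0_norm (p0 _)) scaleN1r [- y + a]addrC.
have [ay|/pout ->] := ltP (enorm (a - y)) del; last by rewrite !mulr0.
by rewrite ler_wpM2r// uf// -enormN opprB.
Qed.

End mollification.

(** * From continuity of the symbol to continuity of the generator *)

Section symbol.
Variables (R : realType) (d : nat).
Variables (chi : 'rV[R]_d -> R) (q0 : 'rV[R]_d -> R) (b : 'rV[R]_d -> 'rV[R]_d).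
Variable nu : 'rV[R]_d -> {measure set (BRd R d) -> \bar R}.
Hypothesis Cchi : Cc_inf chi.
Hypothesis chi_bounds : forall y : 'rV[R]_d,
  (if enorm y < 1 then 1 else 0) <= chi y <= (if enorm y < 2 then 1 else 0).
Hypothesis nu0 : forall x, nu x [set (0 : 'rV[R]_d)] = 0%E.
Hypothesis nu_levy : forall x,
  (\int[nu x]_(y in @punct R d) (Num.min (enorm y ^+ 2) 1)%:E < +oo)%E.

Notation q := (qsym q0 b nu chi).
Notation pR x := (psiR (nu x)).
Notation pI x := (psiI (nu x) chi (b x)).

Lemma qsymE x xi : q x xi = Complex (q0 x + pR x xi) (pI x xi).
Proof.
rewrite /qsym /cmintegral /psiR /psiI.
have -> : Rintegral (nu x) (@punct R d) (fun y => complex.Re (1 - expi (dotp y xi) + iC R * rC (dotp y xi * chi y))) = Rintegral (nu x) (@punct R d) (cosint xi).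
  by apply: eq_Rintegral => y _; rewrite /expi /iC /rC /cosint; simpc.
have -> : Rintegral (nu x) (@punct R d) (fun y => complex.Im (1 - expi (dotp y xi) + iC R * rC (dotp y xi * chi y))) = Rintegral (nu x) (@punct R d) (sinint chi xi).
  by apply: eq_Rintegral => y _; rewrite /expi /iC /rC /sinint; simpc; rewrite /= addrC.
by rewrite /rC /iC; simpc.
Qed.

Lemma psiR0 x : pR x 0 = 0.
Proof.
rewrite /psiR (_ : cosint 0 = (fun _ => 0)); first by rewrite /Rintegral integral0.
by apply/funext => y; rewrite /cosint dotp0r cos0 subrr.
Qed.

Lemma psiI0 x : pI x 0 = 0.
Proof.
rewrite /psiI (_ : sinint chi 0 = (fun _ => 0)); first by rewrite /Rintegral integral0 dotp0r oppr0 addr0.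
by apply/funext => y; rewrite /sinint dotp0r sin0 mul0r subrr.
Qed.

Lemma qsymB x xi : q x xi - q x 0 = Complex (pR x xi) (pI x xi).
Proof. by rewrite !qsymE psiR0 psiI0; simpc; congr Complex; ring. Qed.

Lemma fourierE (f : 'rV[R]_d -> R) xi :
  fourier f xi = rC ((2 * pi) ^- d) * Complex (cosT f 0 xi) (sinT f 0 xi).
Proof.
rewrite /fourier /cint; congr (_ * Complex _ _); congr iint; apply/funext => a;
  rewrite /expi /rC sub0r dotpNl; simpc => /=; ring.
Qed.

Lemma pseudo_diff_integrand (f : 'rV[R]_d -> R) x xi : Cc_inf f ->
  expi (dotp x xi) * (q x xi - q x 0) * fourier f xi =
  Complex ((2 * pi) ^- d * (pR x xi * cosT f x xi - pI x xi * sinT f x xi))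
          ((2 * pi) ^- d * (pR x xi * sinT f x xi + pI x xi * cosT f x xi)).
Proof.
move=> Cf; have [C df] := Cc_dom Cf.
rewrite qsymB fourierE integrand_complex.
have := cosT_shift 0 x xi df; have := sinT_shift 0 x xi df.
by rewrite add0r => -> ->.
Qed.

Lemma pseudo_diffE (f : 'rV[R]_d -> R) x : Cc_inf f ->
  - cint (fun xi => expi (dotp x xi) * (q x xi - q x 0) * fourier f xi) =
  Complex (- iint (fun xi => (2 * pi) ^- d * (pR x xi * cosT f x xi - pI x xi * sinT f x xi)))
          (- iint (fun xi => (2 * pi) ^- d * (pR x xi * sinT f x xi + pI x xi * cosT f x xi))).
Proof.
move=> Cf; rewrite (_ : (fun xi => _) = (fun xi =>
  Complex ((2 * pi) ^- d * (pR x xi * cosT f x xi - pI x xi * sinT f x xi))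
          ((2 * pi) ^- d * (pR x xi * sinT f x xi + pI x xi * cosT f x xi)))).
  by rewrite /cint/=; simpc.
by apply/funext => xi; rewrite pseudo_diff_integrand.
Qed.

Lemma cond_iP : cond_i q <-> forall xi, continuous (fun x => pR x xi) /\ continuous (fun x => pI x xi).
Proof.
split=> H xi.
  have [h1 h2] := H xi; split.
    by rewrite (_ : (fun x => _) = (fun x => complex.Re (q x xi - q x 0)))//; apply/funext => x; rewrite qsymB.
  by rewrite (_ : (fun x => _) = (fun x => complex.Im (q x xi - q x 0)))//; apply/funext => x; rewrite qsymB.
have [h1 h2] := H xi; split.
  by rewrite (_ : (fun x => _) = (fun x => pR x xi))//; apply/funext => x; rewrite qsymB.
by rewrite (_ : (fun x => _) = (fun x => pI x xi))//; apply/funext => x; rewrite qsymB.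
Qed.

Definition gen (f : 'rV[R]_d -> R) x := levy_op (nu x) chi (b x) f x.

Lemma cond_iv_gen : cond_iv q -> forall f, Cc_inf f -> continuous (gen f).
Proof.
move=> H f Cf; have [h _] := H f Cf.
have c0 := inv_cst_gt0 Cchi (chi_at0 chi_bounds) (chi_ge0 chi_bounds).
have p0 : 0 < (2 * pi) ^- d :> R by rewrite invr_gt0 exprn_gt0// mulr_gt0// pi_gt0.
have -> : gen f = (fun x => ((2 * pi) ^- d * inv_cst chi)^-1 * complex.Re (- cint (fun xi => expi (dotp x xi) * (q x xi - q x 0) * fourier f xi))).
  apply/funext => x; rewrite pseudo_diffE//=.
  have [_ [C dC] E] := levy_formula (nu0 x) (nu_levy x) Cchi chi_bounds (b x) x Cf.
  rewrite (iintZ _ dC) E -/(gen f x); field.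
  by rewrite !lt0r_neq0 ?exprn_gt0 ?mulr_gt0 ?pi_gt0.
by apply: contM => //; exact: cont_cst.
Qed.

Hypothesis q_locbdd : forall K : set 'rV[R]_d, compact K ->
  exists2 c : R, 0 < c & forall x xi, K x ->
    cmod (q x xi) <= c * (1 + enorm xi ^+ 2).

(** The hypothesis at [xi = 0] bounds [q0], which can then be subtracted at the price of doubling
    the constant. *)
Lemma psi_locbdd (K : set 'rV[R]_d) : compact K -> exists2 c : R, 0 < c &
  forall x xi, K x -> `|pR x xi| <= c * (1 + enorm xi ^+ 2) /\ `|pI x xi| <= c * (1 + enorm xi ^+ 2).
Proof.
move=> cK; have [c c0 H] := q_locbdd cK; exists (2 * c); first by rewrite mulr_gt0.
move=> x xi Kx; have H1 := H x xi Kx; have H2 := H x 0 Kx.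
have e0 := sqr_ge0 (enorm xi); have := mulr_ge0 (ltW c0) e0 => ce.
have R1 := le_trans (Re_le_cmod _) H1; have R2 := le_trans (Re_le_cmod _) H2.
have I1 := le_trans (Im_le_cmod _) H1.
rewrite qsymE/= in R1 I1; rewrite qsymE/= psiR0 addr0 enorm0 in R2.
split; last by apply: le_trans I1 _; lra.
rewrite (_ : pR x xi = (q0 x + pR x xi) - q0 x); last by ring.
by apply: le_trans (ler_normB _ _) _; move: R2; rewrite expr0n/= addr0; lra.
Qed.

(* The local bound c(1 + |xi|^2) is integrated against transforms of order wt^2. *)
Lemma cond_i_iv : cond_i q -> cond_iv q.
Proof.
move=> /cond_iP Hi f Cf; have [C df] := Cc_dom Cf; have [D D0 HD] := trig_decay Cf.
(* Real and imaginary parts have the same shape, with the pair [(F, G)] equal to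
   [(cosT f, - sinT f)] and [(sinT f, cosT f)] respectively. *)
have key (s : R) (F G : 'rV[R]_d -> 'rV[R]_d -> R) :
    (forall x, continuous (F x)) -> (forall x, continuous (G x)) ->
    (forall xi, continuous (F^~ xi)) -> (forall xi, continuous (G^~ xi)) ->
    (forall x xi, `|F x xi| <= D * wt xi ^+ 2) -> (forall x xi, `|G x xi| <= D * wt xi ^+ 2) ->
    continuous (fun x => - iint (fun xi => s * (pR x xi * F x xi + pI x xi * G x xi))).
  move=> cF cG cFx cGx FD GD; apply: contN => x.
  have [c c0 Hc] := psi_locbdd (@compact_cball R d x 1).
  apply: (@iint_continuous R _ d (`|s| * (2 * (c * D)))) => [|xi]; last first.
    have HR := contM (Hi xi).1 (cFx xi); have HI := contM (Hi xi).2 (cGx xi).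
    by apply: (contM (@cont_cst _ _ s) (contD HR HI)).
  have N : nbhs x [set z | `|x - z| <= 1].
    by apply/nbhs_ballP; exists 1 => //= z; rewrite -ball_normE /= => /ltW.
  apply: filterS N => z zx; apply: domZ; split.
    apply: contD; apply: contM => //.
      exact: (continuous_psiR (nu_levy z)).
    exact: (continuous_psiI (nu_levy z) Cchi chi_bounds).
  move=> xi; have [B1 B2] := Hc z xi zx.
  apply: le_trans (ler_normD _ _) _; rewrite !normrM.
  have W := wt_enorm xi; have W0 := wt_gt0 xi.
  have E0 : 0 <= 1 + enorm xi ^+ 2 by rewrite addr_ge0// sqr_ge0.
  apply: (@le_trans _ _ (2 * ((c * (1 + enorm xi ^+ 2)) * (D * wt xi ^+ 2)))).
    by rewrite mulrDl !mul1r; apply: lerD; apply: ler_pM.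
  rewrite [leLHS](_ : _ = (2 * (c * D) * wt xi) * ((1 + enorm xi ^+ 2) * wt xi)); last by ring.
  by rewrite ler_piMr// !mulr_ge0// ltW.
have cU x := continuous_cosT (x := x) df; have cV x := continuous_sinT (x := x) df.
have cUx xi := continuous_cosT_x (xi := xi) df; have cVx xi := continuous_sinT_x (xi := xi) df.
split.
  rewrite (_ : (fun x => _) = (fun x => - iint (fun xi => (2 * pi) ^- d * (pR x xi * cosT f x xi + pI x xi * (- sinT f x xi))))).
    apply: (key _ (cosT f) (fun x xi => - sinT f x xi)) => //.
    - by move=> x; exact: contN.
    - by move=> xi; exact: contN.
    - by move=> x xi; have [] := HD x xi.
    - by move=> x xi; rewrite normrN; have [] := HD x xi.
  apply/funext => x; rewrite pseudo_diffE//=; congr (- iint _).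
  by apply/funext => xi; rewrite mulrN.
rewrite (_ : (fun x => _) = (fun x => - iint (fun xi => (2 * pi) ^- d * (pR x xi * sinT f x xi + pI x xi * cosT f x xi)))).
  apply: (key _ (sinT f) (cosT f)) => //.
  - by move=> x xi; have [] := HD x xi.
  - by move=> x xi; have [] := HD x xi.
by apply/funext => x; rewrite pseudo_diffE.
Qed.

(** * From continuity of the characteristics to the symbol *)

(** A smooth cut-off between radius [s] and [2 * s]; the summand 0 matches the form of the affine
    substitution lemmas. *)
Definition dil (s : R) (y : 'rV[R]_d) : R := chi (s^-1 *: y + 0).

Lemma dil_in (s : R) y : 0 < s -> enorm y < s -> dil s y = 1.
Proof.
move=> s0 ys; apply: (chi_in chi_bounds).
by rewrite addr0 enormZ gtr0_norm ?invr_gt0// mulrC ltr_pdivrMr// mul1r.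
Qed.

Lemma dil_out (s : R) y : 0 < s -> 2 * s <= enorm y -> dil s y = 0.
Proof.
move=> s0 ys; apply: (chi_out chi_bounds).
by rewrite addr0 enormZ gtr0_norm ?invr_gt0// mulrC ler_pdivlMr.
Qed.

Lemma dil_ge0 s y : 0 <= dil s y.
Proof. exact: (chi_ge0 chi_bounds). Qed.

Lemma dil_le1 s y : dil s y <= 1.
Proof. exact: (chi_le1 chi_bounds). Qed.

Lemma Cc_inf_dil (s : R) : 0 < s -> Cc_inf (dil s).
Proof. by move=> s0; apply: Cc_inf_affine => //; rewrite invr_neq0// lt0r_neq0. Qed.

Lemma continuous_dil (s : R) : continuous (dil s).
Proof. exact: (cont_comp (@continuous_affine _ _ s^-1 0) (continuous_chi Cchi)). Qed.

Definition midf (h : 'rV[R]_d -> R) (s S : R) (y : 'rV[R]_d) : R :=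
  h y * (1 - dil s y) * dil S y.

Lemma continuous_midf h s S : continuous h -> continuous (midf h s S).
Proof.
move=> ch; apply: contM; last exact: continuous_dil.
by apply: contM => //; apply: contB; [exact: cont_cst|exact: continuous_dil].
Qed.

(** Truncation changes [h] only where [enorm y <= 2 * s] or [S <= enorm y]. There [|h|] is at most
    [K * enorm y ^+ 2] and [K] respectively, so each region costs [K * e]. *)
Lemma midf_close x (h : 'rV[R]_d -> R) (K s S e : R) : continuous h -> 0 <= K ->
  (forall y, `|h y| <= K * m2 y) -> 0 < s -> 1 <= S ->
  (\int[nu x]_(y in @punct R d `&` [set y : 'rV[R]_d | (enorm y <= 2 * s)%R])
    (enorm y ^+ 2)%:E <= e%:E)%E ->
  (nu x (~` [set y : 'rV[R]_d | (enorm y < S)%R]) <= e%:E)%E ->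
  `|Rintegral (nu x) (@punct R d) h - Rintegral (nu x) (@punct R d) (midf h s S)| <= 2 * K * e.
Proof.
move=> ch K0 hK s0 S1 Hs HS.
have S0 : 0 < S by exact: lt_le_trans ltr01 S1.
have h0 : h 0 = 0.
  by have := hK 0; rewrite m20 mulr0 normr_le0 => /eqP.
have cg := @continuous_midf h s S ch.
have d01 s' y : 0 <= 1 - dil s' y by rewrite subr_ge0 dil_le1.
have d1 s' y : 1 - dil s' y <= 1 by rewrite gerBl dil_ge0.
have gK y : `|midf h s S y| <= K * m2 y.
  apply: le_trans (hK y); rewrite /midf !normrM (ger0_norm (d01 s y)) (ger0_norm (dil_ge0 S y)).
  by rewrite -mulrA ler_piMr// mulr_ile1 ?dil_ge0 ?dil_le1.
have ih := integrable_le_m2 (nu_levy x) ch hK.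
have ig := integrable_le_m2 (nu_levy x) cg gK.
rewrite !Rintegral_punct//; last by rewrite /midf h0 !mul0r.
rewrite -RintegralB//.
pose D := ~` [set y : 'rV[R]_d | (enorm y < S)%R] : set (BRd R d).
have DE : D = [set y : 'rV[R]_d | (S <= enorm y)%R].
  by apply/seteqP; split => y /=; rewrite leNgt => /negP.
have mD : measurable D by rewrite DE; exact: measurable_enorm_ge.
pose B := [set y : 'rV[R]_d | (enorm y <= 2 * s)%R] : set (BRd R d).
have mB : measurable B by exact: measurable_enorm_le.
have -> : 2 * K * e = K * e + K * e by ring.
apply: (Rintegral_split_bound (g := fun y => K * (enorm y ^+ 2 * \1_B y)) (D := D)) => //.
- exact: (integrableB measurableT ih ig).
- apply: measurable_funM => //; apply: measurable_funM; last exact: measurable_indic.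
  apply: cont_measurable; under eq_fun do rewrite expr2.
  by apply: contM; exact: continuous_enorm.
- by move=> y; rewrite mulr_ge0// mulr_ge0 ?sqr_ge0// indicE.
- move=> y; have E : h y - midf h s S y = h y * (1 - (1 - dil s y) * dil S y).
    by rewrite /midf; ring.
  rewrite E normrM.
  have F0 : 0 <= 1 - (1 - dil s y) * dil S y.
    by rewrite subr_ge0 mulr_ile1 ?dil_ge0 ?dil_le1.
  have F1 : 1 - (1 - dil s y) * dil S y <= 1 by rewrite gerBl mulr_ge0 ?dil_ge0.
  rewrite (ger0_norm F0).
  have [yB|yB] := leP (enorm y) (2 * s).
    rewrite [X in K * (_ * X)]indicE mem_set// mulr1.
    apply: (@le_trans _ _ (K * enorm y ^+ 2)); last first.
      by rewrite lerDl mulr_ge0// indicE.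
    apply: (@le_trans _ _ `|h y|); first by rewrite ler_piMr.
    by apply: le_trans (hK y) _; rewrite ler_wpM2l// ge_min lexx.
  have [yD|yD] := leP S (enorm y).
    rewrite [X in _ + K * X]indicE mem_set ?DE// mulr1.
    apply: (@le_trans _ _ K); last by rewrite lerDr mulr_ge0// mulr_ge0 ?sqr_ge0// indicE.
    apply: (@le_trans _ _ `|h y|); first by rewrite ler_piMr.
    by apply: le_trans (hK y) _; rewrite ler_piMr// ge_min lexx orbT.
  rewrite dil_out ?(ltW yB)// dil_in// subr0 mulr1 subrr mulr0.
  have iB : 0 <= \1_B y :> R by rewrite indicE.
  have iD : 0 <= \1_D y :> R by rewrite indicE.
  exact: addr_ge0 (mulr_ge0 K0 (mulr_ge0 (sqr_ge0 _) iB)) (mulr_ge0 K0 iD).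
- under eq_integral do rewrite EFinM.
  rewrite ge0_integralZl//; last 2 first.
  + apply/measurable_EFinP; apply: measurable_funM; last exact: measurable_indic.
    apply: cont_measurable; under eq_fun do rewrite expr2.
    by apply: contM; exact: continuous_enorm.
  + by move=> y _; rewrite lee_fin mulr_ge0 ?sqr_ge0// indicE.
  rewrite EFinM lee_wpmul2l//; apply: le_trans Hs.
  rewrite -/B integral_mkcondr integral_punct.
    rewrite le_eqVlt; apply/orP; left; apply/eqP.
    apply: eq_integral => y _; rewrite patchE indicE; case: ifPn => yB.
      by rewrite mulr1.
    by rewrite mulr0.
  by rewrite patchE enorm0 expr0n/=; case: ifP.
Qed.

Lemma cond_iii_cont (h : 'rV[R]_d -> R) (K : R) : cond_iii b nu -> continuous h -> 0 <= K ->
  (forall y, `|h y| <= K * m2 y) ->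
  continuous (fun z => Rintegral (nu z) (@punct R d) h).
Proof.
move=> [_ vag tight small] ch K0 hK.
apply: cont_unif_approx => x e e0; pose e' := e / (2 * K + 1).
  have k0 : 0 < 2 * K + 1 by rewrite ltr_wpDl// mulr_ge0.
  have e'0 : 0 < e' by rewrite divr_gt0.
  have cK := @compact_cball R d x 1.
  have [M HM] := tight _ cK e' e'0; have [del d0 Hd] := small _ cK e' e'0.
  (* The inner cut-off reaches out to [2 * s], which must be strictly below [del]; [S] must be
     strictly above [M]. *)
  pose s := del / 4; pose S := Num.max 1 (M + 1).
  have s0 : 0 < s by rewrite divr_gt0.
  have S1 : 1 <= S by rewrite le_max lexx.
  have S0 : 0 < S by exact: lt_le_trans ltr01 S1.
exists (fun z => Rintegral (nu z) (@punct R d) (midf h s S)).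
  apply: vag; first exact: continuous_midf.
    by apply/bsuppP; apply: bsuppM; have /Cc_infP[] := Cc_inf_dil S0.
  apply/not_supp0P; exists s => // y ys.
  by rewrite /midf dil_in// subrr mulr0 mul0r.
apply: nbhs_cball1 => z zx; apply: (@le_trans _ _ (2 * K * e')).
    apply: midf_close => //.
      by apply: Hd => //; rewrite ?mulr_gt0// /s; lra.
    by apply: HM => //; rewrite lt_max ltrDl ltr01 orbT.
  rewrite /e' mulrCA ger_pMr// ler_pdivrMr// mul1r lerDl ler01//.
Qed.

Lemma cond_iii_i : cond_iii b nu -> cond_i q.
Proof.
move=> H3; apply/cond_iP => xi.
have K0 : 0 <= 2 * (1 + enorm xi ^+ 2) by rewrite mulr_ge0// addr_ge0// sqr_ge0.
split.
  apply: (cond_iii_cont H3 _ K0); last exact: cosint_bound.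
  exact: continuous_cosint.
apply: contD.
  have [cb _ _ _] := H3.
  exact: (contN (cont_comp cb (@continuous_dotpl _ _ xi))).
apply: (cond_iii_cont H3 _ K0); last exact: (sinint_bound chi_bounds).
exact: (continuous_sinint Cchi).
Qed.

(** The first term tends to 0 with [xi] when integrated, the second is a tail. [enorm xi <= 1]
    replaces the square of the norm by the norm, [(S + 1) ^+ 2] dominates both [enorm y ^+ 2] and
    [2 * enorm y] below radius [S], and [S >= 2] makes the compensator vanish on the tail. *)
Lemma int_small_bound (S : R) xi y : 2 <= S -> enorm xi <= 1 ->
  `|cosint xi y| <= (S + 1) ^+ 2 * enorm xi * m2 y + 2 * \1_[set y : 'rV[R]_d | (S <= enorm y)%R] y /\
  `|sinint chi xi y| <= (S + 1) ^+ 2 * enorm xi * m2 y + 2 * \1_[set y : 'rV[R]_d | (S <= enorm y)%R] y.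
Proof.
move=> S2 x1; have x0 := enorm_ge0 xi; have y0 := enorm_ge0 y.
have cs := cauchy_schwarz y xi; have ds := dotp_sqr_le xi y.
have xx : enorm xi ^+ 2 <= enorm xi by rewrite expr2 ler_piMr.
have [Sy|yS] := leP S (enorm y).
  rewrite indicE mem_set// mulr1.
  have g0 : 0 <= (S + 1) ^+ 2 * enorm xi * m2 y by exact: mulr_ge0 (mulr_ge0 (sqr_ge0 _) x0) (m2_ge0 _).
  split; first by apply: le_trans (one_cos_le2 _) _; rewrite lerDr.
  rewrite /sinint (chi_out chi_bounds) ?(le_trans S2)// mulr0 sub0r normrN.
  by apply: le_trans (sin_max _) _; lra.
rewrite indicE memNset ?mulr0 ?addr0; last by rewrite /= leNgt yS.
have [y1|y1] := ltP (enorm y) 1.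
  have k1 : 1 <= (S + 1) ^+ 2 by nra.
  have B : dotp y xi ^+ 2 <= (S + 1) ^+ 2 * enorm xi * m2 y.
    rewrite m2_small ?(ltW y1)//; apply: le_trans ds _; rewrite mulrC ler_wpM2r ?sqr_ge0//.
    by apply: le_trans xx _; rewrite ler_peMl.
  split; first exact: le_trans (one_cos_le _) B.
  by rewrite /sinint (chi_in chi_bounds)// mulr1; exact: le_trans (sin_sub_le _) B.
rewrite m2_big// mulr1.
have yS2 : enorm y ^+ 2 <= (S + 1) ^+ 2 by rewrite lerXn2r ?nnegrE ?addr_ge0//; lra.
split.
  apply: le_trans (one_cos_le _) _; apply: le_trans ds _.
  by apply: ler_pM; rewrite ?sqr_ge0.
apply: le_trans (ler_normB _ _) _; rewrite normrM (ger0_norm (chi_ge0 chi_bounds y)).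
have s1 := sin_le_abs (dotp y xi).
have s2 : `|dotp y xi| * chi y <= `|dotp y xi| by rewrite ler_piMr// (chi_le1 chi_bounds).
apply: (@le_trans _ _ (2 * (enorm y * enorm xi))); first by lra.
rewrite mulrA ler_wpM2r//; nra.
Qed.

Lemma cond_iii_ii : cond_iii b nu -> cond_ii q.
Proof.
move=> H3; split; first exact: cond_iii_i.
move=> K cK e e0; have [cb _ tight _] := H3.
(* [m2] is itself an admissible integrand, so its integral is continuous in [z] and hence bounded on
   [K]. *)
have cm : continuous (fun z => Rintegral (nu z) (@punct R d) (@m2 R d)).
  apply: (cond_iii_cont H3 (@continuous_m2 R d) ler01) => y.
  by rewrite mul1r ger0_norm// m2_ge0.
have [C C0 HC] := compact_cont_bounded cm cK.
have [B B0 HB] := compact_cont_bounded (cont_comp cb (@continuous_enorm R d)) cK.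
(* The tail enters with factor 2 in both the real and the imaginary part, which makes [e / 2]; the
   other half is left for the terms linear in [enorm xi], whose coefficients are collected in
   [Q]. *)
have e8 : 0 < e / 8 by rewrite divr_gt0.
have [M HM] := tight K cK (e / 8) e8.
pose S := Num.max 2 (M + 1); have S2 : 2 <= S by rewrite le_max lexx.
have SM : M < S by rewrite lt_max ltrDl ltr01 orbT.
pose Q := B + 2 * ((S + 1) ^+ 2 * C).
have Q0 : 0 <= Q by exact: addr_ge0 B0 (mulr_ge0 (ler0n _ 2) (mulr_ge0 (sqr_ge0 _) C0)).
exists (Num.min 1 (e / 2 / (Q + 1))).
  by rewrite lt_min ltr01 !divr_gt0// ltr_wpDl.
move=> xi; rewrite lt_min => /andP[/ltW x1 xe] x Kx; have x0 := enorm_ge0 xi.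
rewrite ltr_pdivlMr ?ltr_wpDl// in xe.
have k0 : 0 <= (S + 1) ^+ 2 * enorm xi by exact: mulr_ge0 (sqr_ge0 _) x0.
have mle : (\int[nu x]_y ((S + 1) ^+ 2 * enorm xi * m2 y)%:E <= ((S + 1) ^+ 2 * enorm xi * C)%:E)%E.
  have im := integrable_m2 (nu_levy x).
  under eq_integral do rewrite EFinM.
  rewrite ge0_integralZl//; last 2 first.
  - by apply/measurable_EFinP; apply: cont_measurable; exact: continuous_m2.
  - by move=> y _; rewrite lee_fin m2_ge0.
  rewrite [leRHS]EFinM lee_wpmul2l ?lee_fin//.
  rewrite -[X in (X <= _)%E]fineK; last exact: integrable_fin_num im.
  rewrite lee_fin; apply: le_trans (ler_norm _) _.
  by have := HC x Kx; rewrite Rintegral_punct// m20.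
have mD : (nu x [set y : 'rV[R]_d | (S <= enorm y)%R] <= (e / 8)%:E)%E.
  rewrite (_ : [set y | _] = ~` [set y : 'rV[R]_d | (enorm y < S)%R]); first exact: HM.
  by apply/seteqP; split => y /=; rewrite leNgt => /negP.
have key (A : 'rV[R]_d -> R) : A 0 = 0 -> (nu x).-integrable setT (EFin \o A) ->
    (forall y, `|A y| <= (S + 1) ^+ 2 * enorm xi * m2 y + 2 * \1_[set y : 'rV[R]_d | (S <= enorm y)%R] y) ->
    `|Rintegral (nu x) (@punct R d) A| <= (S + 1) ^+ 2 * enorm xi * C + 2 * (e / 8).
  move=> A0 iA AB; rewrite Rintegral_punct//.
  apply: (Rintegral_split_bound iA _ _ _ _ AB mle mD) => //.
  - apply: cont_measurable; apply: contM; [exact: cont_cst|exact: continuous_m2].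
  - by move=> y; exact: mulr_ge0 (mulr_ge0 (sqr_ge0 _) x0) (m2_ge0 _).
  - exact: measurable_enorm_ge.
have kR := key _ (cosint0 xi) (integrable_cosint (nu_levy x) xi) (fun y => (int_small_bound y S2 x1).1).
have kI := key _ (sinint0 chi xi) (integrable_sinint (nu_levy x) Cchi chi_bounds xi) (fun y => (int_small_bound y S2 x1).2).
rewrite qsymB; apply: le_trans (cmod_le _ _) _.
have bB : `|dotp (b x) xi| <= B * enorm xi.
  apply: le_trans (cauchy_schwarz _ _) _; rewrite ler_wpM2r//.
  by apply: le_trans (ler_norm _) (HB x Kx).
have := ler_normD (- dotp (b x) xi) (Rintegral (nu x) (@punct R d) (sinint chi xi)).
rewrite normrN /psiI /psiR => k2.
move: xe; rewrite /Q; nra.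
Qed.

(** * From continuity of the generator to the characteristics *)

(** With [F] centred at [x0], the generator at a nearby [x] evaluates [F] at the small displacement
    [x - x0]. The factor [1] matches the affine substitution lemmas. *)
Definition tr (x0 : 'rV[R]_d) (F : 'rV[R]_d -> R) (u : 'rV[R]_d) : R := F (1 *: u + - x0).

Lemma trE x0 F u : tr x0 F u = F (u - x0).
Proof. by rewrite /tr scale1r. Qed.

Lemma Cc_inf_tr x0 F : Cc_inf F -> Cc_inf (tr x0 F).
Proof. by apply: Cc_inf_affine; exact: oner_neq0. Qed.

Lemma derive_tr x0 F v x : 'D_v (tr x0 F) x = 'D_v F (x - x0).
Proof. by rewrite derive_affine !scale1r. Qed.

Definition jmp F (h y : 'rV[R]_d) : R := F (h + y) - F h - chi y * 'D_y F h.

Lemma gen_tr x0 F x : Cc_inf F ->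
  (nu x).-integrable setT (EFin \o jmp F (x - x0)) /\
  gen (tr x0 F) x = 'D_(b x) F (x - x0) + Rintegral (nu x) setT (jmp F (x - x0)).
Proof.
move=> CF.
have E : jump chi (tr x0 F) x = jmp F (x - x0).
  by apply/funext => y; rewrite /jump /jmp !trE derive_tr [x + y - x0]addrAC.
have [i _ _] := levy_formula (nu0 x) (nu_levy x) Cchi chi_bounds (b x) x (Cc_inf_tr x0 CF).
rewrite E in i; split; first exact: i.
have J0 : jmp F (x - x0) 0 = 0 by rewrite /jmp addr0 derive0 mulr0 !subrr.
by rewrite /gen /levy_op derive_tr E (Rintegral_punct (nu x) J0).
Qed.

Lemma near_enorm_lt (h : 'rV[R]_d) (s : R) : enorm h < s -> \forall u \near h, enorm u < s.
Proof. by move=> hs; apply: open_nbhs_nbhs; split => //; exact: open_enorm_lt. Qed.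

Lemma derive_dil s h v : 0 < s -> enorm h < s -> 'D_v (dil s) h = 0.
Proof.
move=> s0 hs; rewrite -(derive_cst (1 : R) h v); apply: near_eq_derive.
by apply: filterS (near_enorm_lt hs) => u us; rewrite dil_in.
Qed.

Section generator_continuous.
Hypothesis Hgen : forall f, Cc_inf f -> continuous (gen f).

Definition outer (s : R) x : R := Rintegral (nu x) setT (fun y => 1 - dil s y).

(** Near the origin [dil s] is constant 1, so drift and compensator drop out and minus the generator
    at [x] integrates [1 - dil s (x - x0 + y)]. By continuity this is at most its value at [x0] plus
    [e], and a Markov bound extracts the tail. *)
Lemma tail_near (x0 : 'rV[R]_d) (s e : R) : 0 < s -> 0 < e ->
  \forall x \near x0, (nu x [set y : 'rV[R]_d | (3 * s <= enorm y)%R] <= (outer s x0 + e)%:E)%E.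
Proof.
move=> s0 e0; have CF := Cc_inf_dil s0.
have N := cont_near x0 (Hgen (Cc_inf_tr x0 CF)) e0.
have J x : enorm (x - x0) < s -> jmp (dil s) (x - x0) = (fun y => - (1 - dil s (x - x0 + y))).
  by move=> xs; apply/funext => y; rewrite /jmp (derive_dil _ s0 xs) (dil_in s0 xs) mulr0; ring.
have [i0 E0] := gen_tr x0 x0 CF.
have z0 : enorm (x0 - x0) < s by rewrite subrr enorm0.
rewrite (derive_dil _ s0 z0) (J _ z0) add0r in E0.
have {}E0 : gen (tr x0 (dil s)) x0 = - outer s x0.
  rewrite E0 -[RHS]mulN1r /outer -RintegralZl//.
    by apply: eq_Rintegral => y _; rewrite subrr add0r mulN1r.
  move: i0; rewrite J// => /(integrableZl measurableT (-1)).
  apply: eq_integrable => // y _ /=; rewrite subrr add0r -EFinM; congr EFin; ring.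
apply: filterS2 (near_enorm x0 s0) N => x xs; rewrite E0.
have [i E] := gen_tr x0 x CF.
rewrite (derive_dil _ s0 xs) add0r (J _ xs) in E; rewrite E; move: i; rewrite (J _ xs) => i.
set I := Rintegral _ _ _ => H.
have i' : (nu x).-integrable setT (EFin \o (fun y => 1 - dil s (x - x0 + y))).
  move: i => /(integrableZl measurableT (-1)).
  by apply: eq_integrable => // y _ /=; rewrite -EFinM; congr EFin; ring.
have IE : I = - Rintegral (nu x) setT (fun y => 1 - dil s (x - x0 + y)).
  by rewrite -[RHS]mulN1r -RintegralZl//; apply: eq_Rintegral => y _; rewrite mulN1r.
have M := @markov_set R d (nu x) [set y : 'rV[R]_d | (3 * s <= enorm y)%R]
  (fun y => 1 - dil s (x - x0 + y)) 1 (measurable_enorm_ge _).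
rewrite mul1e in M; apply: le_trans (M _ _ ler01 _) _.
- apply: cont_measurable; apply: contB; first exact: cont_cst.
  by apply: (cont_comp (@continuous_translate _ _ _)); exact: continuous_dil.
- by move=> y; rewrite subr_ge0 dil_le1.
(* The displacement is shorter than [s], so [enorm y >= 3 * s] leaves at least [2 * s], where the
   cut-off vanishes. *)
- move=> y /= ys; clear i i' E H IE M; rewrite dil_out ?subr0//.
  have := enormB (x - x0 + y) (x - x0); rewrite [X in enorm X]addrAC subrr add0r.
  by lra.
rewrite -[X in (X <= _)%E]fineK; last exact: integrable_fin_num i'.
rewrite lee_fin -/(Rintegral (nu x) setT (fun y => 1 - dil s (x - x0 + y))).
by move: H; rewrite IE opprK ler_norml => /andP[h1 h2]; lra.
Qed.

Lemma tail_locbdd (x0 : 'rV[R]_d) (r : R) : 0 < r -> exists2 C : R, 0 <= C &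
  \forall x \near x0, (nu x [set y : 'rV[R]_d | (r <= enorm y)%R] <= C%:E)%E.
Proof.
move=> r0; have r3 : 0 < r / 3 by rewrite divr_gt0.
exists (outer (r / 3) x0 + 1).
  by rewrite addr_ge0//; apply: Rintegral_ge0 => y _; rewrite subr_ge0 dil_le1.
have := @tail_near x0 (r / 3) 1 r3 ltr01.
by rewrite (_ : 3 * (r / 3) = r)//; field.
Qed.

Lemma outer_cvg0 x : outer k.+1%:R x @[k --> \oo] --> (0 : R).
Proof.
have -> : 0 = Rintegral (nu x) setT (fun _ => 0) :> R by rewrite /Rintegral integral0.
apply: (@Rintegral_dct _ (BRd R d) R (nu x) setT (fun k y => 1 - dil k.+1%:R y) (fun _ => 0) (@m2 R d)) => //.
- move=> k; apply: cont_measurable.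
  by apply: contB; [exact: cont_cst|exact: continuous_dil].
- move=> y _; apply/cvgrPdist_le => e e0.
  have [N _ HN] : \forall k \near \oo, enorm y < k.+1%:R.
    exists (Num.bound (enorm y)) => // k /= Hk.
    apply: lt_le_trans (archi_boundP (enorm_ge0 y)) _.
    by rewrite ler_nat; exact: leq_trans Hk (leqnSn k).
  by exists N => // k /HN yk; rewrite dil_in// subrr subrr normr0 ltW.
- exact: integrable_m2.
- move=> k y _; rewrite ger0_norm ?subr_ge0 ?dil_le1//.
  have [y1|y1] := ltP (enorm y) 1.
    rewrite dil_in ?subrr ?m2_ge0//; apply: lt_le_trans y1 _.
    by rewrite ler1n.
  by rewrite m2_big// gerBl dil_ge0.
Qed.

(** At each point of [K] a radius with small [outer] exists by dominated convergence for that single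
    measure, and [tail_near] extends the estimate to a neighbourhood. Compactness, used with the
    filter [r --> +oo], gives one threshold for all of [K]. *)
Lemma gen_tight (K : set 'rV[R]_d) : compact K ->
  forall e : R, 0 < e -> exists M : R, forall r : R, M < r ->
    forall x, K x -> (nu x (~` [set y : 'rV[R]_d | (enorm y < r)%R]) <= e%:E)%E.
Proof.
move=> cK e e0; have e2 : 0 < e / 2 by rewrite divr_gt0.
pose P (r : R) x := (nu x (~` [set y : 'rV[R]_d | (enorm y < r)%R]) <= e%:E)%E.
have HP x : K x -> \forall x' \near x & r \near +oo, P r x'.
  move=> _; have /cvgrPdist_le/(_ _ e2)[N _ /(_ N (leqnn N)) /=] := outer_cvg0 x.
  rewrite sub0r normrN => /(le_trans (ler_norm _)) HN.
  have s0 : 0 < N.+1%:R :> R by [].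
  exists ([set z | (nu z [set y : 'rV[R]_d | (3 * N.+1%:R <= enorm y)%R] <= (outer N.+1%:R x + e / 2)%:E)%E],
          [set r | 3 * N.+1%:R <= r]) => /=.
    by split; [exact: tail_near|apply: nbhs_pinfty_ge; rewrite num_real].
  move=> [z r] [/= Hz Hr]; rewrite /P.
  apply: (@le_trans _ _ (nu z [set y : 'rV[R]_d | (3 * N.+1%:R <= enorm y)%R])).
    apply: le_measure; rewrite ?inE.
    - by apply: measurableC; apply: open_measurable_BRd; exact: open_enorm_lt.
    - exact: measurable_enorm_ge.
    - by move=> y /= /negP; rewrite -leNgt; exact: le_trans.
  by apply: le_trans Hz _; rewrite lee_fin; lra.
have [M [_ HM]] := (compact_near_coveringP _).1 cK R _ P _ HP.
by exists M => r Mr x Kx; exact: HM.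
Qed.

Lemma Rintegral_outside x (A : 'rV[R]_d -> R) (r c C : R) :
  (nu x).-integrable setT (EFin \o A) -> 0 <= c ->
  (forall y, enorm y < r -> A y = 0) -> (forall y, `|A y| <= c) ->
  (nu x [set y : 'rV[R]_d | (r <= enorm y)%R] <= C%:E)%E ->
  `|Rintegral (nu x) setT A| <= c * C.
Proof.
move=> iA c0 A0 Ac HC; rewrite -[leRHS]add0r.
apply: (Rintegral_split_bound (g := fun _ => 0) (D := [set y : 'rV[R]_d | (r <= enorm y)%R]) iA) => //.
- exact: measurable_enorm_ge.
- move=> y; rewrite add0r; have [ry|ry] := leP r (enorm y).
    by rewrite indicE mem_set// mulr1.
  by rewrite A0// normr0 mulr_ge0// indicE.
- by rewrite integral0.
Qed.

Definition coordf (j : 'I_d) (y : 'rV[R]_d) : R := y 0 j * chi y.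

Lemma Cc_inf_coordf j : Cc_inf (coordf j).
Proof. by apply: Cc_infM => //; exact: smooth_coord. Qed.

Lemma derive_coordf j h v : enorm h < 1 -> 'D_v (coordf j) h = v 0 j.
Proof.
move=> h1; have -> : v 0 j = 'D_v (fun y : 'rV[R]_d => y 0 j) h.
  by have [_ ->] := is_derive_coord j h v.
apply: near_eq_derive; apply: filterS (near_enorm_lt h1) => u us.
by rewrite /coordf (chi_in chi_bounds)// mulr1.
Qed.

(** [coordf j] is linear near the origin, so for displacement and jump below 1/2 the compensated
    jump is exactly 0 and the drift term is exactly [b x 0 j]. Larger jumps contribute at most
    [2 * e'] each by uniform continuity, over a locally bounded mass, so [b x 0 j] is locally close
    to a continuous function. *)
Lemma gen_b_coord j : continuous (fun x => b x 0 j).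
Proof.
apply: cont_unif_approx => x0 e e0; have CF := Cc_inf_coordf j.
exists (gen (tr x0 (coordf j))); first by apply: Hgen; exact: Cc_inf_tr.
have half0 : (0 : R) < 1 / 2 by rewrite divr_gt0.
have [C C0 HC] := tail_locbdd x0 half0.
have /Cc_infP[sF bF] := CF.
pose e' := e / (2 * (C + 1)).
have e'0 : 0 < e' by rewrite divr_gt0// mulr_gt0// ltr_wpDl.
have [del d0 Hd] := bsupp_unif_cont (smooth_cont sF) bF e'0.
have m0 : 0 < Num.min (1 / 2) (Num.min del e') by rewrite !lt_min half0 d0.
apply: filterS2 HC (near_enorm x0 m0) => x HCx; rewrite !lt_min => /and3P[h1 h2 h3].
have [i E] := gen_tr x0 x CF; rewrite E.
have hh : enorm (x - x0) < 1 by lra.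
rewrite (derive_coordf _ _ hh) opprD addrA subrr sub0r normrN.
apply: le_trans (half_share e0 C0); rewrite -/e'.
have JE y : jmp (coordf j) (x - x0) y = (coordf j (x - x0 + y) - coordf j y) - (x - x0) 0 j.
  by rewrite /jmp (derive_coordf _ _ hh) {2}/coordf (chi_in chi_bounds hh) /coordf; ring.
apply: (Rintegral_outside i _ _ _ HCx).
- exact: mulr_ge0 (ler0n _ 2) (ltW e'0).
- clear HCx i E => y y1; rewrite JE /coordf !(chi_in chi_bounds) ?mulr1.
    by rewrite (rvD (x - x0) y); ring.
    by lra.
  by apply: le_lt_trans (enormD _ _) _; lra.
- clear HCx i E => y; rewrite JE; apply: le_trans (ler_normB _ _) _.
  rewrite mulrDl mul1r; apply: lerD; last exact: le_trans (coord_le_enorm _ _) (ltW h3).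
  by apply: Hd; rewrite -addrA subrr addr0.
Qed.

Lemma gen_b : continuous b.
Proof. by apply: cont_rV => j; exact: gen_b_coord. Qed.

Definition sqf (s : R) (y : 'rV[R]_d) : R := dotp y y * dil s y.

Lemma Cc_inf_sqf s : 0 < s -> Cc_inf (sqf s).
Proof. by move=> s0; apply: Cc_infM; [exact: smooth_dotp|exact: Cc_inf_dil]. Qed.

Lemma sqf_in s y : 0 < s -> enorm y < s -> sqf s y = dotp y y.
Proof. by move=> s0 ys; rewrite /sqf (dil_in s0 ys) mulr1. Qed.

Lemma sqf_ge0 s y : 0 <= sqf s y.
Proof. by rewrite mulr_ge0 ?dotp_ge0 ?dil_ge0. Qed.

Lemma derive_sqf s h v : 0 < s -> enorm h < s -> 'D_v (sqf s) h = 2 * dotp h v.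
Proof.
move=> s0 hs; have [_ <-] := is_derive_dotp h v.
apply: near_eq_derive; apply: filterS (near_enorm_lt hs) => u us.
by rewrite sqf_in.
Qed.

Lemma jmp_sqf_in s h y : 0 < s -> s <= 1 / 2 -> enorm h < s / 2 -> enorm y < s / 2 ->
  jmp (sqf s) h y = enorm y ^+ 2.
Proof.
move=> s0 s1 hs ys; have hs1 : enorm h < s by lra.
have hy : enorm (h + y) < s by apply: le_lt_trans (enormD _ _) _; lra.
rewrite /jmp (derive_sqf _ s0 hs1) (sqf_in s0 hs1) (sqf_in s0 hy).
rewrite (chi_in chi_bounds) ?enorm_sqr; last by lra.
by rewrite dotpDl !dotpDr (dotpC y h); ring.
Qed.

(** Only a lower bound is needed, so [sqf s (h + y) >= 0] is dropped. The constant is 1 for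
    [enorm h ^+ 2 <= enorm h] plus 4 for the compensator, which is present only for
    [enorm y < 2]. *)
Lemma jmp_sqf_out s h y : 0 < s -> s <= 1 / 2 -> enorm h < s / 2 ->
  - (5 * enorm h) <= jmp (sqf s) h y.
Proof.
move=> s0 s1 hs; have hs1 : enorm h < s by lra.
rewrite /jmp (derive_sqf _ s0 hs1) (sqf_in s0 hs1) -enorm_sqr.
have g0 := sqf_ge0 s (h + y); have h0 := enorm_ge0 h.
have h2 : enorm h ^+ 2 <= enorm h by rewrite expr2 ler_piMr//; lra.
have B : chi y * (2 * dotp h y) <= 4 * enorm h.
  have [y2|y2] := leP 2 (enorm y); first by rewrite (chi_out chi_bounds y2) mul0r; lra.
  have cs := le_trans (ler_norm _) (cauchy_schwarz h y).
  have c0 := chi_ge0 chi_bounds y; have c1 := chi_le1 chi_bounds y.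
  have ab := le_trans (ler_norm _) (lexx `|dotp h y|).
  apply: (@le_trans _ _ (chi y * (2 * (enorm h * enorm y)))); first by rewrite ler_wpM2l// ler_wpM2l.
  have y0 := enorm_ge0 y.
  apply: (@le_trans _ _ (2 * (enorm h * enorm y))); first by rewrite ler_piMl// !mulr_ge0.
  have := ler_wpM2l h0 (ltW y2); lra.
lra.
Qed.

Definition inner (s : R) x : R := Rintegral (nu x) setT (sqf s).

(** For small jumps the compensated increment of [sqf s] is exactly [enorm y ^+ 2]; for the others
    it is at least [- (5 * enorm h)]. The generator is [inner s x0] at [x0], and passing to [x]
    costs terms of order [enorm h], controlled by the local bounds on the drift and on the tail. *)
Lemma small_near (x0 : 'rV[R]_d) (s e : R) : 0 < s -> s <= 1 / 2 -> 0 < e ->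
  \forall x \near x0, (\int[nu x]_(y in @punct R d `&` [set y : 'rV[R]_d | (enorm y < s / 2)%R])
    (enorm y ^+ 2)%:E <= (inner s x0 + e)%:E)%E.
Proof.
move=> s0 s1 e0; have CF := Cc_inf_sqf s0.
have e2 : 0 < e / 2 by rewrite divr_gt0.
have s2 : 0 < s / 2 by rewrite divr_gt0.
have N := cont_near x0 (Hgen (Cc_inf_tr x0 CF)) e2.
have [C C0 HC] := tail_locbdd x0 s2.
have Nb := cont_near x0 (cont_comp gen_b (@continuous_enorm R d)) ltr01.
(* [Q] collects the coefficients of [enorm h], from the derivative [2 * dotp h (b x)] and from the
   large jumps; the final 1 makes it positive. *)
pose Q := 2 * (enorm (b x0) + 1) + 5 * C + 1.
have Q0 : 0 < Q by rewrite /Q; have := enorm_ge0 (b x0); lra.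
have m0 : 0 < Num.min (s / 2) (e / 2 / Q) by rewrite lt_min s2 divr_gt0.
have E0 : gen (tr x0 (sqf s)) x0 = inner s x0.
  have [_ ->] := gen_tr x0 x0 CF.
  rewrite subrr derive_sqf ?enorm0// dotp0l mulr0 add0r; apply: eq_Rintegral => y _.
  by rewrite /jmp derive_sqf ?enorm0// dotp0l add0r !mulr0 subr0 /sqf dotp0l mul0r subr0.
have {}N : \forall x \near x0, gen (tr x0 (sqf s)) x <= inner s x0 + e / 2.
  by apply: filterS N => x; rewrite E0 ler_norml => /andP[? ?]; lra.
have {}Nb : \forall x \near x0, enorm (b x) <= enorm (b x0) + 1.
  by apply: filterS Nb => x; rewrite ler_norml => /andP[? ?]; lra.
apply: filterS2 (filterI HC (near_enorm x0 m0)) (filterI N Nb) => x [HCx].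
rewrite lt_min => /andP[h1 h2] [Nx Nbx].
have [i E] := gen_tr x0 x CF.
set h := x - x0 in h1 h2 i E *; have h0 := enorm_ge0 h.
have hs : enorm h < s by lra.
rewrite E (derive_sqf _ s0 hs) in Nx.
have cs : - (enorm h * enorm (b x)) <= dotp h (b x).
  by have := cauchy_schwarz h (b x); rewrite ler_norml => /andP[].
have cs2 := ler_wpM2l h0 Nbx.
rewrite (ltr_pdivlMr _ _ Q0) /Q in h2.
pose B := [set y : 'rV[R]_d | (enorm y < s / 2)%R] : set (BRd R d).
have mB : measurable B by apply: open_measurable_BRd; exact: open_enorm_lt.
rewrite -/B integral_mkcondr (integral_punct (nu x)); last first.
  by rewrite patchE enorm0 expr0n/=; case: ifP.
under eq_integral do rewrite patchE.
rewrite (_ : (fun y => _) = (fun y => (enorm y ^+ 2 * \1_B y)%:E)); last first.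
  by apply/funext => y; rewrite indicE; case: ifPn => _; rewrite ?mulr1 ?mulr0.
have B0 y : 0 <= \1_B y :> R by rewrite indicE.
apply: (@le_trans _ _ ((inner s x0 + e / 2 + 2 * (enorm h * (enorm (b x0) + 1))) + (5 * enorm h) * C)%:E); last first.
  by rewrite lee_fin; lra.
apply: (ge0_integral_split_le (A := jmp (sqf s) h) (D := [set y : 'rV[R]_d | (s / 2 <= enorm y)%R]) i).
- apply: measurable_funM; last exact: measurable_indic.
  apply: cont_measurable; under eq_fun do rewrite expr2.
  by apply: contM; exact: continuous_enorm.
- by move=> y; exact: mulr_ge0 (sqr_ge0 _) (B0 y).
- exact: measurable_enorm_ge.
- exact: mulr_ge0 (ler0n _ 5) h0.
- move=> y; clear i HCx E Nx; have [ys|ys] := ltP (enorm y) (s / 2).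
    rewrite (jmp_sqf_in s0 s1 h1 ys) [\1_B y]indicE mem_set// mulr1 lerDl.
    by apply: mulr_ge0; [exact: mulr_ge0 (ler0n _ 5) h0|rewrite indicE].
  rewrite [\1_B y]indicE memNset ?mulr0; last by rewrite /B /= ltNge ys.
  rewrite indicE mem_set// mulr1.
  by rewrite -lerBlDr sub0r; exact: jmp_sqf_out.
- by clear i HCx E; lra.
- exact: HCx.
Qed.

Lemma inner_cvg0 x : inner (k.+2%:R)^-1 x @[k --> \oo] --> (0 : R).
Proof.
have -> : 0 = Rintegral (nu x) setT (fun _ => 0) :> R by rewrite /Rintegral integral0.
(* Starting the scales at 1/2 makes [sqf] vanish from radius 1 on, so that it stays below [m2]. *)
have k0 k : (0 : R) < k.+2%:R^-1 by rewrite invr_gt0.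
apply: (@Rintegral_dct _ (BRd R d) R (nu x) setT (fun k y => sqf k.+2%:R^-1 y) (fun _ => 0) (@m2 R d)) => //.
- move=> k; apply: cont_measurable.
  by have /Cc_infP[/smooth_cont] := Cc_inf_sqf (k0 k).
- move=> y _; apply/cvgrPdist_le => e e0.
  have [->|y0] := eqVneq y 0.
    by apply: nearW => k; rewrite /sqf dotp0l mul0r subrr normr0 ltW.
  have ey : 0 < enorm y.
    by rewrite lt_neqAle enorm_ge0 andbT eq_sym; apply: contraNneq y0 => /enorm_eq0 ->.
  have [N _ HN] : \forall k \near \oo, 2 * k.+2%:R^-1 <= enorm y.
    exists (Num.bound (2 / enorm y)) => // k /= Hk.
    rewrite ler_pdivrMr// mulrC -ler_pdivrMr//.
    have := archi_boundP (divr_ge0 (ler0n R 2) (ltW ey)) => /ltW/le_trans; apply.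
    by rewrite ler_nat; apply: leq_trans Hk _; rewrite -addn2 leq_addr.
  by exists N => // k /HN yk; rewrite /sqf dil_out// mulr0 subrr normr0 ltW.
- exact: integrable_m2.
- move=> k y _; rewrite ger0_norm ?sqf_ge0//.
  have [y1|y1] := ltP (enorm y) 1.
    by rewrite m2_small ?(ltW y1)// enorm_sqr /sqf ler_piMr ?dotp_ge0 ?dil_le1.
  rewrite /sqf dil_out ?mulr0 ?m2_ge0//; apply: le_trans y1.
  by rewrite ler_pdivrMr// mul1r ler_nat.
Qed.

Lemma gen_small (K : set 'rV[R]_d) : compact K ->
  forall e : R, 0 < e -> exists2 del : R, 0 < del & forall r : R, 0 < r -> r < del ->
    forall x, K x ->
      (\int[nu x]_(y in @punct R d `&` [set y : 'rV[R]_d | (enorm y <= r)%R])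
          (enorm y ^+ 2)%:E <= e%:E)%E.
Proof.
move=> cK e e0; have e2 : 0 < e / 2 by rewrite divr_gt0.
pose P (r : R) x := (\int[nu x]_(y in @punct R d `&` [set y : 'rV[R]_d | (enorm y <= r)%R])
          (enorm y ^+ 2)%:E <= e%:E)%E.
(* The covering argument used for the tails, now with radii tending to 0 from the right. *)
have HP x : K x -> \forall x' \near x & r \near 0^'+, P r x'.
  move=> _; have /cvgrPdist_le/(_ _ e2)[N _ /(_ N (leqnn N)) /=] := inner_cvg0 x.
  rewrite sub0r normrN => /(le_trans (ler_norm _)) HN.
  set s := N.+2%:R^-1 in HN.
  have s0 : 0 < s by rewrite invr_gt0.
  have s1 : s <= 1 / 2 by rewrite div1r lef_pV2 ?posrE// ler_nat.
  exists ([set z | (\int[nu z]_(y in @punct R d `&` [set y : 'rV[R]_d | (enorm y < s / 2)%R])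
    (enorm y ^+ 2)%:E <= (inner s x + e / 2)%:E)%E], [set r | r < s / 2]) => /=.
    by split; [exact: small_near|apply: nbhs_right_lt; rewrite divr_gt0].
  move=> [z r] [/= Hz Hr]; rewrite /P.
  apply: (@le_trans _ _ (\int[nu z]_(y in @punct R d `&` [set y : 'rV[R]_d | (enorm y < s / 2)%R])
    (enorm y ^+ 2)%:E)%E).
    apply: ge0_subset_integral.
    - by apply: measurableI; [exact: measurable_punct|exact: measurable_enorm_le].
    - apply: measurableI; first exact: measurable_punct.
      by apply: open_measurable_BRd; exact: open_enorm_lt.
    - apply: measurable_funTS; apply/measurable_EFinP.
      apply: cont_measurable; under eq_fun do rewrite expr2.
      by apply: contM; exact: continuous_enorm.
    - by move=> y _; rewrite lee_fin sqr_ge0.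
    - by move=> y [? /= yr]; split => //=; exact: le_lt_trans yr Hr.
  by apply: le_trans Hz _; rewrite lee_fin; lra.
have [del /= d0 Hd] := (compact_near_coveringP _).1 cK R _ P _ HP.
exists del => // r r0 rd x Kx; apply: (Hd r) => //=.
by rewrite sub0r normrN gtr0_norm.
Qed.

Lemma integrable_away x (f : 'rV[R]_d -> R) (s : R) : 0 < s -> continuous f -> bsupp f ->
  (forall y, enorm y < s -> f y = 0) -> (nu x).-integrable setT (EFin \o f).
Proof.
move=> s0 cf bf fs; have [B B0 fB] := cont_bsupp_bounded cf bf.
pose k := Num.min (s ^+ 2) 1.
have k0 : 0 < k by rewrite lt_min exprn_gt0// ltr01.
apply: (integrable_le_m2 (nu_levy x) (K := B / k) cf) => y.
have [/fs ->|ys] := ltP (enorm y) s; first by rewrite normr0 mulr_ge0 ?m2_ge0// divr_ge0// ltW.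
apply: le_trans (fB y) _; rewrite -mulrA ler_peMr// mulrC ler_pdivlMr// mul1r /m2 /k.
rewrite le_min !ge_min lexx orbT andbT; apply/orP; left.
by rewrite lerXn2r// nnegrE ?enorm_ge0// ltW.
Qed.

(** A mollification [g] of [f] still vanishes near the origin, so its translate has generator equal
    to the integral of [g (h + y)], without drift or compensator. This integrand is within [2 * e']
    of [f], and both vanish for [enorm y < s / 4], outside of which the mass is locally bounded. *)
Lemma gen_vague (f : 'rV[R]_d -> R) : continuous f -> compact (supp f) -> ~ supp f 0 ->
  continuous (fun z => Rintegral (nu z) (@punct R d) f).
Proof.
move=> cf /bsuppP bf /not_supp0P[s s0 fs].
have f0 : f 0 = 0 by rewrite fs// enorm0.
apply: cont_unif_approx => x0 e e0.
have s4 : 0 < s / 4 by rewrite divr_gt0.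
have [C C0 HC] := tail_locbdd x0 s4.
pose e' := e / (2 * (C + 1)).
have e'0 : 0 < e' by rewrite divr_gt0// mulr_gt0// ltr_wpDl.
have [del d0 Hd] := bsupp_unif_cont cf bf e'0.
(* The mollifier [dil t] has radius [2 * t]: at most [del], for uniform closeness, and at most
   [s / 2], so that [g] vanishes on the ball of radius [s / 2]. *)
pose t := Num.min del (s / 2) / 2.
have t0 : 0 < t by rewrite divr_gt0// lt_min d0 divr_gt0.
have t2 : 2 * t = Num.min del (s / 2) by rewrite /t mulrC divfK.
have t20 : 0 < 2 * t by rewrite mulr_gt0.
have Hd' x y : enorm (x - y) < 2 * t -> `|f x - f y| <= e'.
  by rewrite t2 lt_min => /andP[/Hd].
have p00 : 0 < dil t 0 by rewrite dil_in ?enorm0.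
have [g [Cg fg g0]] := mollify cf bf e'0 t20 Hd' (Cc_inf_dil t0) (dil_ge0 t) p00
  (fun a => @dil_out t a t0).
have {}g0 y : enorm y < s / 2 -> g y = 0.
  move=> ys; apply: g0 => a; rewrite t2 lt_min => /andP[_ ay]; apply: fs.
  by rewrite -(subrK y a); apply: le_lt_trans (enormD _ _) _; lra.
have /Cc_infP[sg bg] := Cg.
have [del2 d20 Hd2] := bsupp_unif_cont (smooth_cont sg) bg e'0.
exists (gen (tr x0 g)); first by apply: Hgen; exact: Cc_inf_tr.
have m0 : 0 < Num.min (s / 4) del2 by rewrite lt_min s4.
apply: filterS2 HC (near_enorm x0 m0) => x HCx; rewrite lt_min => /andP[h1 h2].
have [i E] := gen_tr x0 x Cg; rewrite E.
set h := x - x0 in h1 h2 i E *; have hs : enorm h < s / 2 by lra.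
have Dg v : 'D_v g h = 0.
  rewrite -(derive_cst (0 : R) h v); apply: near_eq_derive.
  by apply: filterS (near_enorm_lt hs) => u us; rewrite g0.
have J : jmp g h = (fun y => g (h + y)).
  by apply/funext => y; rewrite /jmp Dg (g0 h hs) mulr0 !subr0.
rewrite Dg add0r J in i *.
have if_ := integrable_away x s0 cf bf fs.
rewrite (Rintegral_punct (nu x) f0).
rewrite -(RintegralB measurableT if_ i).
apply: le_trans (half_share e0 C0); rewrite -/e'.
apply: (Rintegral_outside _ _ _ _ HCx).
- exact: (integrableB measurableT if_ i).
- exact: mulr_ge0 (ler0n _ 2) (ltW e'0).
- clear HCx i if_ E => y ys; rewrite fs ?g0 ?subrr//; last by lra.
  by apply: le_lt_trans (enormD _ _) _; lra.
- clear HCx i if_ E => y; rewrite (_ : f y - g (h + y) = (f y - g y) - (g (h + y) - g y)); last by ring.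
  apply: le_trans (ler_normB _ _) _; rewrite mulrDl mul1r; apply: lerD; first exact: fg.
  by apply: Hd2; rewrite -addrA subrr addr0.
Qed.

End generator_continuous.

Lemma cond_iv_iii : cond_iv q -> cond_iii b nu.
Proof.
move=> /cond_iv_gen Hgen; split.
- exact: gen_b Hgen.
- exact: gen_vague Hgen.
- exact: gen_tight Hgen.
- exact: gen_small Hgen.
Qed.

End symbol.

Theorem theoremA1 (R : realType) (d : nat)
  (chi : 'rV[R]_d -> R) (q0 : 'rV[R]_d -> R) (b : 'rV[R]_d -> 'rV[R]_d)
  (nu : 'rV[R]_d -> {measure set (BRd R d) -> \bar R})
  (chi_Cc : Cc_inf chi)
  (chi_bounds : forall y : 'rV[R]_d,
     (if enorm y < 1 then 1 else 0) <= chi y <= (if enorm y < 2 then 1 else 0))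
  (q0_ge0 : forall x, 0 <= q0 x)
  (nu0 : forall x, nu x [set (0 : 'rV[R]_d)] = 0%E)
  (nu_levy : forall x,
     (\int[nu x]_(y in @punct R d) (Num.min (enorm y ^+ 2) 1)%:E < +oo)%E)
  (q_locbdd : forall K : set 'rV[R]_d, compact K ->
     exists2 c : R, 0 < c & forall x xi, K x ->
       cmod (qsym q0 b nu chi x xi) <= c * (1 + enorm xi ^+ 2)) :
  [<-> cond_i (qsym q0 b nu chi);
       cond_ii (qsym q0 b nu chi);
       cond_iii b nu;
       cond_iv (qsym q0 b nu chi)].
Proof.
have i_iv := cond_i_iv chi_Cc chi_bounds nu_levy q_locbdd.
have iv_iii : cond_iv (qsym q0 b nu chi) -> cond_iii b nu.
  exact: cond_iv_iii chi_Cc chi_bounds nu0 nu_levy.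
have iii_ii := cond_iii_ii q0 chi_Cc chi_bounds nu_levy.
have ii_i : cond_ii (qsym q0 b nu chi) -> cond_i (qsym q0 b nu chi) by case.
tfae.
- by move/i_iv/iv_iii/iii_ii.
- by move/ii_i/i_iv/iv_iii.
- by move/iii_ii/ii_i/i_iv.
- by move/iv_iii/iii_ii/ii_i.
Qed.
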